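(* In the signal detection model described in the context, suppose $T_n$ converges in distribution to $\xi_1$ under $P_{(n)}$ and to $\xi_2$ under $Q_{(n)}$, where $\xi_1,\xi_2$ are $[-\infty,\infty]$-valued random variables with distributions $\nu_1,\nu_2$. For $x>0$ let $$I_{n,1,x}=\sum_{i=1}^{k_n}\varepsilon_{n,i}\,\mu_{n,i}\Bigl(\varepsilon_{n,i}\frac{d\mu_{n,i}}{dP_{n,i}}>x\Bigr),$$ $$I_{n,2,x}=\sum_{i=1}^{k_n}\varepsilon_{n,i}^2\,E_{P_{n,i}}\Bigl(\Bigl(\frac{d\mu_{n,i}}{dP_{n,i}}\Bigr)^2\mathbf 1\Bigl\{\varepsilon_{n,i}\frac{d\mu_{n,i}}{dP_{n,i}}\le x\Bigr\}-1\Bigr).$$ Then $\xi_1$ is real-valued if and only if the following (a) and (b) hold: (a) There are a dense subset $\mathcal D$ of $(0,\infty)$ and a measure $M$ on the Borel sets of $(0,\infty]$ such that for all $x\in\mathcal D$ $$\lim_{n\to\infty}I_{n,1,e^x-1}=M(x,\infty]<\infty.$$ (b) For some $\sigma^2\in[0,\infty)$, $$\lim_{x\searrow0}\limsup_{n\to\infty}I_{n,2,x}=\lim_{x\searrow0}\liminf_{n\to\infty}I_{n,2,x}=\sigma^2.$$ If (a) and (b) hold, then $\nu_2(\mathbb R)=\exp(-M(\{\infty\}))$; moreover, with $(\gamma_1,\sigma_1^2,\eta_1)$ and $(\gamma_2,\sigma_2^2,\eta_2)$ the Lévy–Khintchine triplets of the (infinitely divisible) distributions $\nu_1$ and $\nu_2(\mathbb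 R)^{-1}\nu_{2|\mathbb R}$, one has $\sigma^2=\sigma_1^2=\sigma_2^2$ and $\eta_2-\eta_1=M_{|(0,\infty)}$.
   Context: Model: $k_n\in\mathbb N$ with $k_n\to\infty$. For each $n$ and $1\le i\le k_n$, $P_{n,i}$ (noise) and $\mu_{n,i}$ (signal) are probability measures on a common measurable space (which may depend on $n,i$) with $\mu_{n,i}\ll P_{n,i}$, and $\varepsilon_{n,i}\in[0,1]$ with $\max_{1\le i\le k_n}\varepsilon_{n,i}\to0$. Put $Q_{n,i}=(1-\varepsilon_{n,i})P_{n,i}+\varepsilon_{n,i}\mu_{n,i}$, $P_{(n)}=\bigotimes_{i=1}^{k_n}P_{n,i}$ (null), $Q_{(n)}=\bigotimes_{i=1}^{k_n}Q_{n,i}$ (alternative). The observations $Y_{n,i}$ are the coordinates, and $T_n=\sum_{i=1}^{k_n}\log\frac{dQ_{n,i}}{dP_{n,i}}(Y_{n,i})$. Convergence in distribution is on the compact space $[-\infty,\infty]$. It is known in this model that if $\xi_1$ is real-valued, then $\nu_2(\mathbb R)>0$ and $\nu_1$ and $\nu_2(\mathbb R)^{-1}\nu_{2|\mathbb R}$ are infinitely divisible on $\mathbb R$ with Lévy measures concentrated on $(0,\infty)$. An infinitely divisible distribution on $\mathbb R$ has Lévy–Khintchine triplet $(\gamma,\sigma^2,\eta)$ ($\gamma\in\mathbb R$, $\sigma^2\ge0$, $\eta$ a measure on $\mathbb R\setminus\{0\}$ with $\int\min(x^2,1)\,d\eta<\infty$) if its characteristic function is $$t\mapsto\exp\Bigl[\mathrm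 i\gamma t-\frac{\sigma^2t^2}{2}+\int_{\mathbb R\setminus\{0\}}\Bigl(e^{\mathrm itx}-1-\frac{\mathrm itx}{1+x^2}\Bigr)d\eta(x)\Bigr].$$ Equality $\eta_2-\eta_1=M_{|(0,\infty)}$ means $\eta_2=\eta_1+M_{|(0,\infty)}$ on Borel subsets of $(0,\infty)$. *)

(* Defs.v *)
From HB Require Import structures.
From mathcomp Require Import all_boot all_order all_algebra.
From mathcomp Require Import all_classical all_reals all_analysis.
From mathcomp Require Import measurable_realfun.
From mathcomp.real_closed Require Import complex.

Set Implicit Arguments.
Unset Strict Implicit.
Unset Printing Implicit Defensive.
Import Order.TTheory GRing.Theory Num.Theory.
Import numFieldNormedType.Exports.
Local Open Scope classical_set_scope.
Local Open Scope ring_scope.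
Local Open Scope complex_scope.

Section product_space.
Context (k : nat) (d : 'I_k -> measure_display)
  (T : forall i, measurableType (d i)).

Definition cylinders : set (set (forall i, T i)) :=
  [set C | exists i (B : set (T i)), measurable B /\ C = [set w | B (w i)]].

(* The library only has powers (tuples over one space) and binary products. *)
Definition product_space : Type := g_sigma_algebraType cylinders.

HB.instance Definition _ := Measurable.on product_space.

Lemma measurable_coord i :
  measurable_fun [set: product_space] (fun w : product_space => w i).
Proof.
move=> _ B mB; rewrite setTI; apply: sub_sigma_algebra.
by exists i, B.
Qed.

Lemma measurable_fun_coordP d0 (S : measurableType d0)
    (f : S -> product_space) :
  (forall i, measurable_fun [set: S] (fun s => f s i)) ->
  measurable_fun [set: S] f.
Proof.
move=> mf; apply: (@measurability _ _ S product_space setT f cylinders) => //.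
move=> _ [_ [i [B [mB ->]]] <-].
exact: mf.
Qed.

End product_space.

Section product_probability.
Context (R : realType).

Lemma product_probability_ex (k : nat) (d : 'I_k -> measure_display)
    (T : forall i, measurableType (d i)) (P : forall i, probability (T i) R) :
  {PP : probability (product_space T) R |
    forall A : forall i, set (T i), (forall i, measurable (A i)) ->
      PP [set w : product_space T | forall i, A i (w i)]
      = (\prod_(i < k) P i (A i))%E}.
Proof.
apply: cid; elim: k => [|k IH] in d T P *.
  exists (dirac (point : product_space T)) => A mA.
  rewrite big_ord0 (_ : [set _ | _] = setT) ?probability_setT//.
  by apply/seteqP; split=> // w _ [].
have [PP PPE] := IH _ (fun i => T (lift ord0 i)) (fun i => P (lift ord0 i)).
pose S := product_space (fun i => T (lift ord0 i)).
pose cons (z : T ord0 * S) : product_space T := fun i =>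
  match unliftP ord0 i with
  | UnliftSome j e => eq_rect_r (fun i => T i : Type) (z.2 j) e
  | UnliftNone e => eq_rect_r (fun i => T i : Type) z.1 e
  end.
have cons0 z : cons z ord0 = z.1.
  rewrite /cons; case: unliftP => [j e|e].
    by move/eqP: (neq_lift ord0 j).
  by rewrite (eq_irrelevance e erefl).
have consS z j : cons z (lift ord0 j) = z.2 j.
  rewrite /cons; case: unliftP => [j' e|e]; last first.
    by move/eqP: (neq_lift ord0 j); case; exact: esym.
  have jj := lift_inj e; case: _ / jj in e *.
  by rewrite (eq_irrelevance e erefl).
have mcons : measurable_fun setT cons.
  apply: measurable_fun_coordP => i; case: (unliftP ord0 i) => [j|] ->.
    apply: (eq_measurable_fun (fun z : T ord0 * S => z.2 j)) => [z _|].
      by rewrite consS.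
    apply: (measurableT_comp (f := fun w : S => w j) _ measurable_snd).
    exact: measurable_coord.
  apply: (eq_measurable_fun (fun z : T ord0 * S => z.1)) => [z _|].
    by rewrite cons0.
  exact: measurable_fst.
pose consM : {mfun _ >-> _} :=
  HB.pack cons (isMeasurableFun.Build _ _ _ _ cons mcons).
exists (distribution (P ord0 \x PP)%E consM) => A mA.
rewrite big_ord_recl -PPE//.
rewrite /distribution /pushforward/= -product_measure1E//.
- congr (_ _); apply/seteqP; split => [z /= zA|z /= [z1 z2] i].
    split; first by rewrite -cons0; exact: zA.
    by move=> j; rewrite -consS; exact: zA.
  by case: (unliftP ord0 i) => [j|] ->; rewrite ?consS ?cons0.
- rewrite (_ : [set _ | _] = \bigcap_(i in [set: 'I_k])
      (fun w : S => w i) @^-1` A (lift ord0 i)).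
    apply: fin_bigcap_measurable => // i _; rewrite -[X in measurable X]setTI.
    exact: measurable_coord.
  by apply/seteqP; split=> [w wA i _|w wA i]; exact: wA.
Qed.

Context (k : nat) (d : 'I_k -> measure_display)
  (T : forall i, measurableType (d i)) (P : forall i, probability (T i) R).

Definition product_probability : probability (product_space T) R :=
  sval (product_probability_ex P).

Lemma product_probabilityE (A : forall i, set (T i)) :
  (forall i, measurable (A i)) ->
  product_probability [set w : product_space T | forall i, A i (w i)]
  = (\prod_(i < k) P i (A i))%E.
Proof. exact: (svalP (product_probability_ex P)). Qed.

End product_probability.

Local Open Scope ereal_scope.
Local Open Scope charge_scope.

(* A finite-valued version of the density; it is only determined up to a P-null
   set, on which it may be negative. *)
Definition density d (T : measurableType d) (R : realType)
    (mu P : probability T R) : T -> \bar R :=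
  'd (charge_of_finite_measure mu) '/d P.

Section mixture.
Context d (T : measurableType d) (R : realType).
Variables (e : {i01 R}) (P mu : probability T R).

Definition mixture (A : set T) : \bar R :=
  (1 - e%:num)%:E * P A + e%:num%:E * mu A.

Let onem_e_ge0 : (0 <= 1 - e%:num :> R)%R.
Proof. by rewrite subr_ge0. Qed.

Let e_ge0 : (0 <= e%:num :> R)%R.
Proof. by []. Qed.

Let mixtureE :
  mixture =
  measure_add (mscale (NngNum onem_e_ge0) P) (mscale (NngNum e_ge0) mu).
Proof. by apply/funext => A; rewrite measure_addE. Qed.

Let mixture0 : mixture set0 = 0.
Proof. by rewrite /mixture !measure0 !mule0 adde0. Qed.

Let mixture_ge0 A : 0 <= mixture A.
Proof. by rewrite adde_ge0// mule_ge0// lee_fin. Qed.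

Let mixture_sigma_additive : semi_sigma_additive mixture.
Proof. by rewrite mixtureE; exact: measure_semi_sigma_additive. Qed.

HB.instance Definition _ := isMeasure.Build _ _ _ mixture
  mixture0 mixture_ge0 mixture_sigma_additive.

Let mixture_setT : mixture setT = 1.
Proof.
by rewrite /mixture !probability_setT !mule1 -EFinD subrK.
Qed.

HB.instance Definition _ := Measure_isProbability.Build _ _ _ mixture
  mixture_setT.

End mixture.

Section detection_statistics.
Context (R : realType) (k : nat) (d : 'I_k -> measure_display)
  (T : forall i, measurableType (d i)).
Variables (P mu : forall i, probability (T i) R) (eps : 'I_k -> {i01 R}).

Definition null_law : probability (product_space T) R := product_probability P.

Definition alt_law : probability (product_space T) R :=
  product_probability (fun i => mixture (eps i) (P i) (mu i)).

Definition loglik (y : product_space T) : \bar R :=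
  \sum_(i < k) lne (density (mixture (eps i) (P i) (mu i)) (P i) (y i)).

Definition I1 (x : R) : \bar R :=
  \sum_(i < k) (eps i)%:num%:E *
    mu i [set w | x%:E < (eps i)%:num%:E * density (mu i) (P i) w].

(* For eps i = 0 the integral can be +oo; the library's 0 * +oo is 0. *)
Definition I2 (x : R) : \bar R :=
  \sum_(i < k) ((eps i)%:num ^+ 2)%:E *
    \int[P i]_w (density (mu i) (P i) w ^+ 2 *
      (\1_[set v | ((eps i)%:num%:E * density (mu i) (P i) v <= x%:E)%E] w)%:E - 1).

End detection_statistics.

Section convergence_in_distribution.
Context (R : realType) (d : nat -> measure_display)
  (Om : forall n, measurableType (d n)).

(* Weak convergence on the compact space \bar R: every continuous real function
   on it is bounded. *)
Definition cvg_in_distribution (PP : forall n, probability (Om n) R)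
    (X : forall n, Om n -> \bar R) (nu : probability (\bar R) R) : Prop :=
  forall g : \bar R -> R, continuous g ->
    \int[PP n]_w (g (X n w))%:E @[n --> \oo] --> \int[nu]_y (g y)%:E.

End convergence_in_distribution.

Section restriction_to_R.
Context (R : realType) (nu : {measure set (\bar R) -> \bar R}).

Definition restr_R (B : set R) : \bar R := nu (EFin @` B).

Let restr_R0 : restr_R set0 = 0.
Proof. by rewrite /restr_R image_set0 measure0. Qed.

Let restr_R_ge0 B : 0 <= restr_R B. Proof. exact: measure_ge0. Qed.

Let restr_R_sigma_additive : semi_sigma_additive restr_R.
Proof.
move=> F mF tF mUF; rewrite /restr_R image_bigcup.
apply: measure_semi_sigma_additive.
- by move=> n; apply: measurable_image_EFin; exact: mF.
- move=> i j _ _ [_ [[x Fix <-] [y Fjy [yx]]]].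
  by apply: tF => //; exists x; split; rewrite // -yx.
- by rewrite -image_bigcup; apply: measurable_image_EFin; exact: mUF.
Qed.

HB.instance Definition _ := isMeasure.Build _ _ _ restr_R
  restr_R0 restr_R_ge0 restr_R_sigma_additive.

Let inv_mass_ge0 : (0 <= (fine (restr_R setT))^-1)%R.
Proof. by rewrite invr_ge0 fine_ge0. Qed.

Definition normalized_restr_R : {measure set R -> \bar R} :=
  mscale (NngNum inv_mass_ge0) restr_R.

End restriction_to_R.

Section levy_khintchine.
Local Close Scope ereal_scope.
Context (R : realType).
Implicit Types (nu eta : {measure set R -> \bar R}) (t : R).

Definition cexp (z : R[i]) : R[i] :=
  (expR (complex.Re z))%:C * (cos (complex.Im z) +i* sin (complex.Im z)).

Definition cintegral nu (D : set R) (f : R -> R[i]) : R[i] :=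
  (\int[nu]_(x in D) complex.Re (f x)) +i* (\int[nu]_(x in D) complex.Im (f x)).

Definition char_fun nu t : R[i] :=
  cintegral nu setT (fun x => cexp ('i * (t * x)%:C)).

(* Measures on R \ {0} are encoded as measures on R not charging 0. *)
Definition levy_measure eta : Prop :=
  eta [set 0] = 0%E /\
  (\int[eta]_(x in [set~ 0%R]) (Num.min (x ^+ 2) 1)%:E < +oo)%E.

(* A probability measure nu with such a triplet is infinitely divisible. *)
Definition levy_khintchine_triplet nu (gamma sigma2 : R) eta : Prop :=
  [/\ 0 <= sigma2, levy_measure eta &
    forall t, char_fun nu t =
      cexp ('i * (gamma * t)%:C - (sigma2 * t ^+ 2 / 2)%:C +
        cintegral eta [set~ 0] (fun x =>
          cexp ('i * (t * x)%:C) - 1 - 'i * (t * x / (1 + x ^+ 2))%:C))].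

End levy_khintchine.

Section conditions.
Context (R : realType).
Variables (k : nat -> nat) (d : forall n, 'I_(k n) -> measure_display)
  (T : forall n (i : 'I_(k n)), measurableType (@d n i))
  (P mu : forall n (i : 'I_(k n)), probability (@T n i) R)
  (eps : forall n, 'I_(k n) -> {i01 R}).

Definition dense_in_pos (D : set R) : Prop :=
  D `<=` [set x | (0 < x)%R] /\ [set x | (0 < x)%R] `<=` closure D.

(* Measures on (0, +oo] are encoded as measures on \bar R vanishing off it. *)
Definition condition_a (D : set R) (M : {measure set (\bar R) -> \bar R}) :
    Prop :=
  [/\ dense_in_pos D, M [set y | y <= 0] = 0 &
    forall x, D x ->
      (I1 (@P n) (@mu n) (@eps n) (expR x - 1)) @[n --> \oo]
        --> M [set y | x%:E < y] /\
      M [set y | x%:E < y] < +oo].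

Definition condition_b (sigma2 : R) : Prop :=
  [/\ (0 <= sigma2)%R,
    limn_esup (fun n => I2 (@P n) (@mu n) (@eps n) x) @[x --> 0%R^'+]
      --> sigma2%:E &
    limn_einf (fun n => I2 (@P n) (@mu n) (@eps n) x) @[x --> 0%R^'+]
      --> sigma2%:E].

End conditions.

(* Main.v *)
(* With f_i = dQ_i/dP_i and u_i = ln f_i, let kap_n be the sum over i of the images under u_i of
   (e^{u/2} - 1)^2 P_i, a finite measure on R.  For z in the strip 0 < Re z < 1,
     E_P e^{zT} = prod_i (1 + E_{P_i}(e^{z u_i} - 1 - z (e^{u_i} - 1)))
   is close to exp (int r_z d kap_n) with r_z(u) = (e^{zu} - 1 - z(e^u - 1)) / (e^{u/2} - 1)^2,
   which is bounded and continuous with a limit at +oo.  If the masses of kap_n are bounded, then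
   along any ultrafilter kap_n converges vaguely on [0, +oo] to some m + c delta_{+oo}; letting z tend
   to the two boundary lines of the strip gives the characteristic functions of nu_1 and of nu_2 on
   R in Levy-Khintchine form, with Gaussian part 4 m{0}, Levy measures eta_1 = m / (e^{u/2} - 1)^2
   and eta_2 = e^u eta_1 on u > 0, and nu_2(R) = e^{-c}.  By uniqueness of the triplet, m and c do not
   depend on the ultrafilter, so that kap_n converges, and (a), (b) read off its limit.  The
   masses of kap_n are bounded under (a) and (b), and also when nu_1(R) > 0, because the Hellinger
   affinity E_P e^{T/2} is at most exp (- kap_n(R) / 2). *)
Require Import Defs.
From HB Require Import structures.
From mathcomp Require Import all_boot all_order all_algebra.
From mathcomp Require Import all_classical all_reals all_analysis.
From mathcomp Require Import measurable_realfun.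
From mathcomp Require Import ring lra.
Import Order.TTheory GRing.Theory Num.Theory.
Import numFieldNormedType.Exports.
Local Open Scope classical_set_scope.
Local Open Scope ring_scope.
From mathcomp.real_closed Require Import complex.

Set Implicit Arguments.
Unset Strict Implicit.
Unset Printing Implicit Defensive.

(** The obstacle is mass at -oo and +oo: [T_n] converges only on [-oo, +oo], so its characteristic
    functions under P and Q need not converge to those of the parts of nu_1 and nu_2 on R. In the
    open strip w = e^{zT} / (1 + e^T) vanishes at both ends, and e^{zT} = w + w e^T, where w e^T
    under P is w under Q. Hence E_P e^{zT} converges, and only the restrictions of nu_1 and nu_2 to
    R occur in the limit. As dQ = e^T dP survives on R, the lines Re z = 0 and Re z = 1 recover
    these restrictions. The boundary is reached only after the limit in n, since r_z has no limit at
    +oo when Re z = 1 and Im z is not 0. The term z (e^u - 1) has P_i-integral 0 and makes the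
    numerator of r_z of order u^2 at 0; the Hellinger weight dominates this numerator at 0, at -oo
    and at +oo. Near 0 the weight is u^2 / 4, whence the factor 4 in the variance. No mass of kap_n
    goes to the left, because f_i >= 1 - eps_i. Finally (a) and (b) truncate eps dmu/dP = f - 1 +
    eps, and replacing it by f - 1 costs terms of order eps times bounded quantities. *)

(** * Elementary inequalities for sine, cosine and the exponential *)

Section elementary_bounds.
Context {R : realType}.
Implicit Types x y s t u : R.

(** The mean value theorem, in the form that builds Taylor bounds one degree at a time: each bound
    below is the derivative inequality for the next. *)
Lemma nonneg_of_derive_ge0 (f f' : R -> R) x :
  (forall y, is_derive y (1 : R) f (f' y)) ->
  (forall y, 0 <= y <= x -> 0 <= f' y) -> f 0 = 0 -> 0 <= x -> 0 <= f x.
Proof.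
move=> df f'0 f0 x0.
have [|c cx] := MVT_segment x0 (fun y _ => df y).
  apply: continuous_subspaceT => y.
  by apply/differentiable_continuous/derivable1_diffP; have [] := df y.
rewrite f0 !subr0 => ->; apply: mulr_ge0 => //.
by apply: f'0; move: cx; rewrite in_itv.
Qed.

Lemma sin_le x : 0 <= x -> sin x <= x.
Proof.
move=> x0; rewrite -subr_ge0.
apply: (nonneg_of_derive_ge0 (f := fun y => y - sin y)
  (f' := fun y => 1 - cos y)) => //.
by rewrite sin0 subr0.
Qed.

Lemma cos_ge_poly x : 0 <= x -> 1 - x ^+ 2 / 2 <= cos x.
Proof.
move=> x0; rewrite -subr_ge0.
apply: (nonneg_of_derive_ge0 (f := fun y => cos y - (1 - y ^+ 2 / 2))
  (f' := fun y => y - sin y)) => //.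
- move=> y; apply: is_derive_eq.
  rewrite /GRing.scale/=; lra.
- by move=> y /andP[y0 _]; rewrite subr_ge0 sin_le.
- by rewrite cos0; lra.
Qed.

Lemma sin_ge_poly x : 0 <= x -> x - x ^+ 3 / 6 <= sin x.
Proof.
move=> x0; rewrite -subr_ge0.
apply: (nonneg_of_derive_ge0 (f := fun y => sin y - (y - y ^+ 3 / 6))
  (f' := fun y => cos y - (1 - y ^+ 2 / 2))) => //.
- move=> y; apply: is_derive_eq.
  rewrite /GRing.scale/=; lra.
- by move=> y /andP[y0 _]; rewrite subr_ge0 cos_ge_poly.
- by rewrite sin0; lra.
Qed.

Lemma cos_le_poly x : 0 <= x -> cos x <= 1 - x ^+ 2 / 2 + x ^+ 4 / 24.
Proof.
move=> x0; rewrite -subr_ge0.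
apply: (nonneg_of_derive_ge0
  (f := fun y => 1 - y ^+ 2 / 2 + y ^+ 4 / 24 - cos y)
  (f' := fun y => sin y - (y - y ^+ 3 / 6))) => //.
- move=> y; apply: is_derive_eq.
  rewrite /GRing.scale/=; lra.
- by move=> y /andP[y0 _]; rewrite subr_ge0 sin_ge_poly.
- by rewrite cos0; lra.
Qed.

Lemma expRN_le_poly x : 0 <= x -> expR (- x) <= 1 - x + x ^+ 2 / 2.
Proof.
move=> x0; rewrite -subr_ge0.
apply: (nonneg_of_derive_ge0 (f := fun y => 1 - y + y ^+ 2 / 2 - expR (- y))
  (f' := fun y => expR (- y) - (1 - y))) => //.
- move=> y; apply: is_derive_eq.
  rewrite /GRing.scale/=; lra.
- by move=> y _; rewrite subr_ge0 (le_trans _ (expR_ge1Dx _)).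
- by rewrite oppr0 expR0; lra.
Qed.

Lemma expRN_ge_poly x : 0 <= x -> 1 - x + x ^+ 2 / 2 - x ^+ 3 / 6 <= expR (- x).
Proof.
move=> x0; rewrite -subr_ge0.
apply: (nonneg_of_derive_ge0
  (f := fun y => expR (- y) - (1 - y + y ^+ 2 / 2 - y ^+ 3 / 6))
  (f' := fun y => 1 - y + y ^+ 2 / 2 - expR (- y))) => //.
- move=> y; apply: is_derive_eq.
  rewrite /GRing.scale/=; lra.
- by move=> y /andP[y0 _]; rewrite subr_ge0 expRN_le_poly.
- by rewrite oppr0 expR0; lra.
Qed.

Lemma expR_ge_poly x : 0 <= x -> 1 + x + x ^+ 2 / 2 <= expR x.
Proof.
move=> x0; rewrite -subr_ge0.
apply: (nonneg_of_derive_ge0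
  (f := fun y => expR y - (1 + y + y ^+ 2 / 2))
  (f' := fun y => expR y - (1 + y))) => //.
- move=> y; apply: is_derive_eq.
  rewrite /GRing.scale/=; lra.
- by move=> y _; rewrite subr_ge0 expR_ge1Dx.
- by rewrite expR0; lra.
Qed.

(** Multiplying by [expR (- x)] leaves only the alternating lower bound for [expR (- x)] to be used;
    the cubic coefficient 1 instead of 1/6 pays for the product of the two truncations on [0, 1]. *)
Lemma expR_le_poly x : 0 <= x <= 1 -> expR x <= 1 + x + x ^+ 2 / 2 + x ^+ 3.
Proof.
move=> /andP[x0 x1]; have := expRN_ge_poly x0.
have := expR_gt0 x; have := expRxMexpNx_1 x.
set a := expR x; set b := expR (- x) => ab a0 b1.
have : 1 <= (1 + x + x ^+ 2 / 2 + x ^+ 3) * b.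
  apply: (@le_trans _ _ ((1 + x + x ^+ 2 / 2 + x ^+ 3) *
      (1 - x + x ^+ 2 / 2 - x ^+ 3 / 6))); last first.
    by apply: ler_wpM2l => //; rewrite !addr_ge0// ?exprn_ge0// divr_ge0// exprn_ge0.
  rewrite -subr_ge0.
  rewrite (_ : _ - _ = x ^+ 3 * (5 / 6 - 11 / 12 * x + 5 / 12 * x ^+ 2 - x ^+ 3 / 6)); last by field.
  rewrite mulr_ge0 ?exprn_ge0//.
  have : 0 <= x ^+ 2 * (1 - x) by rewrite mulr_ge0 ?exprn_ge0// subr_ge0.
  rewrite !exprS expr0; nra.
rewrite -(ler_pM2l a0) mulr1 => /le_trans; apply.
by rewrite mulrCA ab mulr1.
Qed.

Lemma sin_lin_bound y : `|sin y - y| <= `|y| ^+ 3.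
Proof.
wlog y0 : y / 0 <= y.
  move=> H; have [/H//|/ltW y0] := leP 0 y.
  have := H (- y); rewrite oppr_ge0 sinN => /(_ y0).
  by rewrite -opprD !normrN.
rewrite (ger0_norm y0) ler_norml; apply/andP; split.
  by have := sin_ge_poly y0; have := exprn_ge0 3 y0; lra.
by have := sin_le y0; have := exprn_ge0 3 y0; lra.
Qed.

Lemma sin_norm_le y : `|sin y| <= `|y|.
Proof.
wlog y0 : y / 0 <= y.
  move=> H; have [/H//|/ltW y0] := leP 0 y.
  by have := H (- y); rewrite oppr_ge0 sinN !normrN; exact.
rewrite (ger0_norm y0) ler_norml sin_le// andbT.
have [y1|y1] := leP y 1; last by rewrite (le_trans _ (sin_geN1 y))// lerN2 ltW.
apply: (le_trans _ (sin_ge_poly y0)).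
suff : y ^+ 3 <= y by lra.
by rewrite exprS ler_piMr// exprn_ile1.
Qed.

Lemma cos_quad_le y : 1 - cos y <= y ^+ 2 / 2.
Proof.
have := cos_ge_poly (normr_ge0 y); rewrite cos_norm real_normK ?num_real//; lra.
Qed.

Lemma cos_quad_bound y : `|cos y - 1 + y ^+ 2 / 2| <= 3 * `|y| ^+ 3.
Proof.
rewrite -(cos_norm y) -(real_normK (num_real y)).
set x := `|y|; have x0 : 0 <= x := normr_ge0 y.
have := exprn_ge0 3 x0; have := cos_ge_poly x0; rewrite ler_norml.
have [x1|/ltW x1] := leP x 1.
  have := cos_le_poly x0.
  have : x ^+ 4 <= x ^+ 3 by rewrite exprS ler_piMl// exprn_ge0.
  by move=> *; apply/andP; split; lra.
have : x ^+ 2 <= x ^+ 3 by rewrite [leRHS]exprS ler_peMl// exprn_ge0.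
have : 1 <= x ^+ 3 by rewrite exprn_ege1.
have := cos_le1 x.
by move=> *; apply/andP; split; lra.
Qed.

Lemma expR_quad_bound y : `|y| <= 1 ->
  `|expR y - 1 - y - y ^+ 2 / 2| <= `|y| ^+ 3.
Proof.
move=> y1; have [y0|/ltW y0] := leP 0 y.
  rewrite (ger0_norm y0) in y1 *.
  have H := expR_le_poly (introT andP (conj y0 y1)).
  by have := expR_ge_poly y0; rewrite ler_norml; move=> ?; apply/andP; split; lra.
rewrite (ler0_norm y0) in y1 *; have y0' : 0 <= - y by lra.
have := expRN_le_poly y0'; have := expRN_ge_poly y0'; have := exprn_ge0 3 y0'.
by rewrite opprK sqrrN ler_norml; move=> *; apply/andP; split; lra.
Qed.

Lemma cube_le y : `|y| <= 1 -> `|y| ^+ 3 <= y ^+ 2.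
Proof.
by move=> y1; rewrite -(real_normK (num_real y)) exprS ler_piMl.
Qed.

Lemma sqr_le_norm y : `|y| <= 1 -> y ^+ 2 <= `|y|.
Proof.
by move=> y1; rewrite -(real_normK (num_real y)) expr2 ler_piMr.
Qed.

Lemma expR_lin_bound y : `|y| <= 1 -> `|expR y - 1 - y| <= 2 * y ^+ 2.
Proof.
move=> y1; have := expR_quad_bound y1; have := cube_le y1.
have := sqr_ge0 y; rewrite !ler_norml; move=> *; apply/andP; split; lra.
Qed.

Lemma expR_cst_bound y : `|y| <= 1 -> `|expR y - 1| <= 3 * `|y|.
Proof.
move=> y1; have := expR_lin_bound y1; have := sqr_le_norm y1.
have := ler_norm y; have := ler_norm (- y); rewrite normrN.
rewrite !ler_norml; move=> *; apply/andP; split; lra.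
Qed.

Lemma expR_half_ge : 3 / 2 <= expR (2^-1 : R).
Proof. by have := expR_ge1Dx (2^-1 : R); lra. Qed.

Lemma continuous_quotient0 (p w : R -> R) (c K : R) :
  continuous p -> continuous w -> (forall u, u != 0 -> w u != 0) ->
  (forall u, u != 0 -> `|u| <= 1 -> `|p u / w u - c| <= K * `|u|) ->
  continuous (fun u => if u == 0 then c else p u / w u).
Proof.
move=> cp cw w0 H u.
have [->|u0] := eqVneq u 0.
  rewrite /continuous_at eqxx.
  apply/cvgrPdist_le => e e0.
  have K0 : 0 < `|K| + 1 by rewrite ltr_wpDl.
  near=> v; case: eqVneq => [_|v0]; first by rewrite subrr normr0 ltW.
  rewrite distrC; apply: (le_trans (H v v0 _)).
    near: v; apply/nbhs_ballP; exists 1 => //= v.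
    by rewrite /ball/= sub0r normrN => /ltW.
  apply: (@le_trans _ _ ((`|K| + 1) * `|v|)).
    by rewrite ler_wpM2r//; have := ler_norm K; lra.
  rewrite mulrC -ler_pdivlMr//.
  near: v; apply/nbhs_ballP; exists (e / (`|K| + 1)) => /=; first exact: divr_gt0.
  by move=> v; rewrite /ball/= sub0r normrN => /ltW.
rewrite /continuous_at (negbTE u0).
have : (fun v => p v / w v) v @[v --> u] --> p u / w u.
  by apply: cvgM; [exact: cp|apply: cvgV; [exact: w0|exact: cw]].
apply: cvg_trans; apply: near_eq_cvg.
near=> v; rewrite ifN//.
near: v; apply: (@cvgr_neq0 _ _ _ (nbhs u) _ id u) => //; exact: cvg_id.
Unshelve. all: by end_near.
Qed.

End elementary_bounds.

(** * The kernel r_z *)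

Section levy_kernel.
Context {R : realType}.
Implicit Types s t u : R.

(** With u = ln f this is (sqrt f - 1)^2, whose P-integral is the unnormalised squared Hellinger
    distance between P and f P. *)
Definition hell u : R := (expR (u / 2) - 1) ^+ 2.

(** [pRe] and [pIm] are the real and imaginary parts of e^{zu} - 1 - z (e^u - 1) for z = s + i t,
    and [rRe], [rIm] are those of r_z. *)
Definition pRe s t u := expR (s * u) * cos (t * u) - 1 - s * (expR u - 1).
Definition pIm s t u := expR (s * u) * sin (t * u) - t * (expR u - 1).

(** The value at 0 is 2 (z^2 - z): up to O(|u|^3) the numerator is (z^2 - z) u^2 / 2 and [hell u] is
    u^2 / 4. *)
Definition rRe s t u :=
  if u == 0 then 2 * (s ^+ 2 - t ^+ 2 - s) else pRe s t u / hell u.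
Definition rIm s t u :=
  if u == 0 then 2 * (2 * s * t - t) else pIm s t u / hell u.

Lemma hell_ge0 u : 0 <= hell u. Proof. exact: sqr_ge0. Qed.

Lemma hell0 : hell 0 = 0.
Proof. by rewrite /hell mul0r expR0 subrr expr0n. Qed.

Lemma hell_neq0 u : u != 0 -> hell u != 0.
Proof.
move=> u0; rewrite expf_neq0// subr_eq0 -[X in _ == X]expR0.
by apply: contra u0 => /eqP/expR_inj/eqP; rewrite mulf_eq0 invr_eq0 pnatr_eq0 orbF.
Qed.

Lemma hell_gt0 u : u != 0 -> 0 < hell u.
Proof. by move=> u0; rewrite lt0r hell_neq0// hell_ge0. Qed.

Lemma pRe0 s t : pRe s t 0 = 0.
Proof. by rewrite /pRe !mulr0 expR0 cos0; lra. Qed.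

Lemma pIm0 s t : pIm s t 0 = 0.
Proof. by rewrite /pIm !mulr0 expR0 sin0; lra. Qed.

Lemma rReK s t u : rRe s t u * hell u = pRe s t u.
Proof.
rewrite /rRe; case: eqVneq => [->|u0]; first by rewrite hell0 mulr0 pRe0.
by rewrite divfK// hell_neq0.
Qed.

Lemma rImK s t u : rIm s t u * hell u = pIm s t u.
Proof.
rewrite /rIm; case: eqVneq => [->|u0]; first by rewrite hell0 mulr0 pIm0.
by rewrite divfK// hell_neq0.
Qed.

(** The lower bounds on [hell] in three regimes (quadratic on [-1, 1], exponential above 1, constant
    below -1) match the growth of [pRe] and [pIm], which is why r_z is bounded. *)
Lemma hell_lb u : `|u| <= 1 -> u ^+ 2 / 16 <= hell u.
Proof.
move=> u1; have [u0|/ltW u0] := leP 0 u.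
  rewrite /hell; have := expR_ge1Dx (u / 2); nra.
have v0 : 0 <= - (u / 2) by lra.
have := expRN_le_poly v0; rewrite opprK /hell.
have : - u <= 1 by rewrite -(ler0_norm u0).
set b := expR _ => u1' H.
have : 1 - b >= - u / 4 by nra.
by move=> ?; nra.
Qed.

Lemma hell_lb_expR u : 1 <= u -> expR u / 16 <= hell u.
Proof.
move=> u1; have -> : expR u = expR (u / 2) ^+ 2.
  by rewrite -expRM_natl; congr expR; lra.
have : 3 / 2 <= expR (u / 2).
  by rewrite (le_trans expR_half_ge)// ler_expR; lra.
by rewrite /hell => ?; nra.
Qed.

Lemma hell_lb_cst u : u <= -1 -> 16^-1 <= hell u.
Proof.
move=> u1; have : expR (u / 2) * (3 / 2) <= 1.
  rewrite -[leRHS](expRxMexpNx_1 (u / 2)); apply: ler_wpM2l; first exact: expR_ge0.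
  by rewrite (le_trans expR_half_ge)// ler_expR; lra.
have := expR_gt0 (u / 2); rewrite /hell => ? ?; nra.
Qed.

(** Difference of squares: with y = u / 2, [hell u - y ^+ 2] is (e^y - 1 - y)(e^y - 1 + y), a
    quadratic times a linear quantity. *)
Lemma hell_quad u : `|u| <= 1 -> `|hell u - u ^+ 2 / 4| <= `|u| ^+ 3.
Proof.
move=> u1; set y := u / 2.
have ny : `|y| = `|u| / 2 by rewrite /y normrM [`|2^-1|]ger0_norm.
have y1 : `|y| <= 1 by rewrite ny; lra.
have -> : hell u - u ^+ 2 / 4 = (expR y - 1 - y) * (expR y - 1 + y).
  rewrite /hell -/y (_ : u ^+ 2 / 4 = y ^+ 2); first by ring.
  by rewrite /y; field.
rewrite normrM; apply: (@le_trans _ _ ((2 * y ^+ 2) * (4 * `|y|))).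
  apply: ler_pM => //; first exact: expR_lin_bound.
  by apply: (le_trans (ler_normD _ _)); have := expR_cst_bound y1; lra.
rewrite -(real_normK (num_real y)) ny le_eqVlt; apply/orP; left; apply/eqP.
by field.
Qed.

(** The constant depends on [t] only: bounds uniform in [s] over the closed interval are needed when
    [s] moves to 0 or 1. *)
Lemma pRe_quad s t u : 0 <= s <= 1 -> `|u| <= 1 ->
  `|pRe s t u - (s ^+ 2 - t ^+ 2 - s) / 2 * u ^+ 2| <=
  (2 + 3 * t ^+ 2 + 12 * `|t| ^+ 3) * `|u| ^+ 3.
Proof.
move=> /andP[s0 s1] u1.
have su : `|s * u| <= `|u| by rewrite normrM (ger0_norm s0) ler_piMl.
have su1 : `|s * u| <= 1 by apply: le_trans su u1.
have su3 : `|s * u| ^+ 3 <= `|u| ^+ 3 by rewrite lerXn2r// nnegrE.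
have E1 := expR_quad_bound su1; have E2 := expR_quad_bound u1.
have E3 := cos_quad_bound (t * u); have E4 := expR_cst_bound su1.
have -> : pRe s t u - (s ^+ 2 - t ^+ 2 - s) / 2 * u ^+ 2 =
    (expR (s * u) - 1 - s * u - (s * u) ^+ 2 / 2)
    - s * (expR u - 1 - u - u ^+ 2 / 2)
    + expR (s * u) * (cos (t * u) - 1 + (t * u) ^+ 2 / 2)
    - (expR (s * u) - 1) * ((t * u) ^+ 2 / 2).
  by rewrite /pRe; field.
have H1 : `|s * (expR u - 1 - u - u ^+ 2 / 2)| <= `|u| ^+ 3.
  rewrite normrM (ger0_norm s0); apply: le_trans E2.
  by rewrite ler_piMl.
have H2 : `|expR (s * u) * (cos (t * u) - 1 + (t * u) ^+ 2 / 2)| <=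
    4 * (3 * (`|t| ^+ 3 * `|u| ^+ 3)).
  rewrite -exprMn -normrM [leLHS]normrM; apply: ler_pM => //.
  rewrite ger0_norm ?expR_ge0//.
  by have := ler_norm (expR (s * u) - 1); lra.
have H3 : `|(expR (s * u) - 1) * ((t * u) ^+ 2 / 2)| <= 3 * t ^+ 2 * `|u| ^+ 3.
  rewrite normrM [X in _ * X]ger0_norm ?divr_ge0 ?sqr_ge0//.
  apply: (@le_trans _ _ (3 * `|u| * (t ^+ 2 * `|u| ^+ 2))).
    apply: ler_pM => //; first by rewrite divr_ge0 ?sqr_ge0.
      by apply: (le_trans E4); lra.
    rewrite real_normK ?num_real// exprMn ler_piMr ?invf_le1 ?ler1n//.
    by rewrite mulr_ge0// sqr_ge0.
  by rewrite le_eqVlt; apply/orP; left; apply/eqP; ring.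
do 3 (apply: (le_trans (ler_normB _ _)) || apply: (le_trans (ler_normD _ _)) ||
  idtac).
have := ler_normD (expR (s * u) - 1 - s * u - (s * u) ^+ 2 / 2
    - s * (expR u - 1 - u - u ^+ 2 / 2))
    (expR (s * u) * (cos (t * u) - 1 + (t * u) ^+ 2 / 2)).
have := ler_normB (expR (s * u) - 1 - s * u - (s * u) ^+ 2 / 2)
    (s * (expR u - 1 - u - u ^+ 2 / 2)).
lra.
Qed.

Lemma pIm_quad s t u : 0 <= s <= 1 -> `|u| <= 1 ->
  `|pIm s t u - (2 * s * t - t) / 2 * u ^+ 2| <=
  (3 * `|t| + 4 * `|t| ^+ 3) * `|u| ^+ 3.
Proof.
move=> /andP[s0 s1] u1.
have su : `|s * u| <= `|u| by rewrite normrM (ger0_norm s0) ler_piMl.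
have su1 : `|s * u| <= 1 by apply: le_trans su u1.
have E1 := expR_lin_bound su1; have E2 := expR_quad_bound u1.
have E3 := sin_lin_bound (t * u); have E4 := expR_cst_bound su1.
have -> : pIm s t u - (2 * s * t - t) / 2 * u ^+ 2 =
    expR (s * u) * (sin (t * u) - t * u)
    + t * u * (expR (s * u) - 1 - s * u)
    - t * (expR u - 1 - u - u ^+ 2 / 2).
  by rewrite /pIm; field.
have H1 : `|t * (expR u - 1 - u - u ^+ 2 / 2)| <= `|t| * `|u| ^+ 3.
  by rewrite normrM; apply: ler_wpM2l.
have H2 : `|expR (s * u) * (sin (t * u) - t * u)| <= 4 * (`|t| ^+ 3 * `|u| ^+ 3).
  rewrite -exprMn -normrM [leLHS]normrM; apply: ler_pM => //.
  rewrite ger0_norm ?expR_ge0//.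
  by have := ler_norm (expR (s * u) - 1); lra.
have H3 : `|t * u * (expR (s * u) - 1 - s * u)| <= 2 * `|t| * `|u| ^+ 3.
  rewrite normrM; apply: (@le_trans _ _ (`|t * u| * (2 * `|u| ^+ 2))).
    apply: ler_wpM2l => //; apply: (le_trans E1).
    rewrite ler_pM2l// -(real_normK (num_real (s * u))) lerXn2r// nnegrE//.
  by rewrite normrM le_eqVlt; apply/orP; left; apply/eqP; ring.
have := ler_normB (expR (s * u) * (sin (t * u) - t * u)
    + t * u * (expR (s * u) - 1 - s * u)) (t * (expR u - 1 - u - u ^+ 2 / 2)).
have := ler_normD (expR (s * u) * (sin (t * u) - t * u))
    (t * u * (expR (s * u) - 1 - s * u)).
lra.
Qed.

Lemma continuous_expRM s : continuous (fun u : R => expR (s * u)).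
Proof.
move=> u; apply: continuous_comp; last exact: continuous_expR.
by apply: cvgM; [exact: cvg_cst|exact: cvg_id].
Qed.

Lemma continuous_cosM t : continuous (fun u : R => cos (t * u)).
Proof.
move=> u; apply: continuous_comp; last exact: continuous_cos.
by apply: cvgM; [exact: cvg_cst|exact: cvg_id].
Qed.

Lemma continuous_sinM t : continuous (fun u : R => sin (t * u)).
Proof.
move=> u; apply: continuous_comp; last exact: continuous_sin.
by apply: cvgM; [exact: cvg_cst|exact: cvg_id].
Qed.

Lemma continuous_hell : continuous hell.
Proof.
move=> u; rewrite /hell; apply: (@cvg_comp _ _ _ (fun v => expR (v / 2) - 1)
  (fun v => v ^+ 2) _ (nbhs (expR (u / 2) - 1))); last exact: exprn_continuous.
apply: cvgB; last exact: cvg_cst.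
rewrite mulrC; under eq_fun do rewrite mulrC.
exact: continuous_expRM.
Qed.

Lemma continuous_pRe s t : continuous (pRe s t).
Proof.
move=> u; rewrite /pRe; apply: cvgB; last first.
  by apply: cvgM; [exact: cvg_cst|apply: cvgB; [exact: continuous_expR|exact: cvg_cst]].
apply: cvgB; last exact: cvg_cst.
by apply: cvgM; [exact: continuous_expRM|exact: continuous_cosM].
Qed.

Lemma continuous_pIm s t : continuous (pIm s t).
Proof.
move=> u; rewrite /pIm; apply: cvgB; last first.
  by apply: cvgM; [exact: cvg_cst|apply: cvgB; [exact: continuous_expR|exact: cvg_cst]].
by apply: cvgM; [exact: continuous_expRM|exact: continuous_sinM].
Qed.

(** Both [p] and [2 * q * hell u] equal q u^2 / 2 up to a cubic error; dividing by
    [hell u >= u ^+ 2 / 16] leaves a linear error and the factor 16. *)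
Lemma quotient_hell_bound (p q K : R) u : u != 0 -> `|u| <= 1 ->
  `|p - q / 2 * u ^+ 2| <= K * `|u| ^+ 3 ->
  `|p / hell u - 2 * q| <= 16 * (K + 2 * `|q|) * `|u|.
Proof.
move=> u0 u1 pK; have w0 := hell_gt0 u0.
have -> : p / hell u - 2 * q = (p - 2 * q * hell u) / hell u.
  by field; rewrite gt_eqF.
rewrite normrM normfV (gtr0_norm w0) ler_pdivrMr//.
apply: (@le_trans _ _ ((K + 2 * `|q|) * `|u| ^+ 3)).
  have -> : p - 2 * q * hell u = (p - q / 2 * u ^+ 2) - 2 * q * (hell u - u ^+ 2 / 4).
    by field.
  apply: (le_trans (ler_normB _ _)); rewrite [leRHS]mulrDl lerD//.
  by rewrite normrM normrM [`|2|]ger0_norm// ler_wpM2l// ?hell_quad// mulr_ge0.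
have K0 : 0 <= K.
  have := le_trans (normr_ge0 _) pK.
  by rewrite pmulr_lge0// exprn_gt0// normr_gt0.
rewrite (_ : 16 * (K + 2 * `|q|) * `|u| * hell u =
  (K + 2 * `|q|) * `|u| * (16 * hell u)); last by ring.
rewrite (exprS _ 2) [leLHS]mulrA ler_wpM2l//.
  by rewrite mulr_ge0// addr_ge0// mulr_ge0.
by rewrite real_normK ?num_real//; have := hell_lb u1; lra.
Qed.

Lemma continuous_rRe s t : 0 <= s <= 1 -> continuous (rRe s t).
Proof.
move=> s01; apply: (continuous_quotient0 (@continuous_pRe s t) continuous_hell).
  exact: hell_neq0.
move=> u u0 u1; exact: (quotient_hell_bound u0 u1 (pRe_quad t s01 u1)).
Qed.

Lemma continuous_rIm s t : 0 <= s <= 1 -> continuous (rIm s t).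
Proof.
move=> s01; apply: (continuous_quotient0 (@continuous_pIm s t) continuous_hell).
  exact: hell_neq0.
move=> u u0 u1; exact: (quotient_hell_bound u0 u1 (pIm_quad t s01 u1)).
Qed.

(** One argument for both parts of r_z: near 0 the expansion of the numerator, farther out its
    growth against the lower bounds on [hell]. As [C] is independent of [s], it dominates in limits
    along [s]. *)
Lemma quotient_hell_bounded (f p : R -> R -> R) (q : R -> R) (Q K A : R) :
  (forall s u, f s u = if u == 0 then 2 * q s else p s u / hell u) ->
  (forall s, 0 <= s <= 1 -> `|q s| <= Q) ->
  (forall s u, 0 <= s <= 1 -> `|u| <= 1 ->
    `|p s u - q s / 2 * u ^+ 2| <= K * `|u| ^+ 3) ->
  (forall s u, 0 <= s <= 1 -> 1 <= u -> `|p s u| <= A * expR u) ->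
  (forall s u, 0 <= s <= 1 -> u <= -1 -> `|p s u| <= A) ->
  exists C : R, forall s u, 0 <= s <= 1 -> `|f s u| <= C.
Proof.
move=> fE qQ pK pA pB.
exists (2 * Q + 16 * (`|K| + 2 * Q) + 16 * `|A|) => s u s01; rewrite fE.
have Q0 : 0 <= Q := le_trans (normr_ge0 _) (qQ s s01).
have A0 : 0 <= 16 * `|A| by rewrite mulr_ge0.
have K0 : 0 <= 16 * (`|K| + 2 * Q) by rewrite mulr_ge0// addr_ge0// mulr_ge0.
have qs : `|2 * q s| <= 2 * Q by rewrite normrM ger0_norm// ler_pM2l// qQ.
case: eqVneq => [_|u0]; first by apply: (le_trans qs); lra.
have big (B : R) : 0 <= B -> `|p s u| <= `|A| * B -> B / 16 <= hell u ->
    `|p s u / hell u| <= 2 * Q + 16 * (`|K| + 2 * Q) + 16 * `|A|.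
  move=> B0 pAB Bh; apply: (@le_trans _ _ (16 * `|A|)); last by lra.
  rewrite normrM normfV (gtr0_norm (hell_gt0 u0)) ler_pdivrMr ?hell_gt0//.
  by apply: (le_trans pAB); have := normr_ge0 A; nra.
have [u1|u1] := leP `|u| 1.
  have := quotient_hell_bound u0 u1 (pK s u s01 u1).
  have := ler_norm K; have := qQ s s01 => h1 h2 h3.
  have h4 : `|p s u / hell u| <= `|p s u / hell u - 2 * q s| + `|2 * q s|.
    by have := ler_normD (p s u / hell u - 2 * q s) (2 * q s); rewrite subrK.
  have : 16 * (K + 2 * `|q s|) * `|u| <= 16 * (`|K| + 2 * Q).
    apply: (@le_trans _ _ (16 * (`|K| + 2 * Q) * `|u|)); last by rewrite ler_piMr.
    by rewrite ler_wpM2r//; lra.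
  lra.
have [u0'|u0'] := leP 0 u.
  rewrite ger0_norm// in u1.
  apply: (big (expR u)); [exact: expR_ge0| |exact: hell_lb_expR (ltW u1)].
  apply: (le_trans (pA s u s01 (ltW u1))); rewrite ler_wpM2r ?expR_ge0//.
  exact: ler_norm.
rewrite ltr0_norm// in u1; have u1' : u <= -1 by lra.
apply: (big 1) => //; last by have := hell_lb_cst u1'; lra.
by rewrite mulr1 (le_trans (pB s u s01 u1'))// ler_norm.
Qed.

Lemma rRe_bounded t :
  exists C : R, forall s u, 0 <= s <= 1 -> `|rRe s t u| <= C.
Proof.
apply: (@quotient_hell_bounded _ (pRe^~ t) (fun s => s ^+ 2 - t ^+ 2 - s)
  (1 + t ^+ 2) (2 + 3 * t ^+ 2 + 12 * `|t| ^+ 3) 3) => //.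
- by move=> s /andP[s0 s1]; rewrite ler_norml; have := sqr_ge0 t; nra.
- by move=> s u s01 u1; exact: pRe_quad.
- move=> s u /andP[s0 s1] u1; have e1 : 1 <= expR u.
    by rewrite -expR0 ler_expR; lra.
  have : expR (s * u) <= expR u by rewrite ler_expR; nra.
  have := cos_max (t * u); rewrite !ler_norml /pRe.
  have := expR_gt0 (s * u).
  set a := expR _; set c := cos _ => a0 /andP[c1 c2] ab.
  by apply/andP; split; nra.
- move=> s u /andP[s0 s1] u1; have e1 : expR u <= 1 by rewrite expR_le1; lra.
  have : expR (s * u) <= 1 by rewrite expR_le1; nra.
  have := cos_max (t * u); rewrite !ler_norml /pRe.
  have := expR_gt0 (s * u); have := expR_gt0 u.
  set a := expR (s * u); set c := cos _ => u0 a0 /andP[c1 c2] ab.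
  by apply/andP; split; nra.
Qed.

Lemma rIm_bounded t :
  exists C : R, forall s u, 0 <= s <= 1 -> `|rIm s t u| <= C.
Proof.
apply: (@quotient_hell_bounded _ (pIm^~ t) (fun s => 2 * s * t - t)
  `|t| (3 * `|t| + 4 * `|t| ^+ 3) (1 + `|t|)) => //.
- move=> s /andP[s0 s1]; rewrite (_ : 2 * s * t - t = (2 * s - 1) * t); last by ring.
  by rewrite normrM ler_piMl// ler_norml; lra.
- by move=> s u s01 u1; exact: pIm_quad.
- move=> s u /andP[s0 s1] u1; have e1 : 1 <= expR u.
    by rewrite -expR0 ler_expR; lra.
  have : expR (s * u) <= expR u by rewrite ler_expR; nra.
  have := sin_max (t * u); rewrite /pIm.
  have := expR_gt0 (s * u) => a0 c1 ab.
  apply: (le_trans (ler_normB _ _)); rewrite mulrDl mul1r lerD//.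
    by rewrite normrM ger0_norm ?expR_ge0// (le_trans _ ab)// ler_piMr// ltW.
  by rewrite normrM ler_wpM2l// ler_norml; apply/andP; split; lra.
- move=> s u /andP[s0 s1] u1; have e1 : expR u <= 1 by rewrite expR_le1; lra.
  have : expR (s * u) <= 1 by rewrite expR_le1; nra.
  have := sin_max (t * u); rewrite /pIm.
  have := expR_gt0 (s * u); have := expR_gt0 u => e0 a0 c1 ab.
  apply: (le_trans (ler_normB _ _)); rewrite lerD//.
    by rewrite normrM ger0_norm ?expR_ge0// (le_trans _ ab)// ler_piMr// ltW.
  by rewrite normrM ler_piMr// ler_norml; apply/andP; split; lra.
Qed.

Lemma cvgy_expRN (a : R) : 0 < a -> expR (- (a * u)) @[u --> +oo] --> (0 : R).
Proof.
move=> a0; apply: (@cvg_comp _ _ _ (fun u => a * u) (fun v => expR (- v)) _ +oo%R).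
  exact: (gt0_cvgMry a0 cvg_id).
exact: cvgr_expR.
Qed.

Lemma cvgy_hell_expRN : hell u * expR (- u) @[u --> +oo] --> (1 : R).
Proof.
have -> : (fun u => hell u * expR (- u)) = (fun u => (1 - expR (- (2^-1 * u))) ^+ 2).
  apply/funext => u; rewrite /hell.
  have -> : expR (- u) = expR (- (2^-1 * u)) ^+ 2.
    by rewrite -expRM_natl; congr expR; field.
  by rewrite -exprMn mulrBl mul1r [u / 2]mulrC -expRD subrr expR0.
rewrite [X in _ --> X](_ : 1 = (1 - 0) ^+ 2); last by rewrite subr0 expr1n.
apply: (@cvg_comp _ _ _ (fun u : R => 1 - expR (- (2^-1 * u))) (fun v => v ^+ 2) _
  (nbhs (1 - 0 : R))); last exact: exprn_continuous.
by apply: cvgB; [exact: cvg_cst|apply: cvgy_expRN].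
Qed.

(** [hell u] is equivalent to e^u at +oo, so the quotient has the limit of p e^{-u}. *)
Lemma cvgy_quotient_hell (p f : R -> R) (l : R) :
  (forall u, u != 0 -> f u = p u / hell u) ->
  p u * expR (- u) @[u --> +oo] --> l -> f u @[u --> +oo%R] --> l.
Proof.
move=> fE pl; have : (p u * expR (- u)) / (hell u * expR (- u)) @[u --> +oo%R] --> l.
  rewrite -[X in _ --> X]divr1; apply: cvgM => //; apply: cvgV => //.
  exact: cvgy_hell_expRN.
apply: cvg_trans; apply: near_eq_cvg; near=> u.
have u0 : u != 0 by apply: lt0r_neq0; near: u; exact: nbhs_pinfty_gt.
rewrite fE//; field; rewrite hell_neq0// gt_eqF ?expR_gt0//.
Unshelve. all: by end_near.
Qed.

Lemma cvgy_expR_trig s (c : R -> R) : s < 1 -> (forall u, `|c u| <= 1) ->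
  expR (s * u) * c u * expR (- u) @[u --> +oo] --> (0 : R).
Proof.
move=> s1 c1; apply/cvgr0Pnorm_le => e e0.
have /cvgr0Pnorm_le/(_ e e0) H : expR (- ((1 - s) * u)) @[u --> +oo] --> (0 : R).
  by apply: cvgy_expRN; lra.
near=> u; apply: (@le_trans _ _ `|expR (- ((1 - s) * u))|); last by near: u.
rewrite mulrAC -expRD normrM (_ : s * u - u = - ((1 - s) * u)); last by ring.
by rewrite ler_piMr.
Unshelve. all: by end_near.
Qed.

Lemma cvgy_expRm1 : (expR u - 1) * expR (- u) @[u --> +oo] --> (1 : R).
Proof.
have -> : (fun u => (expR u - 1) * expR (- u)) = (fun u => 1 - expR (- u) : R).
  by apply/funext => u; rewrite mulrBl expRxMexpNx_1 mul1r.
rewrite -[X in _ --> X]subr0; apply: cvgB; first exact: cvg_cst.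
exact: cvgr_expR.
Qed.

(** With [cvgy_rIm]: r_z tends to -z at +oo, so that mass c escaping there contributes the factor
    e^{-cz}. For s = 1 and t not 0 the term e^{(z-1)u} would keep oscillating. *)
Lemma cvgy_rRe s t : s < 1 -> rRe s t u @[u --> +oo] --> - s.
Proof.
move=> s1; apply: (@cvgy_quotient_hell (pRe s t)) => [u u0|].
  by rewrite /rRe (negbTE u0).
have -> : (fun u => pRe s t u * expR (- u)) = (fun u =>
    expR (s * u) * cos (t * u) * expR (- u) - expR (- u)
    - s * ((expR u - 1) * expR (- u))).
  by apply/funext => u; rewrite /pRe; ring.
rewrite [X in _ --> X](_ : _ = 0 - 0 - s * 1); last by ring.
apply: cvgB; last by apply: cvgM; [exact: cvg_cst|exact: cvgy_expRm1].
apply: cvgB; last exact: cvgr_expR.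
by apply: (cvgy_expR_trig (c := fun u => cos (t * u)) s1) => u; exact: cos_max.
Qed.

Lemma cvgy_rIm s t : s < 1 -> rIm s t u @[u --> +oo] --> - t.
Proof.
move=> s1; apply: (@cvgy_quotient_hell (pIm s t)) => [u u0|].
  by rewrite /rIm (negbTE u0).
have -> : (fun u => pIm s t u * expR (- u)) = (fun u =>
    expR (s * u) * sin (t * u) * expR (- u)
    - t * ((expR u - 1) * expR (- u))).
  by apply/funext => u; rewrite /pIm; ring.
rewrite [X in _ --> X](_ : _ = 0 - t * 1); last by ring.
apply: cvgB; last by apply: cvgM; [exact: cvg_cst|exact: cvgy_expRm1].
by apply: (cvgy_expR_trig (c := fun u => sin (t * u)) s1) => u; exact: sin_max.
Qed.

Lemma continuous_rRe_arg t u : continuous (fun s => rRe s t u).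
Proof.
move=> s; rewrite /rRe; case: eqVneq => u0.
  apply: cvgM; first exact: cvg_cst.
  apply: cvgB; last exact: cvg_id.
  by apply: cvgB; [exact: exprn_continuous|exact: cvg_cst].
apply: cvgM; last exact: cvg_cst.
rewrite /pRe; apply: cvgB; last by apply: cvgM; [exact: cvg_id|exact: cvg_cst].
apply: cvgB; last exact: cvg_cst.
apply: cvgM; last exact: cvg_cst.
by under eq_fun do rewrite mulrC; rewrite mulrC; exact: continuous_expRM.
Qed.

Lemma continuous_rIm_arg t u : continuous (fun s => rIm s t u).
Proof.
move=> s; rewrite /rIm; case: eqVneq => u0.
  apply: cvgM; first exact: cvg_cst.
  apply: cvgB; last exact: cvg_cst.
  apply: cvgM; last exact: cvg_cst.
  by apply: cvgM; [exact: cvg_cst|exact: cvg_id].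
apply: cvgM; last exact: cvg_cst.
rewrite /pIm; apply: cvgB; last exact: cvg_cst.
apply: cvgM; last exact: cvg_cst.
by under eq_fun do rewrite mulrC; rewrite mulrC; exact: continuous_expRM.
Qed.

(** Convexity of the exponential between 0 and u: e^{su} <= s e^u + 1 - s. *)
Lemma pRe_t0_le0 s u : 0 <= s <= 1 -> pRe s 0 u <= 0.
Proof.
move=> /andP[s0 s1]; rewrite /pRe mul0r cos0 mulr1.
have := @convex_expR R (Itv01 s0 s1) u 0.
rewrite !convRE/= mulr0 addr0 expR0 mulr1 /unstable.onem; lra.
Qed.

End levy_kernel.

(** * Integration *)

Section real_integrals.
Context d (T : measurableType d) (R : realType).
Implicit Types (mu : {measure set T -> \bar R}) (f g : T -> R).

Lemma bounded_integrable mu f (M : R) : (mu setT < +oo)%E ->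
  measurable_fun setT f -> (forall x, `|f x| <= M) ->
  mu.-integrable setT (EFin \o f).
Proof.
move=> muT mf fM; apply: measurable_bounded_integrable => //.
exists M; split; first exact: num_real.
by move=> x Mx y _ /=; apply: le_trans (ltW Mx).
Qed.

Lemma integrable_Rsum mu (I : Type) (s : seq I) (c : I -> R) (g : I -> T -> R) :
  (forall i, mu.-integrable setT (EFin \o g i)) ->
  mu.-integrable setT (EFin \o (fun x => \sum_(i <- s) c i * g i x)).
Proof.
move=> gi; have := @integrable_sum _ _ _ mu setT measurableT I s xpredT
  (fun i x => (c i * g i x)%:E).
move=> /(_ _)/wrap[i _|]; last by apply: eq_integrable => // x _; rewrite /= sumEFin.
have := integrableZl measurableT (c i) (gi i).
by apply: eq_integrable => // x _; rewrite /= EFinM.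
Qed.

Lemma Rintegral_sum mu (I : Type) (s : seq I) (c : I -> R) (g : I -> T -> R) :
  (forall i, mu.-integrable setT (EFin \o g i)) ->
  \int[mu]_x (\sum_(i <- s) c i * g i x) = \sum_(i <- s) c i * \int[mu]_x g i x.
Proof.
move=> gi; elim: s => [|i s IH].
  by rewrite big_nil; under eq_Rintegral do rewrite big_nil; rewrite Rintegral_cst// mul0r.
rewrite big_cons -IH -RintegralZl//; under eq_Rintegral do rewrite big_cons.
rewrite RintegralD//; last exact: integrable_Rsum.
have := integrableZl measurableT (c i) (gi i).
by apply: eq_integrable => // x _; rewrite /= EFinM.
Qed.

Lemma Rintegral_dct mu (D : set T) (f_ : nat -> T -> R) f g :
  measurable D -> (forall n, measurable_fun D (f_ n)) ->
  (forall x, D x -> f_ n x @[n --> \oo] --> f x) ->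
  mu.-integrable D (EFin \o g) -> (forall n x, D x -> `|f_ n x| <= g x) ->
  \int[mu]_(x in D) f_ n x @[n --> \oo] --> \int[mu]_(x in D) f x.
Proof.
move=> mD mf ff ig fg.
have mf' : measurable_fun D f.
  exact: (measurable_fun_cvg mf).
have [|||||fi _ H] := @dominated_convergence _ _ _ mu D mD
  (fun n => EFin \o f_ n) (EFin \o f) (EFin \o g).
- by move=> n; apply/measurable_EFinP; exact: mf.
- exact/measurable_EFinP.
- by apply: aeW => x Dx; apply: cvg_EFin; [exact: nearW|exact: ff].
- exact: ig.
- by apply: aeW => x n Dx; rewrite /= lee_fin fg.
- have fiN : (\int[mu]_(x in D) (f x)%:E)%E \is a fin_num.
    exact: integrable_fin_num.
  by move: H; rewrite -(fineK fiN) => /fine_cvgP[].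
Qed.

End real_integrals.

Definition image_measure d1 d2 (T1 : measurableType d1) (T2 : measurableType d2)
    (R : realType) (mu : {measure set T1 -> \bar R}) (f : T1 -> T2)
    (mf : measurable_fun setT f) : {measure set T2 -> \bar R} :=
  @measure_function_pushforward__canonical__measure_function_Measure
    _ _ _ _ _ mu f mf.

Section image_measure.
Context d1 d2 (T1 : measurableType d1) (T2 : measurableType d2) (R : realType)
  (mu : {measure set T1 -> \bar R}) (f : T1 -> T2) (mf : measurable_fun setT f).

Lemma ge0_integral_image (g : T2 -> \bar R) :
  measurable_fun setT g -> (forall y, 0 <= g y)%E ->
  (\int[image_measure mu mf]_y g y = \int[mu]_x g (f x))%E.
Proof. by move=> mg g0; exact: ge0_integral_pushforward. Qed.

Lemma integrable_image (g : T2 -> R) : measurable_fun setT g ->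
  mu.-integrable setT (EFin \o (g \o f)) ->
  (image_measure mu mf).-integrable setT (EFin \o g).
Proof.
move=> mg /integrableP[_ gi]; apply/integrableP; split; first exact/measurable_EFinP.
rewrite ge0_integral_image//.
by apply: measurableT_comp => //; exact/measurable_EFinP.
Qed.

Lemma Rintegral_image (g : T2 -> R) : measurable_fun setT g ->
  mu.-integrable setT (EFin \o (g \o f)) ->
  \int[image_measure mu mf]_y g y = \int[mu]_x g (f x).
Proof.
move=> mg gi; rewrite /Rintegral; congr fine.
by apply: integral_pushforward => //; exact/measurable_EFinP.
Qed.

End image_measure.

Section density_measure.
Import HBNNSimple.
Local Open Scope ereal_scope.
Context d (T : measurableType d) (R : realType).
Variables (mu : {measure set T -> \bar R}) (phi : T -> R).
Hypotheses (mphi : measurable_fun setT phi) (phi0 : forall x, (0 <= phi x)%R).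

Definition mdensity (A : set T) : \bar R := \int[mu]_(x in A) (phi x)%:E.

Let mdensity0 : mdensity set0 = 0.
Proof. by rewrite /mdensity integral_set0. Qed.

Let mdensity_ge0 A : 0 <= mdensity A.
Proof. by apply: integral_ge0 => x _; rewrite lee_fin. Qed.

Let mdensity_sigma_additive : semi_sigma_additive mdensity.
Proof.
move=> F mF tF mUF; rewrite /mdensity ge0_integral_bigcup//.
- by apply: is_cvg_nneseries => n _ _; apply: integral_ge0 => x _; rewrite lee_fin.
- by apply/measurable_EFinP; exact: measurable_funTS.
- by move=> x _; rewrite lee_fin.
Qed.

HB.instance Definition _ := isMeasure.Build _ _ _ mdensity
  mdensity0 mdensity_ge0 mdensity_sigma_additive.

Definition density_measure : {measure set T -> \bar R} := mdensity.

(** Monotone convergence reduces both sides to a simple function, where the definition of [mdensity]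
    applies level set by level set. *)
Lemma ge0_integral_mdensity (f : T -> \bar R) :
  measurable_fun setT f -> (forall x, 0 <= f x) ->
  \int[density_measure]_x f x = \int[mu]_x (f x * (phi x)%:E).
Proof.
move=> mf f0; pose h := nnsfun_approx measurableT mf.
have mphiE : measurable_fun setT (EFin \o phi) by exact/measurable_EFinP.
have -> : \int[density_measure]_x f x = lim (\int[density_measure]_x (h n x)%:E @[n --> \oo]).
  have fE x : f x = lim ((h n x)%:E @[n --> \oo]).
    by apply/esym/cvg_lim => //; exact: cvg_nnsfun_approx.
  under eq_integral => x _ do rewrite fE.
  apply: monotone_convergence => //.
  - by move=> n; apply/measurable_EFinP; exact: measurable_funP.
  - by move=> n x _; rewrite lee_fin.
  - by move=> x _ a b ab; rewrite lee_fin; exact/lefP/nd_nnsfun_approx.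
have -> : \int[mu]_x (f x * (phi x)%:E) =
    lim (\int[mu]_x ((h n x)%:E * (phi x)%:E) @[n --> \oo]).
  have fE x : f x * (phi x)%:E = lim ((h n x)%:E * (phi x)%:E @[n --> \oo]).
    by apply/esym/cvg_lim => //; apply: cvgeZr => //; exact: cvg_nnsfun_approx.
  under eq_integral => x _ do rewrite fE.
  apply: monotone_convergence => //.
  - by move=> n; apply: emeasurable_funM => //; apply/measurable_EFinP; exact: measurable_funP.
  - by move=> n x _; rewrite mule_ge0// lee_fin.
  - move=> x _ a b ab; rewrite lee_wpmul2r ?lee_fin//.
    exact/lefP/nd_nnsfun_approx.
congr (lim (_ @ \oo)); apply/funext => n.
transitivity (\int[density_measure]_x
   (\sum_(y \in range (h n)) (y * \1_(h n @^-1` [set y]) x)%:E)).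
  by apply: eq_integral => t tE; rewrite /= fimfunE -fsumEFin.
have indich m r : measurable_fun setT (fun x => (r * \1_(h m @^-1` [set r]) x)%:E).
  by apply: (measurable_comp measurableT) => //; exact: measurable_funM.
rewrite ge0_integral_fsum//; last by move=> m y Ey; exact: nnfun_muleindic_ge0.
transitivity (\int[mu]_x (\sum_(y \in range (h n))
    (y * \1_(h n @^-1` [set y]) x)%:E * (phi x)%:E)); last first.
  apply: eq_integral => x xE.
  rewrite -ge0_mule_fsuml => [|y]; last exact: nnfun_muleindic_ge0.
  by rewrite fsumEFin // -(fimfunE _ x).
rewrite ge0_integral_fsum//; last 2 first.
  - by move=> y; apply: emeasurable_funM.
  - by move=> m y Ey; apply: mule_ge0; [exact: nnfun_muleindic_ge0|rewrite lee_fin].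
apply: eq_fsbigr => r rhn.
under eq_integral do rewrite EFinM.
rewrite integralZl_indic_nnsfun => //.
under [RHS]eq_integral do rewrite EFinM -muleA.
rewrite integral_indic// setIT.
have [r0|r0] := ltP r 0%R.
  have -> : h n @^-1` [set r] = set0.
    apply/seteqP; split => // x /= hx; have : (0 <= h n x)%R by [].
    by rewrite hx leNgt r0.
  rewrite measure0 mule0; under eq_integral do rewrite indicE in_set0 mul0e mule0.
  by rewrite integral0.
rewrite ge0_integralZl//.
- congr (_ * _); rewrite -[LHS]/(mdensity _) /mdensity [LHS]integral_mkcond.
  by apply: eq_integral => x _; rewrite epatch_indic muleC.
- apply: emeasurable_funM => //; exact/measurable_EFinP.
- by move=> x _; rewrite mule_ge0// lee_fin.
Qed.

Lemma integrable_mdensity (f : T -> R) : measurable_fun setT f ->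
  mu.-integrable setT (EFin \o (fun x => (f x * phi x)%R)) ->
  density_measure.-integrable setT (EFin \o f).
Proof.
move=> mf /integrableP[_ fi]; apply/integrableP; split.
  exact/measurable_EFinP.
rewrite ge0_integral_mdensity//; last first.
  by apply: measurableT_comp => //; exact/measurable_EFinP.
rewrite (le_lt_trans _ fi)//; apply: ge0_le_integral => //.
- by move=> x _; rewrite mule_ge0// lee_fin.
- apply: emeasurable_funM; last exact/measurable_EFinP.
  by apply: measurableT_comp => //; exact/measurable_EFinP.
- apply: measurableT_comp => //; apply/measurable_EFinP; exact: measurable_funM.
- by move=> x _; rewrite /= -EFinM normrM (ger0_norm (phi0 x)).
Qed.

Lemma Rintegral_mdensity (f : T -> R) : measurable_fun setT f ->
  mu.-integrable setT (EFin \o (fun x => (f x * phi x)%R)) ->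
  (\int[density_measure]_x f x = \int[mu]_x (f x * phi x))%R.
Proof.
move=> mf fi; rewrite /Rintegral; congr fine.
have mE : measurable_fun setT (EFin \o f) by exact/measurable_EFinP.
rewrite [LHS]integralE [RHS]integralE; congr (_ - _).
  rewrite ge0_integral_mdensity//; last exact: measurable_funepos.
  apply: eq_integral => x _; rewrite !funeposE /= EFinM.
  by rewrite !maxe_pMl// ?mul0e// lee_fin.
rewrite ge0_integral_mdensity//; last exact: measurable_funeneg.
apply: eq_integral => x _; rewrite !funenegE /= -mulNr EFinM.
by rewrite !maxe_pMl// ?mul0e// lee_fin.
Qed.

End density_measure.
Arguments density_measure {d T R} mu {phi}.

Lemma normr_indic_le1 T (R : realType) (A : set T) x : `|\1_A x : R| <= 1.
Proof. by rewrite indicE; case: (_ \in _); rewrite ?normr1 ?normr0. Qed.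

Lemma indic_integrable d (T : measurableType d) (R : realType)
  (mu : {measure set T -> \bar R}) (A : set T) : (mu setT < +oo)%E ->
  measurable A -> mu.-integrable setT (EFin \o \1_A).
Proof.
move=> muT mA; apply: (@bounded_integrable _ _ _ _ _ 1) => // x.
exact: normr_indic_le1.
Qed.

(** * Atoms of finite measures, and measures determined by rays *)

Section atoms.
Context (R : realType).

(** A finite measure has finitely many atoms of mass at least 1/(n+1), hence countably many atoms in
    all, whereas ]a, b[ has positive Lebesgue measure. *)
Lemma exists_null_point (mu : {measure set R -> \bar R}) (a b : R) :
  (mu setT < +oo)%E -> a < b -> exists2 x, a < x < b & mu [set x] = 0%E.
Proof.
move=> muT ab; apply: contrapT => noatom.
pose A (n : nat) := [set x | a < x < b /\ (n.+1%:R^-1%:E <= mu [set x])%E].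
have finA n : finite_set (A n).
  apply: contrapT => /infiniteP/pcard_leP/unsquash f.
  have mf i : measurable [set f i] by exact: measurable_set1.
  have tf : trivIset setT (fun i => [set f i]).
    apply/trivIsetP => i j _ _ ij; apply/seteqP; split => // x [/= ->].
    by move=> /(@inj _ _ _ f); rewrite !in_setT => /(_ isT isT) ijE; rewrite ijE eqxx in ij.
  have mU : measurable (\bigcup_i [set f i]) by exact: bigcupT_measurable.
  have : (mu (\bigcup_i [set f i]) <= mu setT)%E.
    by apply: le_measure; rewrite ?inE.
  rewrite measure_semi_bigcup//; apply/negP; rewrite -ltNge.
  have muTf : mu setT \is a fin_num by rewrite ge0_fin_numE.
  pose c := fine (mu setT); have c0 : 0 <= c * n.+1%:R by rewrite mulr_ge0// fine_ge0.
  apply: lt_le_trans (nneseries_lim_ge (Num.bound (c * n.+1%:R)) _) => //.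
  apply: (@lt_le_trans _ _ (\sum_(0 <= i < Num.bound (c * n.+1%:R)) n.+1%:R^-1%:E)%E).
    rewrite sumEFin -(fineK muTf) lte_fin big_const_nat subn0 iter_addr_0.
    by rewrite -[_ *+ Num.bound _]mulr_natr ltr_pdivlMl// mulrC archi_boundP.
  apply: lee_sum => i _.
  by have [] : A n (f i) by exact: (@funS _ _ _ _ f).
have : countable `]a, b[.
  apply: (@sub_countable _ _ _ (\bigcup_n A n)); last first.
    by apply: bigcup_countable => // n _; exact: finite_set_countable.
  apply: subset_card_le => x; rewrite /= in_itv/= => xab.
  have mux : (0 < mu [set x])%E.
    by rewrite lt0e measure_ge0 andbT; apply/eqP => mux; apply: noatom; exists x.
  have mufin : mu [set x] \is a fin_num.
    by rewrite ge0_fin_numE// (le_lt_trans _ muT)// le_measure// inE.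
  have fmu : 0 < fine (mu [set x]) by rewrite fine_gt0// mux -ge0_fin_numE.
  have [n] := ltr_add_invr fmu.
  rewrite add0r => nmu; exists n => //; split=> //.
  by rewrite -(fineK mufin) lee_fin ltW.
move=> /countable_lebesgue_measure0; rewrite lebesgue_measure_itv/= lte_fin ab.
by move=> /eqP; rewrite -EFinB eqe subr_eq0 gt_eqF.
Qed.

End atoms.

Lemma measure_eq_rays (R : realType) (m1 m2 : {measure set R -> \bar R}) :
  (m1 setT < +oo)%E -> (forall a, m1 `]a, +oo[%classic = m2 `]a, +oo[%classic) ->
  forall A, measurable A -> m1 A = m2 A.
Proof.
move=> m1T eq_ray.
apply: (@measure_unique _ _ _ (@RGenOInfty.G R) (fun n => `]- n%:R, +oo[%classic)).
- exact: RGenOInfty.measurableE.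
- move=> _ _ [x ->] [y ->]; exists (Num.max x y).
  apply/seteqP; split => z /=; rewrite !in_itv/= !andbT gt_max; first by move=> [-> ->].
  by move/andP.
- by move=> n; exists (- n%:R).
- apply/seteqP; split => // x _.
  exists (Num.bound `|x|) => //=; rewrite in_itv/= andbT ltrNl.
  by rewrite (le_lt_trans (ler_norm _))// normrN archi_boundP.
- by move=> _ [x ->]; exact: eq_ray.
- by move=> n; rewrite (le_lt_trans _ m1T)// le_measure// inE.
Qed.

(** * Uniqueness of characteristic functions *)

Section fourier.
Context (R : realType).
Variables (m1 m2 : {measure set R -> \bar R}).
Hypotheses (m1T : (m1 setT < +oo)%E) (m2T : (m2 setT < +oo)%E).
Hypotheses
  (eqcos : forall t, \int[m1]_x cos (t * x) = \int[m2]_x cos (t * x))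
  (eqsin : forall t, \int[m1]_x sin (t * x) = \int[m2]_x sin (t * x)).

Lemma measurable_cos_affine (t c : R) :
  measurable_fun setT (fun x => cos (t * x + c)).
Proof.
apply: continuous_measurable_fun => x.
apply: continuous_comp; last exact: continuous_cos.
apply: cvgD; last exact: cvg_cst.
by apply: cvgM; [exact: cvg_cst|exact: cvg_id].
Qed.

(* Closed under multiplication by cosines, thanks to the product-to-sum formula. *)
Let E (f : R -> R) := [/\ measurable_fun setT f, exists M : R, forall x, `|f x| <= M &
  forall t c, \int[m1]_x (f x * cos (t * x + c)) = \int[m2]_x (f x * cos (t * x + c))].

Let integrable_Ecos (mu : {measure set R -> \bar R}) f t c :
  (mu setT < +oo)%E -> E f ->
  mu.-integrable setT (EFin \o (fun x => f x * cos (t * x + c))).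
Proof.
move=> muT [mf [M fM] _]; apply: (@bounded_integrable _ _ _ _ _ M) => //.
  by apply: measurable_funM => //; exact: measurable_cos_affine.
by move=> x; rewrite normrM (le_trans _ (fM x))// ler_piMr// cos_max.
Qed.

Let E1 : E (cst 1).
Proof.
split=> [//||t c]; first by exists 1 => x; rewrite /= normr1.
have ci (mu : {measure set R -> \bar R}) : (mu setT < +oo)%E ->
    mu.-integrable setT (EFin \o (fun x => cos (t * x))).
  move=> muT; apply: (@bounded_integrable _ _ _ _ _ 1) => //.
    by apply: continuous_measurable_fun; exact: continuous_cosM.
  by move=> x; exact: cos_max.
have si (mu : {measure set R -> \bar R}) : (mu setT < +oo)%E ->
    mu.-integrable setT (EFin \o (fun x => sin (t * x))).
  move=> muT; apply: (@bounded_integrable _ _ _ _ _ 1) => //.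
    by apply: continuous_measurable_fun; exact: continuous_sinM.
  by move=> x; exact: sin_max.
have H (mu : {measure set R -> \bar R}) : (mu setT < +oo)%E ->
    \int[mu]_x (cst 1 x * cos (t * x + c)) =
    cos c * (\int[mu]_x cos (t * x)) - sin c * (\int[mu]_x sin (t * x)).
  move=> muT; rewrite -RintegralZl//; [|exact: ci]; rewrite -RintegralZl//; [|exact: si].
  rewrite -RintegralB//; last 2 first.
  - have := integrableZl measurableT (cos c) (ci mu muT).
    by apply: eq_integrable => // x _; rewrite /= EFinM.
  - have := integrableZl measurableT (sin c) (si mu muT).
    by apply: eq_integrable => // x _; rewrite /= EFinM.
  by apply: eq_Rintegral => x _; rewrite /= mul1r cosD; ring.
by rewrite !H// eqcos eqsin.
Qed.

Let ElinM f g a b : E f -> E g -> E (fun x => a * f x + b * g x).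
Proof.
move=> Ef Eg; have [mf [M fM] ef] := Ef; have [mg [N gN] eg] := Eg; split.
- by apply: measurable_funD; apply: measurable_funM.
- exists (`|a| * M + `|b| * N) => x; apply: (le_trans (ler_normD _ _)).
  by rewrite !normrM lerD// ler_wpM2l.
move=> t c.
have H (mu : {measure set R -> \bar R}) : (mu setT < +oo)%E ->
    \int[mu]_x ((a * f x + b * g x) * cos (t * x + c)) =
    a * (\int[mu]_x (f x * cos (t * x + c))) + b * (\int[mu]_x (g x * cos (t * x + c))).
  move=> muT; have fi := integrable_Ecos t c muT Ef; have gi := integrable_Ecos t c muT Eg.
  rewrite -RintegralZl// -RintegralZl// -RintegralD//; last 2 first.
  - have := integrableZl measurableT a fi.
    by apply: eq_integrable => // x _; rewrite /= EFinM.
  - have := integrableZl measurableT b gi.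
    by apply: eq_integrable => // x _; rewrite /= EFinM.
  by apply: eq_Rintegral => x _; rewrite mulrDl !mulrA.
by rewrite !H// ef eg.
Qed.

Let EcosM f t c : E f -> E (fun x => f x * cos (t * x + c)).
Proof.
move=> Ef; have [mf [M fM] ef] := Ef; split.
- by apply: measurable_funM => //; exact: measurable_cos_affine.
- by exists M => x; rewrite normrM (le_trans _ (fM x))// ler_piMr// cos_max.
move=> t' c'.
have H (mu : {measure set R -> \bar R}) : (mu setT < +oo)%E ->
    \int[mu]_x (f x * cos (t * x + c) * cos (t' * x + c')) =
    2^-1 * (\int[mu]_x (f x * cos ((t + t') * x + (c + c')))) +
    2^-1 * (\int[mu]_x (f x * cos ((t - t') * x + (c - c')))).
  move=> muT; have fi := fun t c => integrable_Ecos t c muT Ef.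
  rewrite -RintegralZl// -RintegralZl// -RintegralD//; last 2 first.
  - have := integrableZl measurableT 2^-1 (fi (t + t') (c + c')).
    by apply: eq_integrable => // x _; rewrite /= EFinM.
  - have := integrableZl measurableT 2^-1 (fi (t - t') (c - c')).
    by apply: eq_integrable => // x _; rewrite /= EFinM.
  apply: eq_Rintegral => x _.
  rewrite (_ : (t + t') * x + (c + c') = (t * x + c) + (t' * x + c')); last by ring.
  rewrite (_ : (t - t') * x + (c - c') = (t * x + c) - (t' * x + c')); last by ring.
  by set A := t * x + c; set B := t' * x + c'; rewrite (cosD A) (cosB A); field.
by rewrite !H// !ef.
Qed.

Let Epoly (p : {poly R}) t c : E (fun x => p.[cos (t * x + c)]).
Proof.
elim/poly_ind: p => [|p a Ep].
  have := ElinM 0 0 E1 E1; congr E; apply/funext => x.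
  by rewrite horner0 !mul0r addr0.
have := ElinM 1 a (EcosM t c Ep) E1; congr E; apply/funext => x.
by rewrite hornerMXaddC mul1r /= mulr1.
Qed.

(* The odd polynomial (3c - c^3)/2 contracts ]0, 1] towards 1: its iterates
   converge boundedly to the sign function on [-1, 1]. *)
Definition sg_step (c : R) : R := (3 * c - c ^+ 3) / 2.

Lemma sg_step_poly n : exists p : {poly R}, forall c, iter n sg_step c = p.[c].
Proof.
elim: n => [|n [p IH]]; first by exists 'X => c; rewrite hornerX.
exists ((3 / 2) *: p - 2^-1 *: p ^+ 3) => c.
by rewrite iterS IH hornerD hornerN !hornerZ horner_exp /sg_step; field.
Qed.

Lemma sg_stepN c : sg_step (- c) = - sg_step c.
Proof. by rewrite /sg_step; field. Qed.

Lemma iter_sg_stepN n c : iter n sg_step (- c) = - iter n sg_step c.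
Proof. by elim: n => // n IH; rewrite !iterS IH sg_stepN. Qed.

(** The defect obeys 1 - [sg_step b] = (1 - b)(2 - b - b^2) / 2, and the last factor is at most 1 -
    c / 2 as long as b >= c, which the iteration preserves. *)
Lemma iter_sg_step_pos n c : 0 < c <= 1 ->
  c <= iter n sg_step c <= 1 /\ 1 - iter n sg_step c <= (1 - c / 2) ^+ n.
Proof.
move=> /andP[c0 c1]; elim: n => [|n [/andP[cn n1] IH]] /=.
  by rewrite lexx c1; split=> //; rewrite expr0; lra.
set b := iter n sg_step c in cn n1 IH *.
have b0 : 0 < b by lra.
have h : 1 - sg_step b = (1 - b) * ((2 - b - b ^+ 2) / 2) by rewrite /sg_step; field.
have h1 : (2 - b - b ^+ 2) / 2 <= 1 - c / 2 by nra.
have h2 : 0 <= (2 - b - b ^+ 2) / 2 by nra.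
split; last by rewrite h [leRHS]exprSr; apply: ler_pM => //; lra.
apply/andP; split; last by rewrite -subr_ge0 h mulr_ge0//; lra.
rewrite /sg_step.
have : 0 <= b * (1 - b ^+ 2) by rewrite mulr_ge0; nra.
rewrite (_ : (3 * b - b ^+ 3) / 2 = b + b * (1 - b ^+ 2) / 2); last by field.
lra.
Qed.

Lemma iter_sg_step_norm n c : `|c| <= 1 -> `|iter n sg_step c| <= 1.
Proof.
move=> c1; have pos b : 0 < b <= 1 -> `|iter n sg_step b| <= 1.
  move=> bb; have [/andP[h1 h2] _] := iter_sg_step_pos n bb.
  by rewrite ger0_norm//; move/andP: bb => [? ?]; lra.
have [c0|c0|->] := ltgtP c 0.
- rewrite -[c]opprK iter_sg_stepN normrN; apply: pos.
  by rewrite ltr0_norm// in c1; lra.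
- by apply: pos; rewrite gtr0_norm// in c1; lra.
- suff -> : iter n sg_step 0 = 0 by rewrite normr0.
  by elim: n {pos} => //= n ->; rewrite /sg_step; lra.
Qed.

Lemma cvg_iter_sg_step c : `|c| <= 1 -> iter n sg_step c @[n --> \oo] --> Num.sg c.
Proof.
move=> c1; have pos b : 0 < b <= 1 -> iter n sg_step b @[n --> \oo] --> (1 : R).
  move=> bb; apply/cvgrPdist_le => e e0.
  have /cvgr0Pnorm_le/(_ e e0) H : (1 - b / 2) ^+ n @[n --> \oo] --> (0 : R).
    by apply: cvg_expr; move/andP: bb => [? ?]; rewrite ger0_norm; lra.
  near=> n; have [/andP[h1 h2] h3] := iter_sg_step_pos n bb.
  rewrite ger0_norm; last by lra.
  by apply: (le_trans h3); apply: (le_trans (ler_norm _)); near: n.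
have [c0|c0|->] := ltgtP c 0.
- rewrite ltr0_sg//; have := pos (- c).
  have -> : 0 < - c <= 1 by rewrite ltr0_norm// in c1; lra.
  move=> /(_ isT)/cvgN; apply: cvg_trans; apply: near_eq_cvg; apply: nearW => n.
  by rewrite -[LHS]/(- iter n sg_step (- c)) iter_sg_stepN opprK.
- by rewrite gtr0_sg//; apply: pos; rewrite gtr0_norm// in c1; lra.
- rewrite sgr0; have -> : (fun n => iter n sg_step 0) = fun=> 0.
    by apply/funext; elim => //= n ->; rewrite /sg_step; lra.
  exact: cvg_cst.
Unshelve. all: by end_near.
Qed.

Let eq_lim (f_ : nat -> R -> R) f : (forall n, measurable_fun setT (f_ n)) ->
  (forall n x, `|f_ n x| <= 1) -> (forall x, f_ n x @[n --> \oo] --> f x) ->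
  (forall n, \int[m1]_x f_ n x = \int[m2]_x f_ n x) ->
  \int[m1]_x f x = \int[m2]_x f x.
Proof.
move=> mf f1 ff eqf.
have H (mu : {measure set R -> \bar R}) : (mu setT < +oo)%E ->
    \int[mu]_x f_ n x @[n --> \oo] --> \int[mu]_x f x.
  move=> muT; apply: (@Rintegral_dct _ _ _ mu setT f_ f (cst 1)) => //.
  by apply: (@bounded_integrable _ _ _ _ _ 1) => // x; rewrite normr1.
apply: (cvg_unique _ (H m1 m1T)) => //.
rewrite (_ : (fun n => _) = (fun n => \int[m2]_x f_ n x)); first exact: H.
by apply/funext => n; exact: eqf.
Qed.

Let measurable_sg (f : R -> R) : measurable_fun setT f ->
  measurable_fun setT (fun x => Num.sg (f x)).
Proof.
move=> mf; rewrite (_ : (fun x => _) =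
  (fun x => if f x == 0 then 0 else if f x < 0 then -1 else 1)); last first.
  apply/funext => x.
  by case: ltgtP => fx; [exact: ltr0_sg|exact: gtr0_sg|rewrite fx sgr0].
apply: measurable_fun_ifT => //.
  by apply: measurable_fun_eqr => //; exact: measurable_cst.
apply: measurable_fun_ifT => //.
by apply: measurable_fun_ltr => //; exact: measurable_cst.
Qed.

Let eq_sg_cos t c :
  \int[m1]_x Num.sg (cos (t * x + c)) = \int[m2]_x Num.sg (cos (t * x + c)).
Proof.
apply: (@eq_lim (fun n x => iter n sg_step (cos (t * x + c)))) => [n|n x|x|n].
- have [p pE] := sg_step_poly n; under eq_fun do rewrite pE.
  by have [] := Epoly p t c.
- by apply: iter_sg_step_norm; exact: cos_max.
- by apply: cvg_iter_sg_step; exact: cos_max.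
- have [p pE] := sg_step_poly n.
  have [_ _ /(_ 0 0)] := Epoly p t c.
  by under eq_Rintegral do rewrite mul0r addr0 cos0 mulr1 -pE;
     under [RHS]eq_Rintegral do rewrite mul0r addr0 cos0 mulr1 -pE.
Qed.

(** Square waves of growing period: the sine of (x - a) / (n+1) has the sign of x - a as soon as |x
    - a| < pi (n+1), and a shift by pi / 2 turns this sine into one of the cosines already
    treated. *)
Let eq_sg a : \int[m1]_x Num.sg (x - a) = \int[m2]_x Num.sg (x - a).
Proof.
apply: (@eq_lim (fun n x => Num.sg (cos (n.+1%:R^-1 * x +
    (- (n.+1%:R^-1 * a) - pi / 2))))) => [n|n x|x|n].
- by apply: measurable_sg; exact: measurable_cos_affine.
- by rewrite normr_sg; case: eqP.
- apply: cvg_near_cst; near=> n.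
  rewrite addrA -mulrBr cosBpihalf.
  have pos (y : R) : 0 <= y -> y < pi * n.+1%:R -> Num.sg (sin (n.+1%:R^-1 * y)) = Num.sg y.
    rewrite le_eqVlt => /predU1P[<- _|y0 yn]; first by rewrite mulr0 sin0.
    rewrite gtr0_sg ?gtr0_sg// sin_gt0_pi// mulr_gt0//=.
    by rewrite ltr_pdivrMl// mulrC.
  have xan : `|x - a| < pi * n.+1%:R.
    rewrite -ltr_pdivrMl ?pi_gt0//; near: n.
    have := nbhs_infty_gtr (pi^-1 * `|x - a|); apply: filterS => i /lt_le_trans; apply.
  by rewrite ler_nat.
  have [xa|/ltW xa] := leP 0 (x - a).
    by apply: pos => //; rewrite ger0_norm in xan.
  rewrite ler0_norm// in xan; rewrite -oppr_ge0 in xa.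
  by have := pos _ xa xan; rewrite mulrN sinN !sgrN => /oppr_inj.
- exact: eq_sg_cos.
Unshelve. all: by end_near.
Qed.

Let eq_total : m1 setT = m2 setT.
Proof.
have := eqcos 0; under eq_Rintegral do rewrite mul0r cos0.
under [RHS]eq_Rintegral do rewrite mul0r cos0.
rewrite !Rintegral_cst// !mul1r => /(congr1 (@EFin R)).
by rewrite !fineK// ge0_fin_numE.
Qed.

Let eq_ray a : m1 `]a, +oo[%classic = m2 `]a, +oo[%classic.
Proof.
have H : \int[m1]_x (2 * \1_`]a, +oo[%classic x - 1) = \int[m2]_x (2 * \1_`]a, +oo[%classic x - 1).
  (* The threshold tends to [a] from the right, so that the limit at [x = a] is -1 and the open ray
     comes out. *)
  apply: (@eq_lim (fun n x => Num.sg (x - (a + n.+1%:R^-1)))) => [n|n x|x|n].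
  - by apply: measurable_sg; apply: measurable_funB.
  - by rewrite normr_sg; case: eqP.
  - rewrite indicE; have [xa|xa] := ltP a x.
      rewrite mem_set/= ?in_itv/= ?xa//.
      have -> : 2 * 1 - 1 = 1 :> R by lra.
      apply: cvg_near_cst; near=> n; rewrite gtr0_sg//.
      rewrite subr_gt0 -ltrBrDl; near: n.
      have xa0 : 0 < x - a by rewrite subr_gt0.
      exact: (near_infty_natSinv_lt (PosNum xa0)).
    rewrite memNset/= ?in_itv/= ?andbT; last by apply/negP; rewrite -leNgt.
    have -> : 2 * 0 - 1 = -1 :> R by lra.
    apply: cvg_near_cst; near=> n; rewrite ltr0_sg//.
    by rewrite subr_lt0 (le_lt_trans xa)// ltrDl.
  - exact: eq_sg.
have F (mu : {measure set R -> \bar R}) : (mu setT < +oo)%E ->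
    \int[mu]_x (2 * \1_`]a, +oo[%classic x - 1) = 2 * fine (mu `]a, +oo[%classic) - fine (mu setT).
  move=> muT.
  have i1 : mu.-integrable setT (EFin \o \1_`]a, +oo[%classic).
    exact: indic_integrable.
  rewrite RintegralB//; last 2 first.
  - have := integrableZl measurableT 2 i1.
    by apply: eq_integrable => // x _; rewrite /= EFinM.
  - by apply: (@bounded_integrable _ _ _ _ _ 1) => // x; rewrite normr1.
  rewrite RintegralZl// Rintegral_cst// mul1r; congr (_ * _ - _).
  by rewrite /Rintegral integral_indic// setIT.
have : fine (m1 `]a, +oo[%classic) = fine (m2 `]a, +oo[%classic).
  by move: H; rewrite !F// eq_total; lra.
move=> /(congr1 (@EFin R)).
have fin (mu : {measure set R -> \bar R}) : (mu setT < +oo)%E ->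
    mu `]a, +oo[%classic \is a fin_num.
  by move=> muT; rewrite ge0_fin_numE// (le_lt_trans _ muT)// le_measure// inE.
by rewrite !fineK// fin.
Unshelve. all: by end_near.
Qed.

Theorem fourier_unique (A : set R) : measurable A -> m1 A = m2 A.
Proof. exact: (measure_eq_rays m1T eq_ray). Qed.

End fourier.

(** * Ultrafilter limits, uniform continuity and Stieltjes measures *)

Lemma ultra_image_filter (T U : Type) (f : T -> U) (F : set_system T) :
  UltraFilter F -> UltraFilter (f @ F).
Proof.
move=> UF; apply: Build_UltraFilter => G PG FG; apply/seteqP; split => // A GA.
have [//|FA] := in_ultra_setVsetC (f @^-1` A) UF.
have /FG GA' : (f @ F) (~` A) by [].
by have [x []] := filter_ex (filterI GA GA').
Qed.

(** Compactness of the segment. Along an ultrafilter the distribution functions converge at all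
    points at once, so no diagonal extraction is needed. *)
Lemma ultra_bounded_cvg (R : realType) (U : set_system nat) (f : nat -> R) (C : R) :
  UltraFilter U -> (\forall n \near U, 0 <= f n <= C) ->
  exists2 l : R, 0 <= l <= C & f n @[n --> U] --> l.
Proof.
move=> UU fC; have := @segment_compact R 0 C.
rewrite compact_ultra => /(_ (f @ U) (ultra_image_filter f UU)) [].
  by apply: filterS fC => n; rewrite /= in_itv.
by move=> l [/= l0C fl]; exists l => //; move: l0C; rewrite in_itv.
Qed.

Lemma Rintegral_indic d (T : measurableType d) (R : realType)
  (mu : {measure set T -> \bar R}) (A : set T) : measurable A ->
  \int[mu]_x \1_A x = fine (mu A).
Proof. by move=> mA; rewrite /Rintegral integral_indic// setIT. Qed.

Lemma segment_unif_continuous (R : realType) (h : R -> R) (a b e : R) :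
  continuous h -> 0 < e -> exists2 delta, 0 < delta &
  forall x y, a <= x <= b -> `|x - y| < delta -> `|h x - h y| <= e.
Proof.
move=> ch e0; have /compact_near_coveringP := @segment_compact R a b.
move=> /(_ R (0 : R)^'+ (fun delta x => forall y, `|x - y| < delta ->
  `|h x - h y| <= e) _) [].
  move=> x _; have e20 : 0 < e / 2 by rewrite divr_gt0.
  have /cvgrPdist_le/(_ _ e20)/nbhs_ballP[r /= r0 rh] := ch x.
  have r20 : 0 < r / 2 by rewrite divr_gt0.
  exists (ball x (r / 2), [set d | d < r / 2]).
    split => /=; first exact: nbhsx_ballx.
    by near=> d; near: d; exact: nbhs_right_lt.
  move=> [z d] [/= xz dr] y zy.
  have h1 : `|h x - h z| <= e / 2 by apply: rh; apply: le_ball xz; lra.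
  have h2 : `|h x - h y| <= e / 2.
    apply: rh; rewrite /ball/= -(subrK z x) -addrA.
    by rewrite (le_lt_trans (ler_normD _ _))//; move: xz; rewrite /ball/=; lra.
  rewrite (_ : h z - h y = (h x - h y) - (h x - h z)); last by ring.
  by rewrite (le_trans (ler_normB _ _))//; lra.
move=> r /= r0 rP; exists (r / 2); first by rewrite divr_gt0.
move=> x y xab xy; apply: (rP (r / 2)) => //=.
- by rewrite sub0r normrN gtr0_norm ?divr_gt0//; lra.
- by rewrite divr_gt0.
Unshelve. all: by end_near.
Qed.

Lemma lebesgue_stieltjes_itv (R : realType) (F : cumulative R R) a b : a <= b ->
  lebesgue_stieltjes_measure F `]a, b]%classic = (F b - F a)%:E.
Proof.
move=> ab; rewrite /lebesgue_stieltjes_measure /measure_extension/=.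
rewrite measurable_mu_extE/=; last exact: is_ocitv.
by rewrite wlength_itv_bnd.
Qed.

(** * Compactness along an ultrafilter *)

Section vague_compactness.
Context (R : realType) (U : set_system nat) (kap : nat -> {measure set R -> \bar R})
  (C : R).
Hypotheses (UU : UltraFilter U) (kapT : forall n, (kap n setT < +oo)%E)
  (kapC : \forall n \near U, fine (kap n setT) <= C)
  (kap0 : forall a, a < 0 -> \forall n \near U, kap n `]-oo, a]%classic = 0%E).

Let kapfin n A : measurable A -> kap n A \is a fin_num.
Proof.
by move=> mA; rewrite ge0_fin_numE// (le_lt_trans _ (kapT n))// le_measure// inE.
Qed.

Let Fn n v := fine (kap n `]-oo, v]%classic).

Let Fn_nd n v w : v <= w -> Fn n v <= Fn n w.
Proof.
move=> vw; rewrite fine_le ?kapfin//; apply: le_measure; rewrite ?inE//.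
by apply: subset_itvl; rewrite bnd_simp.
Qed.

Let FnT n v : 0 <= Fn n v <= fine (kap n setT).
Proof.
by rewrite fine_ge0//= fine_le ?kapfin//; apply: le_measure; rewrite ?inE.
Qed.

(** Helly's theorem along an ultrafilter. The limits of the distribution functions, made
    right-continuous, define [m]; the mass [c] missing from the limit of the total masses has gone
    to +oo, since [kap0] bars it from the left. Integrals converge by approximation with step
    functions that jump at continuity points. *)
Lemma vague_compactness : exists (m : {measure set R -> \bar R}) (c : R),
  [/\ (m setT < +oo)%E, m `]-oo, 0[%classic = 0%E, 0 <= c &
  forall (h : R -> R) (M l : R), continuous h -> (forall x, `|h x| <= M) ->
    h x @[x --> +oo] --> l ->
    \int[kap n]_x h x @[n --> U] --> \int[m]_x h x + c * l].
Proof.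
have PU : ProperFilter U by exact: ultra_proper.
have /choice[F0 F0P] : forall v, exists l, 0 <= l <= C /\ Fn n v @[n --> U] --> l.
  move=> v; have [|l lC Fl] := @ultra_bounded_cvg _ U (Fn ^~ v) C UU.
    by near=> n; have /andP[-> /le_trans] := FnT n v; apply; near: n.
  by exists l.
have [|L LC kapL] := @ultra_bounded_cvg _ U (fun n => fine (kap n setT)) C UU.
  by near=> n; rewrite fine_ge0//=; near: n.
have F0nd v w : v <= w -> F0 v <= F0 w.
  move=> vw; apply: (ler_cvg_to (F0P v).2 (F0P w).2).
  by apply: nearW => n; exact: Fn_nd.
have F0L v : F0 v <= L.
  apply: (ler_cvg_to (F0P v).2 kapL).
  by apply: nearW => n; have /andP[] := FnT n v.
have F0neg v : v < 0 -> F0 v = 0.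
  move=> v0; apply: (cvg_unique _ (F0P v).2) => //.
  apply: cvg_near_cst; near=> n; rewrite /Fn (_ : kap n _ = 0%E)//.
  by near: n; exact: kap0.
(* The right-continuous version of the pointwise limit [F0]; the two can differ only at atoms of the
   measure that [F] defines. *)
pose F v := inf [set F0 w | w in `]v, +oo[%classic].
have Fhas v : has_inf [set F0 w | w in `]v, +oo[%classic].
  split; first by exists (F0 (v + 1)); exists (v + 1) => //=; rewrite in_itv/= andbT ltrDl.
  by exists 0 => y [w _ <-]; have [/andP[]] := F0P w.
have F_le v w : v < w -> F v <= F0 w.
  by move=> vw; apply: ge_inf; [exact: (Fhas v).2|exists w => //=; rewrite in_itv/= vw].
have F_ge v : F0 v <= F v.
  apply: lb_le_inf; first exact: (Fhas v).1.
  by move=> y [w /=]; rewrite in_itv/= andbT => vw <-; exact/F0nd/ltW.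
have Fnd : {homo F : v w / v <= w}.
  move=> v w; rewrite le_eqVlt => /predU1P[->//|vw].
  exact: (le_trans (F_le _ _ vw) (F_ge w)).
have Frc : right_continuous F.
  move=> v; apply/cvgrPdist_le => e e0.
  have [_ [w /= vw <-] Fw] := inf_adherent e0 (Fhas v).
  rewrite in_itv/= andbT in vw.
  near=> z; rewrite distrC ger0_norm; last first.
    by rewrite subr_ge0 Fnd//; near: z; exact: nbhs_right_ge.
  rewrite lerBlDl (le_trans _ (ltW Fw))//; apply: F_le.
  by near: z; exact: nbhs_right_lt.
have Fneg v : v < 0 -> F v = 0.
  move=> v0; apply/eqP; rewrite eq_le; apply/andP; split; last first.
    by rewrite -(F0neg v v0) F_ge.
  by rewrite -(F0neg (v / 2)) ?F_le//; lra.
have FL v : F v <= L by rewrite (le_trans (F_le v (v + 1) _))// ltrDl.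
pose FC : cumulative R R := HB.pack F (isCumulative.Build R _ R F Fnd Frc).
(* The identity carries the Stieltjes measure from [measurableTypeR R] to the measurable structure
   of [R] itself. *)
pose m0 : {measure set R -> \bar R} :=
  pushforward (lebesgue_stieltjes_measure FC) (idfun : measurableTypeR R -> R).
have mid : measurable_fun setT (idfun : measurableTypeR R -> R).
  by move=> _ A mA; rewrite setTI.
pose m := m0 mid.
have mitv a b : a <= b -> m `]a, b]%classic = (F b - F a)%:E.
  exact: (@lebesgue_stieltjes_itv _ FC).
have mray b : m `]-oo, b]%classic = (F b)%:E.
  have H1 : m `]- n%:R, b]%classic @[n --> \oo] --> m (\bigcup_n `]- n%:R, b]%classic).
    apply: nondecreasing_cvg_mu => //; first exact: bigcup_measurable.
    move=> i j ij; apply/subsetPset/subset_itvr; rewrite bnd_simp lerN2 ler_nat//.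
  have H2 : m `]- n%:R, b]%classic @[n --> \oo] --> (F b)%:E.
    apply: cvg_near_cst; near=> n.
    have n0 : 0 < n%:R :> R by near: n; exact: nbhs_infty_gtr.
    rewrite mitv ?(Fneg (- n%:R)) ?subr0 ?oppr_lt0// lerNl.
    by near: n; exact: nbhs_infty_ger.
  rewrite itvNybndEbigcup; exact: (cvg_unique _ H1 H2).
have mTL : (m setT <= L%:E)%E.
  have H1 : m `]-oo, n%:R]%classic @[n --> \oo] --> m (\bigcup_n `]-oo, n%:R]%classic).
    apply: nondecreasing_cvg_mu => //; first exact: bigcup_measurable.
    by move=> i j ij; apply/subsetPset/subset_itvl; rewrite bnd_simp ler_nat.
  have -> : [set: R] = \bigcup_n `]-oo, n%:R]%classic.
    apply/seteqP; split => // x _; exists (Num.bound `|x|) => //=.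
    by rewrite in_itv/= (le_trans (ler_norm _))// ltW// archi_boundP.
  move: (H1) => /(cvg_lim (@ereal_hausdorff R)) <-.
  apply: lime_le; first by apply/cvg_ex; eexists; exact: H1.
  by apply: nearW => n; rewrite mray lee_fin FL.
have mT : (m setT < +oo)%E by rewrite (le_lt_trans mTL)// ltry.
have mfin A : measurable A -> m A \is a fin_num.
  by move=> mA; rewrite ge0_fin_numE// (le_lt_trans _ mT)// le_measure// inE.
(* [L] is the limit of the total masses, and [c] the part of it that [m] does not carry. *)
exists m, (L - fine (m setT)); split.
- exact: mT.
- have -> : `]-oo, (0 : R)[%classic = \bigcup_n `]-oo, - n.+1%:R^-1]%classic.
    apply/seteqP; split => x /=.
      rewrite in_itv/= => x0; have nx : 0 < - x by rewrite oppr_gt0.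
      have [n] := ltr_add_invr nx; rewrite add0r => nx'.
      by exists n => //=; rewrite in_itv/= lerNr ltW.
    by move=> [n _] /=; rewrite !in_itv/= => /le_lt_trans; apply; rewrite oppr_lt0.
  have H1 : m `]-oo, - n.+1%:R^-1]%classic @[n --> \oo] -->
      m (\bigcup_n `]-oo, - n.+1%:R^-1]%classic).
    apply: nondecreasing_cvg_mu => //; first exact: bigcup_measurable.
    move=> i j ij; apply/subsetPset/subset_itvl.
    by rewrite bnd_simp lerN2 lef_pV2 ?posrE// ler_nat.
  apply: (cvg_unique _ H1) => //.
  by apply: cvg_near_cst; apply: nearW => n; rewrite mray Fneg// oppr_lt0.
- by rewrite subr_ge0 -lee_fin fineK// mfin.
move=> h M l ch hM hl.
have kapint n (f : R -> R) (B : R) : measurable_fun setT f -> (forall x, `|f x| <= B) ->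
    (kap n).-integrable setT (EFin \o f).
  by move=> mf fB; apply: (bounded_integrable _ mf fB).
have mint (f : R -> R) (B : R) : measurable_fun setT f -> (forall x, `|f x| <= B) ->
    m.-integrable setT (EFin \o f).
  by move=> mf fB; apply: (bounded_integrable _ mf fB).
have mh : measurable_fun setT h by exact: continuous_measurable_fun.
(* In [G s a], the number [a] stands for the value of [s] at +oo. *)
pose G (s : R -> R) a := [/\ measurable_fun setT s, exists B : R, forall x, `|s x| <= B &
  \int[kap n]_x s x @[n --> U] --> \int[m]_x s x + (L - fine (m setT)) * a].
have GD s s' a a' b b' : G s a -> G s' a' ->
    G (fun x => b * s x + b' * s' x) (b * a + b' * a').
  move=> [ms [B sB] sl] [ms' [B' sB'] sl']; split.
  - by apply: measurable_funD; apply: measurable_funM.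
  - exists (`|b| * B + `|b'| * B') => x; apply: (le_trans (ler_normD _ _)).
    by rewrite !normrM lerD// ler_wpM2l.
  have lin (mu : {measure set R -> \bar R}) : (mu setT < +oo)%E ->
      \int[mu]_x (b * s x + b' * s' x) = b * \int[mu]_x s x + b' * \int[mu]_x s' x.
    move=> muT.
    have si := bounded_integrable muT ms sB; have si' := bounded_integrable muT ms' sB'.
    rewrite RintegralD//; last 2 first.
    - have := integrableZl measurableT b si.
      by apply: eq_integrable => // x _; rewrite /= EFinM.
    - have := integrableZl measurableT b' si'.
      by apply: eq_integrable => // x _; rewrite /= EFinM.
    by rewrite !RintegralZl.
  rewrite (_ : (fun n => _) = (fun n =>
    b * \int[kap n]_x s x + b' * \int[kap n]_x s' x)); last first.
    by apply/funext => n; rewrite lin.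
  have -> : \int[m]_x (b * s x + b' * s' x) + (L - fine (m setT)) * (b * a + b' * a') =
    b * (\int[m]_x s x + (L - fine (m setT)) * a) +
    b' * (\int[m]_x s' x + (L - fine (m setT)) * a') by rewrite lin//; ring.
  by apply: cvgD; apply: cvgM => //; exact: cvg_cst.
(* At such points the limit of [Fn n v] is the value of the distribution function of [m]. They are
   dense, because [F v - F0 v] is at most the mass of [m] at [v]. *)
pose good v := F0 v = F v.
have goodP a b : a < b -> exists2 v, a < v < b & good v.
  move=> ab; have [v vab mv] := exists_null_point mT ab; exists v => //.
  apply/eqP; rewrite eq_le F_ge/= leNgt; apply/negP => F0F.
  have : ((F v - F0 v)%:E <= m [set v])%E.
    have -> : [set v] = \bigcap_n `]v - n.+1%:R^-1, v]%classic by rewrite set1_bigcap_oc.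
    have H1 : m `]v - n.+1%:R^-1, v]%classic @[n --> \oo] -->
        m (\bigcap_n `]v - n.+1%:R^-1, v]%classic).
      apply: nonincreasing_cvg_mu => //.
      - by rewrite -ge0_fin_numE// mfin.
      - exact: bigcap_measurable.
      - move=> i j ij; apply/subsetPset/subset_itvr.
        by rewrite bnd_simp lerD2l lerN2 lef_pV2 ?posrE// ler_nat.
    move: (H1) => /(cvg_lim (@ereal_hausdorff R)) <-.
    apply: lime_ge; first by apply/cvg_ex; eexists; exact: H1.
    apply: nearW => n; rewrite mitv; last by rewrite gerBl.
    by rewrite lee_fin lerD2l lerN2 F_le// ltrBlDr ltrDl.
  by rewrite mv lee_fin subr_le0 leNgt F0F.
have Fnitv n a b : a <= b -> fine (kap n `]a, b]%classic) = Fn n b - Fn n a.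
  move=> ab; apply/eqP; rewrite eq_sym subr_eq -fineD ?kapfin//; apply/eqP; congr fine.
  rewrite /Fn -measureU//.
  - by congr (kap n _); rewrite setUC -itv_bndbnd_setU ?bnd_simp.
  - apply/seteqP; split => // x []/=; rewrite !in_itv/= => /andP[ax _].
    by rewrite leNgt ax.
have Fntail n b : fine (kap n `]b, +oo[%classic) = fine (kap n setT) - Fn n b.
  apply/eqP; rewrite eq_sym subr_eq -fineD ?kapfin//; apply/eqP; congr fine.
  rewrite /Fn -measureU//.
  - by congr (kap n _); rewrite setUC -itv_bndbnd_setU ?bnd_simp// set_itvNyy.
  - apply/seteqP; split => // x []/=; rewrite !in_itv/= andbT => bx.
    by rewrite leNgt bx.
have Gitv a b : a < b -> good a -> good b -> G \1_(`]a, b]%classic) 0.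
  move=> ab ga gb; split => //; first by exists 1 => x; exact: normr_indic_le1.
  rewrite mulr0 addr0 Rintegral_indic// mitv ?(ltW ab)//=.
  rewrite (_ : (fun n => _) = (fun n => Fn n b - Fn n a)); last first.
    by apply/funext => n; rewrite Rintegral_indic// Fnitv ?(ltW ab).
  by rewrite -ga -gb; apply: cvgB; [exact: (F0P b).2|exact: (F0P a).2].
have Gtail b : good b -> G \1_(`]b, +oo[%classic) 1.
  move=> gb; split => //; first by exists 1 => x; exact: normr_indic_le1.
  rewrite mulr1 Rintegral_indic//.
  have -> : fine (m `]b, +oo[%classic) = fine (m setT) - F b.
    apply/eqP; rewrite eq_sym subr_eq -[F b]/(fine (F b)%:E) -mray -fineD ?mfin//.
    apply/eqP; congr fine; rewrite -measureU//.
    + by congr (m _); rewrite setUC -itv_bndbnd_setU ?bnd_simp// set_itvNyy.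
    + apply/seteqP; split => // x []/=; rewrite !in_itv/= andbT => bx.
      by rewrite leNgt bx.
  rewrite addrAC [_ + (L - _)]addrC subrK -gb.
  rewrite (_ : (fun n => _) = (fun n => fine (kap n setT) - Fn n b)); last first.
    by apply/funext => n; rewrite Rintegral_indic// Fntail.
  by apply: cvgB; [exact: kapL|exact: (F0P b).2].
apply/cvgrPdist_le => e e0.
have C0 : 0 <= C by case/andP: LC; exact: le_trans.
have [M0|M0] := leP 0 M; last first.
  by have := le_trans (normr_ge0 _) (hM 0); rewrite leNgt M0.
(* The error is split in three: [e1] times the mass bound [C], once for [m] and once for [kap n],
   and [e / 3] for the step function. *)
pose e1 := e / (3 * (C + 1)).
have e10 : 0 < e1 by rewrite divr_gt0// mulr_gt0// ltr_wpDl.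
have [V HV] : exists V, forall x, V < x -> `|h x - l| <= e1.
  have /cvgrPdist_le/(_ e1 e10)[V [_ HV]] := hl.
  by exists V => x Vx; rewrite distrC; exact: HV.
have [delta d0 dP] := segment_unif_continuous (-2) (Num.max V 0 + 2) ch e10.
pose Vm := Num.max V 0; pose eta := Num.min delta 1 / 2.
have eta0 : 0 < eta by rewrite divr_gt0// lt_min d0/=.
have eta1 : 2 * eta <= 1 by rewrite /eta mulrCA divff// mulr1 ge_min lexx orbT.
have etad : 2 * eta <= delta by rewrite /eta mulrCA divff// mulr1 ge_min lexx.
have [g0 /andP[g02 g01] good0] : exists2 v, -2 < v < -1 & good v by apply: goodP; lra.
(* The step function grows cell by cell: each new endpoint is a good point at distance between [eta]
   and [2 * eta] from the last one, within the modulus [delta], until the endpoint passes [Vm],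
   beyond which [h] is close to [l]. *)
have cells N : exists g s, [/\ good g, g0 + N%:R * eta <= g \/ Vm < g,
    G s 0, g0 <= g & forall x, `|h x - s x| <= e1 /\ g0 < x <= g \/
      s x = 0 /\ (x <= g0 \/ g < x)].
  elim: N => [|N [g [s [gg gN Gs g0g hs]]]].
    exists g0, (fun x => 0 * \1_(`]g0, +oo[%classic) x + 0 * \1_(`]g0, +oo[%classic) x).
    split => //; first by left; rewrite mul0r addr0.
      by have := GD _ _ _ _ 0 0 (Gtail _ good0) (Gtail _ good0); rewrite !mul0r addr0.
    move=> x; right; rewrite !mul0r addr0; split=> //.
    by have [|] := leP x g0; [left|right].
  have [Vg|gV] := ltP Vm g; first by exists g, s; split => //; right.
  have [g' /andP[gg1 gg2] good'] : exists2 v, g + eta < v < g + 2 * eta & good v.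
    by apply: goodP; lra.
  have gg' : g < g' by lra.
  exists g', (fun x => 1 * s x + h g' * \1_(`]g, g']%classic) x); split => //.
  - left; case: gN => [gN|]; last by rewrite ltNge gV.
    by rewrite -natr1 mulrDl mul1r; lra.
  - by have := GD _ _ _ _ 1 (h g') Gs (Gitv _ _ gg' gg good'); rewrite !mulr0 addr0.
  - lra.
  move=> x; rewrite mul1r indicE.
  have [xg|xg] := leP x g.
    rewrite memNset/= ?in_itv/=; last by rewrite ltNge xg.
    rewrite mulr0 addr0; case: (hs x) => [[h1 /andP[h2 h3]]|[h1 [h2|h2]]].
    - by left; split=> //; rewrite h2 (le_trans xg (ltW gg')).
    - by right; split=> //; left.
    - by rewrite ltNge xg in h2.
  have -> : s x = 0.
    by case: (hs x) => [[_ /andP[_]]|[]//]; rewrite leNgt xg.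
  have [xg'|xg'] := leP x g'.
    left; rewrite mem_set/= ?in_itv/= ?xg ?xg'// mulr1 add0r; split; last first.
      by rewrite (le_lt_trans g0g xg).
    have x1 : -2 <= x by lra.
    have x2 : x <= Vm + 2 by lra.
    apply: dP; first by rewrite x1.
    by rewrite ltr_distl; apply/andP; split; lra.
  right; rewrite memNset/= ?in_itv/= ?mulr0 ?addr0; last by rewrite leNgt xg' andbF.
  by split=> //; right.
have [g [s [gg Vg Gs g0g hs]]] : exists g s, [/\ good g, Vm < g,
    G s 0, g0 <= g & forall x, `|h x - s x| <= e1 /\ g0 < x <= g \/
      s x = 0 /\ (x <= g0 \/ g < x)].
  have [N NP] : exists N : nat, (Vm + 3) / eta < N%:R.
    exists (Num.bound ((Vm + 3) / eta)); apply: archi_boundP.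
    by rewrite divr_ge0 ?(ltW eta0)// addr_ge0// /Vm le_max lexx orbT.
  have [g [s [gg gN Gs g0g hs]]] := cells N; exists g, s; split => //.
  case: gN => // gN; apply: lt_le_trans gN.
  by move: NP; rewrite ltr_pdivrMr//; lra.
pose s' x := 1 * s x + l * \1_(`]g, +oo[%classic) x.
have Gs' : G s' l by have := GD _ _ _ _ 1 l Gs (Gtail _ gg); rewrite mulr0 add0r mulr1.
have hs' x : g0 < x -> `|h x - s' x| <= e1.
  move=> g0x; rewrite /s' mul1r indicE; have [xg|xg] := leP x g.
    rewrite memNset/= ?in_itv/= ?andbT; last by rewrite ltNge xg.
    rewrite mulr0 addr0; case: (hs x) => [[]//|[_ [|]]]; last by rewrite ltNge xg.
    by rewrite leNgt g0x.
  rewrite mem_set/= ?in_itv/= ?xg// mulr1.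
  have -> : s x = 0 by case: (hs x) => [[_ /andP[_]]|[]//]; rewrite leNgt xg.
  rewrite add0r; apply: HV; apply: le_lt_trans (lt_trans Vg xg).
  by rewrite le_max lexx.
have [ms' [B sB] sl] := Gs'.
(* To the right of [g0] the functions [h] and [s'] are [e1]-close; on the left they are merely
   bounded, but there [m] has no mass, nor has [kap n] eventually. *)
have close (mu : {measure set R -> \bar R}) : (mu setT < +oo)%E ->
    mu `]-oo, g0]%classic = 0%E -> fine (mu setT) <= C ->
    `|\int[mu]_x h x - \int[mu]_x s' x| <= e1 * C.
  move=> muT mu0 muC.
  have hi := bounded_integrable muT mh hM; have si := bounded_integrable muT ms' sB.
  rewrite -RintegralB//.
  have mhs : measurable_fun setT (fun x => h x - s' x) by exact: measurable_funB.
  have hsB x : `|h x - s' x| <= M + B by rewrite (le_trans (ler_normB _ _))// lerD.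
  apply: (le_trans (le_normr_Rintegral _ (bounded_integrable muT mhs hsB))) => //.
  have i1 : mu.-integrable setT (EFin \o (fun=> e1)).
    by apply: (@bounded_integrable _ _ _ _ _ `|e1|).
  have i2 : mu.-integrable setT
      (EFin \o (fun x => (M + B) * \1_(`]-oo, g0]%classic) x)).
    have := integrableZl measurableT (M + B)
      (indic_integrable muT (measurable_itv `]-oo, g0])).
    by apply: eq_integrable => // x _; rewrite /= EFinM.
  apply: (@le_trans _ _ (\int[mu]_x (e1 + (M + B) * \1_(`]-oo, g0]%classic) x))).
    apply: le_Rintegral => //.
    - apply: (bounded_integrable (M := M + B)) => //.
        exact: measurableT_comp.
      by move=> x; rewrite normr_id.
    - have := integrableD measurableT i1 i2.
      by apply: eq_integrable.
    - move=> x _; rewrite indicE; have [xg|xg] := leP x g0.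
        by rewrite mem_set/= ?in_itv//= mulr1 (le_trans (hsB x))// lerDr ltW.
      by rewrite memNset/= ?in_itv/= ?mulr0 ?addr0 ?hs'// leNgt xg.
  rewrite RintegralD// Rintegral_cst// RintegralZl//; last exact: indic_integrable.
  by rewrite Rintegral_indic// mu0 mulr0 addr0 ler_wpM2l// ltW.
have m0' : m `]-oo, g0]%classic = 0%E by rewrite mray Fneg//; lra.
have mC : fine (m setT) <= C.
  by case/andP: LC => _; apply: le_trans; rewrite -lee_fin fineK// mfin.
have h1 := close m mT m0' mC.
have e30 : 0 < e / 3 by rewrite divr_gt0.
have /cvgrPdist_le/(_ _ e30) h2 := sl.
near=> n.
have h3 : `|\int[kap n]_x h x - \int[kap n]_x s' x| <= e1 * C.
  apply: close => //; last by near: n.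
  by near: n; apply: kap0; lra.
have h4 : `|\int[m]_x s' x + (L - fine (m setT)) * l - \int[kap n]_x s' x| <= e / 3.
  by near: n.
have h5 : e1 * C <= e / 3.
  rewrite /e1 mulrAC invfM mulrA ler_pdivrMr ?ltr_wpDl//.
  by rewrite mulrAC ler_pM2l// lerDl.
move: (h1) (h3) (h4); rewrite !ler_norml => /andP[? ?] /andP[? ?] /andP[? ?].
by apply/andP; split; lra.
Unshelve. all: by end_near.
Qed.

End vague_compactness.

(** * Expectations under product laws *)

Section product_expectation.
Context (R : realType) (k : nat) (d : 'I_k -> measure_display)
  (T : forall i, measurableType (d i)) (P : forall i, probability (T i) R).
Local Notation PP := (product_probability P).
Implicit Types h : forall i, T i -> R.

Lemma measurable_coord_comp h i : measurable_fun setT (h i) ->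
  measurable_fun setT (fun w : product_space T => h i (w i)).
Proof. by move=> mh; apply: measurableT_comp => //; exact: measurable_coord. Qed.

Lemma measurable_prod_coord (Q : pred 'I_k) h :
  (forall i, measurable_fun setT (h i)) ->
  measurable_fun setT (fun w : product_space T => \prod_(i < k | Q i) h i (w i)).
Proof.
move=> mh; rewrite (_ : (fun w => _) = fun w : product_space T =>
  \prod_(i < k) (if Q i then h i (w i) else 1)); last first.
  by apply/funext => w; rewrite big_mkcond.
apply: measurable_prod => i _.
by case: (Q i) => //; exact: measurable_coord_comp.
Qed.

(** Factors are released one coordinate at a time from indicators to general nonnegative functions,
    starting from boxes, where the product formula is the defining property of the product law. *)
Lemma expectation_prod_ge0 h : (forall i, measurable_fun setT (h i)) ->
  (forall i x, 0 <= h i x) -> (forall i, (\int[P i]_x (h i x)%:E < +oo)%E) ->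
  (\int[PP]_w (\prod_(i < k) h i (w i))%:E = \prod_(i < k) \int[P i]_x (h i x)%:E)%E.
Proof.
(* Induction on the number [j] of leading coordinates whose factor may be other than an indicator;
   for [j >= k] this is no restriction. *)
have [j kj] : exists j, (k <= j)%N by exists k.
have {kj} : forall i : 'I_k, (j <= i)%N -> exists2 A, measurable A & h i = \1_A.
  by move=> i ji; have := leq_trans kj ji; rewrite leqNgt ltn_ord.
elim: j h => [|j IH] h hj mh h0 hoo.
  have /all_sig2 /= [A mA hA] : forall i : 'I_k,
      {A : set (T i) | measurable A & h i = \1_A}.
    by move=> i; apply/cid2/hj.
  have -> : (fun w : product_space T => (\prod_(i < k) h i (w i))%:E) =
      EFin \o \1_([set w : product_space T | forall i, A i (w i)]).
    apply/funext => w /=; congr EFin.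
    have [wA|wA] := pselect (forall i, A i (w i)).
      by rewrite indicE mem_set// big1// => i _; rewrite hA indicE mem_set.
    rewrite indicE memNset//; have [i wi] : exists i, ~ A i (w i) by exact/existsNP.
    by rewrite (bigD1 i)//= hA indicE memNset// mul0r.
  rewrite integral_indic//; last first.
    rewrite (_ : [set _ | _] = \bigcap_(i in [set: 'I_k])
      (fun w : product_space T => w i) @^-1` A i).
      apply: fin_bigcap_measurable => // i _; rewrite -[X in measurable X]setTI.
      exact: measurable_coord.
    by apply/seteqP; split=> [w wA i _|w wA i]; exact: wA.
  rewrite setIT; transitivity (\prod_(i < k) P i (A i))%E.
    exact: product_probabilityE.
  apply: eq_bigr => i _.
  by rewrite hA integral_indic// setIT.
have [jk|kj] := ltnP j k; last first.
  by apply: IH => // i ji; have := leq_trans kj ji; rewrite leqNgt ltn_ord.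
pose i0 := Ordinal jk.
pose S (w : product_space T) := \prod_(i < k | i != i0) h i (w i).
have mS : measurable_fun setT S by exact: measurable_prod_coord.
have S0 w : 0 <= S w by apply: prodr_ge0 => i _.
have fi i : (\int[P i]_x (h i x)%:E)%E \is a fin_num.
  by rewrite ge0_fin_numE// integral_ge0// => x _; rewrite lee_fin.
pose c := \prod_(i < k | i != i0) fine (\int[P i]_x (h i x)%:E)%E.
have c0 : 0 <= c by apply: prodr_ge0 => i _; rewrite fine_ge0// integral_ge0// => x _; rewrite lee_fin.
have mc := @measurable_coord k d T i0.
(* With the other factors fixed, the expectation of \1_B (w i0) S w is, as a measure in [B], a
   multiple of [P i0]: an indicator at the coordinate [i0] is the case of the induction
   hypothesis. *)
have nuE (B : set (T i0)) : measurable B ->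
    (\int[PP]_w ((\1_B (w i0))%:E * (S w)%:E) = c%:E * P i0 B)%E.
  move=> mB; pose hB := @dfwith _ (fun i => T i -> R) h i0 \1_B.
  have hB0 : hB i0 = \1_B by rewrite /hB dfwithin.
  have hBn i : i != i0 -> hB i = h i by move=> ii0; rewrite /hB dfwithout// eq_sym.
  have := IH hB; rewrite (bigD1 i0)//= hB0.
  under eq_integral.
    move=> w _; rewrite (bigD1 i0)//= hB0 EFinM.
    rewrite (eq_bigr (fun i => h i (w i))); last by move=> i ii0; rewrite hBn.
    over.
  move=> -> //.
  - rewrite muleC integral_indic// setIT; congr (_ * _)%E.
    rewrite /c -prodEFin; apply: eq_bigr => i ii0.
    by rewrite fineK ?hBn.
  - move=> i ji; have [->|ii0] := eqVneq i i0; first by exists B.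
    have ij : nat_of_ord i != j by apply: contra ii0 => /eqP e; apply/eqP/val_inj.
    by rewrite hBn//; apply: hj; rewrite ltn_neqAle eq_sym ij.
  - move=> i; have [->|ii0] := eqVneq i i0; first by rewrite hB0.
    by rewrite hBn.
  - move=> i x; have [e|ii0] := eqVneq i i0; last by rewrite hBn.
    by subst i; rewrite hB0.
  - move=> i; have [->|ii0] := eqVneq i i0; last by rewrite hBn.
    by rewrite hB0 integral_indic// setIT (le_lt_trans (probability_le1 _ _))// ltry.
have c0' : c%:E = (NngNum c0)%:num%:E :> \bar R by [].
transitivity (\int[mscale (NngNum c0) (P i0)]_x (h i0 x)%:E)%E.
  rewrite -(@eq_measure_integral _ _ _ setT _
    (image_measure (density_measure PP mS S0) mc)); last first.
    move=> B mB _; rewrite -[RHS]/(c%:E * P i0 B)%E -nuE//.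
    rewrite -[LHS]/(mdensity PP S _) /mdensity integral_mkcond.
    by apply: eq_integral => w _; rewrite epatch_indic muleC.
  rewrite ge0_integral_image; last 2 first.
  - exact/measurable_EFinP.
  - by move=> y; rewrite lee_fin.
  rewrite ge0_integral_mdensity; last 2 first.
  - by apply/measurable_EFinP; exact: (@measurable_coord_comp h).
  - by move=> w; rewrite lee_fin.
  by apply: eq_integral => w _; rewrite (bigD1 i0)//= EFinM.
rewrite ge0_integral_mscale//; last 2 first.
- exact/measurable_EFinP.
- by move=> x _; rewrite lee_fin.
rewrite (bigD1 i0)//= muleC; congr (_ * _)%E.
by rewrite /c -prodEFin; apply: eq_bigr => i ii0; rewrite fineK.
Qed.

(** The two measures agree on boxes, by the product formula applied to the factors [h i] times
    indicators, and boxes generate and are stable under intersection. *)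
Lemma product_probability_density (Q : forall i, probability (T i) R) h :
  (forall i, measurable_fun setT (h i)) -> (forall i x, 0 <= h i x) ->
  (forall i A, measurable A -> Q i A = \int[P i]_(x in A) (h i x)%:E)%E ->
  forall g : product_space T -> \bar R,
    measurable_fun setT g -> (forall w, 0 <= g w)%E ->
  (\int[product_probability Q]_w g w =
   \int[PP]_w (g w * (\prod_(i < k) h i (w i))%:E))%E.
Proof.
move=> mh h0 Qh g mg g0.
pose S (w : product_space T) := \prod_(i < k) h i (w i).
have mS : measurable_fun setT S by exact: (@measurable_prod_coord xpredT).
have S0 w : 0 <= S w by apply: prodr_ge0.
rewrite -(ge0_integral_mdensity PP mS S0)//.
apply: eq_measure_integral => A mA _.
pose G : set (set (product_space T)) :=
  [set C | exists2 B : forall i, set (T i), (forall i, measurable (B i)) &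
    C = [set w | forall i, B i (w i)]].
have mG C : G C -> measurable C.
  move=> [B mB ->]; rewrite (_ : [set _ | _] = \bigcap_(i in [set: 'I_k])
      (fun w : product_space T => w i) @^-1` B i).
    apply: fin_bigcap_measurable => // i _; rewrite -[X in measurable X]setTI.
    exact: measurable_coord.
  by apply/seteqP; split=> [w wA i _|w wA i]; exact: wA.
apply: (@measure_unique _ _ _ G (fun=> setT)) => //.
- apply/seteqP; split => B; last first.
    by apply: smallest_sub; [exact: sigma_algebra_measurable|exact: mG].
  apply: smallest_sub; first exact: smallest_sigma_algebra.
  move=> _ [i [C [mC ->]]]; apply: sub_sigma_algebra.
  exists (@dfwith _ (fun i => set (T i)) (fun=> setT) i C).
    move=> j; have [->|ji] := eqVneq j i; first by rewrite dfwithin.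
    by rewrite dfwithout// eq_sym.
  apply/seteqP; split => w /= wC; last by have := wC i; rewrite dfwithin.
  move=> j; have [->|ji] := eqVneq j i; first by rewrite dfwithin.
  by rewrite dfwithout// eq_sym.
- move=> _ _ [B mB ->] [C mC ->]; exists (fun i => B i `&` C i).
    by move=> i; exact: measurableI.
  apply/seteqP; split => w /=; first by move=> [wB wC] i; split.
  by move=> wBC; split => i; have [] := wBC i.
- move=> i; exists (fun=> setT) => //.
  by apply/seteqP; split.
- by rewrite bigcup_const.
- move=> _ [B mB ->]; rewrite -[RHS]/(mdensity PP S _) /mdensity.
  transitivity (\prod_(i < k) Q i (B i))%E; first exact: product_probabilityE.
  pose hB i x : R := h i x * \1_(B i) x.
  transitivity (\prod_(i < k) \int[P i]_x (hB i x)%:E)%E.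
    apply: eq_bigr => i _; rewrite Qh// [LHS]integral_mkcond; apply: eq_integral => x _.
    by rewrite epatch_indic.
  rewrite -expectation_prod_ge0.
  + rewrite [RHS]integral_mkcond; apply: eq_integral => w _.
    rewrite epatch_indic -EFinM; congr EFin; rewrite big_split/=; congr (_ * _).
    have [wB|wB] := pselect (forall i, B i (w i)).
      by rewrite indicE mem_set// big1// => i _; rewrite indicE mem_set.
    rewrite indicE memNset//; have [i wi] : exists i, ~ B i (w i) by exact/existsNP.
    by rewrite (bigD1 i)//= indicE memNset// mul0r.
  + by move=> i; apply: measurable_funM.
  + by move=> i x; rewrite mulr_ge0.
  + move=> i; rewrite (_ : integral _ _ _ = Q i (B i)).
      by rewrite (le_lt_trans (probability_le1 _ _))// ltry.
    rewrite Qh// [RHS]integral_mkcond; apply: eq_integral => x _.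
    by rewrite epatch_indic.
- by move=> i; rewrite (le_lt_trans (probability_le1 _ _))// ltry.
Qed.

End product_expectation.

(** * Expectations of complex products *)

Section complex_expectation.
Local Open Scope complex_scope.
Context d (T : measurableType d) (R : realType).
Variable P : {measure set T -> \bar R}.
Implicit Types f : T -> R[i].

Definition cexpectation f : R[i] :=
  (\int[P]_x complex.Re (f x)) +i* (\int[P]_x complex.Im (f x)).

Definition cintegrable f :=
  P.-integrable setT (EFin \o (fun x => complex.Re (f x))) /\
  P.-integrable setT (EFin \o (fun x => complex.Im (f x))).

Lemma Re_sum (I : Type) (s : seq I) (F : I -> R[i]) :
  complex.Re (\sum_(i <- s) F i) = \sum_(i <- s) complex.Re (F i).
Proof. by elim/big_rec2: _ => //= i x [a b] _ <-; case: (F i). Qed.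

Lemma Im_sum (I : Type) (s : seq I) (F : I -> R[i]) :
  complex.Im (\sum_(i <- s) F i) = \sum_(i <- s) complex.Im (F i).
Proof. by elim/big_rec2: _ => //= i x [a b] _ <-; case: (F i). Qed.

Lemma ReM_real (a : R[i]) (x : R) : complex.Re (a * x%:C) = complex.Re a * x.
Proof. by case: a => a b /=; rewrite mulr0 subr0. Qed.

Lemma ImM_real (a : R[i]) (x : R) : complex.Im (a * x%:C) = complex.Im a * x.
Proof. by case: a => a b /=; rewrite mulr0 add0r. Qed.

Lemma cexpectation_sum (I : Type) (s : seq I) (c : I -> R[i]) (g : I -> T -> R) :
  (forall i, P.-integrable setT (EFin \o g i)) ->
  cexpectation (fun x => \sum_(i <- s) c i * (g i x)%:C) =
  \sum_(i <- s) c i * (\int[P]_x g i x)%:C.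
Proof.
move=> gi; apply/eqP; rewrite eq_complex /cexpectation/=; apply/andP; split; apply/eqP.
  rewrite Re_sum; under eq_bigr do rewrite ReM_real.
  rewrite -Rintegral_sum//; apply: eq_Rintegral => x _.
  by rewrite Re_sum; apply: eq_bigr => i _; rewrite ReM_real.
rewrite Im_sum; under eq_bigr do rewrite ImM_real.
rewrite -Rintegral_sum//; apply: eq_Rintegral => x _.
by rewrite Im_sum; apply: eq_bigr => i _; rewrite ImM_real.
Qed.

End complex_expectation.

Section complex_product.
Local Open Scope complex_scope.
Context (R : realType).

(* A complex number as a combination of four nonnegative reals. *)
Definition quarter (q : 'I_4) (z : R[i]) : R :=
  nth 0 [:: Num.max (complex.Re z) 0; Num.max (- complex.Re z) 0;
            Num.max (complex.Im z) 0; Num.max (- complex.Im z) 0] q.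

Definition quarter_unit (q : 'I_4) : R[i] := nth 0 [:: 1; -1; 'i; - 'i] q.

Lemma quarterE (z : R[i]) : z = \sum_(q < 4) quarter_unit q * (quarter q z)%:C.
Proof.
have mx (x : R) : Num.max x 0 - Num.max (- x) 0 = x.
  by rewrite /Num.max; case: ifPn => h1; case: ifPn => h2; lra.
rewrite !big_ord_recl big_ord0 /quarter_unit /quarter/=; case: z => a b.
apply/eqP; rewrite eq_complex /= !(mul0r, mul1r, mulr0, subr0, add0r, addr0, oppr0, sub0r, mulN1r) /=.
by rewrite !mx !eqxx.
Qed.

Lemma quarter_ge0 q z : 0 <= quarter q z.
Proof.
by case: q => -[|[|[|[|]]]]//= i; rewrite /quarter/= le_max lexx orbT.
Qed.

Lemma quarter_le q z : quarter q z <= `|complex.Re z| + `|complex.Im z|.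
Proof.
have := normr_ge0 (complex.Re z); have := normr_ge0 (complex.Im z).
have := ler_norm (complex.Re z); have := ler_norm (complex.Im z).
have := ler_norm (- complex.Re z); have := ler_norm (- complex.Im z); rewrite !normrN.
by case: q => -[|[|[|[|]]]]//= i; rewrite /quarter/= ge_max => *; apply/andP; split; lra.
Qed.

Lemma integrable_quarter d (T : measurableType d) (P : {measure set T -> \bar R})
  (f : T -> R[i]) q : cintegrable P f ->
  P.-integrable setT (EFin \o (fun x => quarter q (f x))).
Proof.
move=> [fr fi]; have mr : measurable_fun setT (fun x => complex.Re (f x)).
  by apply/measurable_EFinP; exact: measurable_int fr.
have mi : measurable_fun setT (fun x => complex.Im (f x)).
  by apply/measurable_EFinP; exact: measurable_int fi.
have mm (g : T -> R) : measurable_fun setT g -> measurable_fun setT (fun x => Num.max (g x) 0).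
  by move=> mg; apply: measurable_maxr.
have mN (g : T -> R) : measurable_fun setT g -> measurable_fun setT (fun x => - g x).
  by move=> mg; exact: measurableT_comp.
have := integrableD measurableT (integrable_norm fr) (integrable_norm fi).
apply: le_integrable => //.
  apply/measurable_EFinP.
  by case: q => -[|[|[|[|]]]]//= i; rewrite /quarter/=; apply: mm => //; exact: mN.
move=> x _ /=; rewrite lee_fin ger0_norm ?quarter_ge0// ger0_norm ?addr_ge0//.
exact: quarter_le.
Qed.

Context (k : nat) (d : 'I_k -> measure_display)
  (T : forall i, measurableType (d i)) (P : forall i, probability (T i) R).

(** Each factor is a combination of four nonnegative quarters; expanding the product over all
    choices reduces the claim to nonnegative functions, and the integrability on the product space
    comes out of the same formula. *)
Lemma cexpectation_prod (h : forall i, T i -> R[i]) :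
  (forall i, cintegrable (P i) (h i)) ->
  cexpectation (product_probability P)
    (fun w : product_space T => \prod_(i < k) h i (w i)) =
  \prod_(i < k) cexpectation (P i) (h i).
Proof.
move=> hi.
have expand (z : 'I_k -> R[i]) : \prod_(i < k) z i =
    \sum_(s : {ffun 'I_k -> 'I_4}) (\prod_(i < k) quarter_unit (s i)) *
      (\prod_(i < k) quarter (s i) (z i))%:C.
  under eq_bigr do rewrite (quarterE (z _)).
  rewrite (bigA_distr_bigA (fun i q => quarter_unit q * (quarter q (z i))%:C)).
  apply: eq_bigr => s _; rewrite big_split/=; congr (_ * _).
  by rewrite (rmorph_prod (real_complex R)).
have Eexpand i : cexpectation (P i) (h i) = \sum_(q < 4) quarter_unit q *
    (\int[P i]_x quarter q (h i x))%:C.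
  rewrite -cexpectation_sum//; last by move=> q; exact: integrable_quarter.
  by congr cexpectation; apply/funext => x; rewrite [LHS]quarterE.
under [RHS]eq_bigr do rewrite Eexpand.
rewrite (bigA_distr_bigA (fun i q => quarter_unit q * (\int[P i]_x quarter q (h i x))%:C)).
rewrite (_ : (fun w => _) = (fun w : product_space T =>
  \sum_(s : {ffun 'I_k -> 'I_4}) (\prod_(i < k) quarter_unit (s i)) *
      (\prod_(i < k) quarter (s i) (h i (w i)))%:C)); last first.
  by apply/funext => w; rewrite expand.
have qm i q : measurable_fun setT (fun x => quarter q (h i x)).
  by apply/measurable_EFinP; exact: (measurable_int (P i)) (integrable_quarter q (hi i)).
have qoo i q : (\int[P i]_x (quarter q (h i x))%:E < +oo)%E.
  have /integrableP[_] := integrable_quarter q (hi i).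
  under eq_integral do rewrite /= ger0_norm ?quarter_ge0//.
  by [].
have prodE (s : {ffun 'I_k -> 'I_4}) := @expectation_prod_ge0 R k d T P
  (fun i x => quarter (s i) (h i x)) (fun i => qm i (s i))
  (fun i x => quarter_ge0 _ _) (fun i => qoo i (s i)).
have prodEF (s : {ffun 'I_k -> 'I_4}) :
    (\int[product_probability P]_w (\prod_(i < k) quarter (s i) (h i (w i)))%:E =
     (\prod_(i < k) \int[P i]_x quarter (s i) (h i x))%:E)%E.
  rewrite prodE -prodEFin; apply: eq_bigr => i _; rewrite fineK//.
  rewrite ge0_fin_numE//; apply: integral_ge0 => x _; rewrite lee_fin; exact: quarter_ge0.
rewrite cexpectation_sum.
  apply: eq_bigr => s _; rewrite big_split/=; congr (_ * _).
  by rewrite -(rmorph_prod (real_complex R)) /Rintegral prodEF.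
move=> s; apply/integrableP; split.
  by apply/measurable_EFinP; apply: (@measurable_prod_coord _ _ _ _ xpredT (fun i x => quarter (s i) (h i x))).
under eq_integral.
  move=> w _; rewrite /= ger0_norm; last by apply: prodr_ge0 => i _; exact: quarter_ge0.
  over.
by rewrite prodEF ltry.
Qed.

End complex_product.

(** The inverse is e^{- ln f} where f > 0, and 0 at the zeros of f by the convention on inverses. *)
Lemma measurable_funV_ge0 d (T : measurableType d) (R : realType) (f : T -> R) :
  measurable_fun setT f -> (forall x, 0 <= f x) ->
  measurable_fun setT (fun x => (f x)^-1).
Proof.
move=> mf f0; rewrite (_ : (fun x => _) =
    fun x => if f x == 0 then 0 else expR (- ln (f x))); last first.
  apply/funext => x; case: eqVneq => [->|fx0]; first by rewrite invr0.
  by rewrite expRN lnK// posrE lt0r fx0 f0.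
apply: measurable_fun_ifT => //; first exact: measurable_fun_eqr.
apply: measurableT_comp => //; apply: measurableT_comp => //.
exact: measurableT_comp.
Qed.

(** * Uniqueness and existence of triplets *)

Section levy_khintchine_real.
Context (R : realType).
Local Open Scope complex_scope.
Implicit Types (nu eta : {measure set R -> \bar R}) (t : R).

Lemma cexpE (a b : R) : cexp (a +i* b) = (expR a * cos b) +i* (expR a * sin b).
Proof.
rewrite /cexp/=; apply/eqP.
by rewrite eq_complex /= !mul0r subr0 addr0 !eqxx.
Qed.

Lemma ImulC_real (x : R) : 'i * x%:C = 0 +i* x :> R[i].
Proof.
apply/eqP; rewrite eq_complex /=; apply/andP; split; apply/eqP; lra.
Qed.

Lemma char_funE nu t :
  char_fun nu t = (\int[nu]_x cos (t * x)) +i* (\int[nu]_x sin (t * x)).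
Proof.
rewrite /char_fun /cintegral; apply/eqP; rewrite eq_complex; apply/andP.
split; apply/eqP; apply: eq_Rintegral => x _.
  by rewrite ImulC_real cexpE expR0 mul1r.
by rewrite ImulC_real cexpE expR0 /= mul1r.
Qed.

(** [lk_Re] and [lk_Im] are the real and imaginary parts of the Levy-Khintchine exponent. The
    integrals run over all of R, as the integrands vanish at 0. *)
Definition lk_Re (sigma2 : R) eta t : R :=
  - (sigma2 * t ^+ 2 / 2) + \int[eta]_x (cos (t * x) - 1).

Definition lk_Im (gamma : R) eta t : R :=
  gamma * t + \int[eta]_x (sin (t * x) - t * x / (1 + x ^+ 2)).

Lemma Rintegral_setC0 eta (f : R -> R) : f 0 = 0 ->
  \int[eta]_(x in [set~ 0]) f x = \int[eta]_x f x.
Proof.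
move=> f0; rewrite Rintegral_mkcond; apply: eq_Rintegral => x _.
rewrite patchE; case: ifPn => //; rewrite notin_setE/= => /contrapT ->.
by rewrite f0.
Qed.

Lemma levy_khintchine_tripletE nu gamma sigma2 eta :
  levy_khintchine_triplet nu gamma sigma2 eta <->
  [/\ 0 <= sigma2, levy_measure eta &
    forall t, char_fun nu t = cexp (lk_Re sigma2 eta t +i* lk_Im gamma eta t)].
Proof.
suff H t : 'i * (gamma * t)%:C - (sigma2 * t ^+ 2 / 2)%:C +
    cintegral eta [set~ 0] (fun x =>
      cexp ('i * (t * x)%:C) - 1 - 'i * (t * x / (1 + x ^+ 2))%:C) =
    lk_Re sigma2 eta t +i* lk_Im gamma eta t.
  by split=> -[? ? c]; split => // t; rewrite c H.
rewrite /cintegral /lk_Re /lk_Im -(@Rintegral_setC0 _ (fun x => cos (t * x) - 1)); last first.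
  by rewrite mulr0 cos0 subrr.
rewrite -(@Rintegral_setC0 _ (fun x => sin (t * x) - t * x / (1 + x ^+ 2))); last first.
  by rewrite mulr0 sin0 mul0r subrr.
have E x : cexp ('i * (t * x)%:C) - 1 - 'i * (t * x / (1 + x ^+ 2))%:C =
    (cos (t * x) - 1) +i* (sin (t * x) - t * x / (1 + x ^+ 2)) :> R[i].
  rewrite !ImulC_real cexpE expR0 !mul1r; apply/eqP; rewrite eq_complex /=.
  by apply/andP; split; apply/eqP; lra.
under [X in X +i* _]eq_Rintegral do rewrite E.
under [X in _ +i* X]eq_Rintegral do rewrite E.
rewrite ImulC_real; apply/eqP; rewrite eq_complex /=.
by apply/andP; split; apply/eqP; lra.
Qed.

Definition levy_weight (x : R) : R := Num.min (x ^+ 2) 1.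

Lemma levy_weight_ge0 x : 0 <= levy_weight x.
Proof. by rewrite /levy_weight le_min sqr_ge0 ler01. Qed.

Lemma measurable_levy_weight : measurable_fun setT levy_weight.
Proof. by apply: measurable_minr => //; exact: exprn_measurable. Qed.

Lemma levy_integrable eta (f : R -> R) (C : R) : levy_measure eta ->
  measurable_fun setT f -> (forall x, `|f x| <= C * levy_weight x) ->
  eta.-integrable setT (EFin \o f).
Proof.
move=> [_ eta_oo] mf fC.
have wi : eta.-integrable setT (EFin \o levy_weight).
  apply/integrableP; split.
    by apply/measurable_EFinP; exact: measurable_levy_weight.
  apply: le_lt_trans eta_oo; rewrite [leRHS]integral_mkcond.
  rewrite le_eqVlt; apply/orP; left; apply/eqP; apply: eq_integral => x _ /=.
  rewrite ger0_norm ?levy_weight_ge0// patchE; case: ifPn => //.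
  rewrite notin_setE/= => /contrapT ->.
  by rewrite /levy_weight expr0n/= min_l.
apply: (le_integrable measurableT _ _ (integrableZl measurableT C wi)).
  exact/measurable_EFinP.
by move=> x _ /=; rewrite lee_fin (le_trans (fC x))// ler_norm.
Qed.

Lemma cos_levy_bound t x : `|cos (t * x) - 1| <= (2 + t ^+ 2) * levy_weight x.
Proof.
rewrite ler0_norm ?subr_le0 ?cos_le1// opprB /levy_weight.
have := cos_quad_le (t * x); have := cos_geN1 (t * x); rewrite exprMn.
have := sqr_ge0 t; have := sqr_ge0 x; have : 0 <= t ^+ 2 * x ^+ 2 by rewrite mulr_ge0 ?sqr_ge0.
by rewrite /Num.min; case: ifP => _; nra.
Qed.

(** On [-1, 1] the compensator differs from t x by t x^3 / (1 + x^2), and the sine from t x by a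
    cubic error; outside, every term is bounded. *)
Lemma sin_levy_bound t x : `|sin (t * x) - t * x / (1 + x ^+ 2)| <=
  (1 + `|t| + `|t| ^+ 3) * levy_weight x.
Proof.
have D0 : 0 < 1 + x ^+ 2 by rewrite ltr_pwDl// sqr_ge0.
have [x1|x1] := leP `|x| 1.
  have -> : levy_weight x = x ^+ 2.
    by rewrite /levy_weight min_l// -(real_normK (num_real x)) expr_le1.
  have -> : sin (t * x) - t * x / (1 + x ^+ 2) =
      (sin (t * x) - t * x) + t * (x * (x ^+ 2 / (1 + x ^+ 2))).
    by field; rewrite gt_eqF.
  have h1 : `|sin (t * x) - t * x| <= `|t| ^+ 3 * x ^+ 2.
    apply: (le_trans (sin_lin_bound _)); rewrite normrM exprMn ler_wpM2l ?exprn_ge0//.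
    exact: cube_le.
  have h2 : `|t * (x * (x ^+ 2 / (1 + x ^+ 2)))| <= `|t| * x ^+ 2.
    rewrite normrM ler_wpM2l// normrM [X in _ * X]ger0_norm; last first.
      by rewrite divr_ge0 ?sqr_ge0// ltW.
    apply: (@le_trans _ _ (1 * x ^+ 2)); last by rewrite mul1r.
    apply: ler_pM => //; first by rewrite divr_ge0 ?sqr_ge0// ltW.
    by rewrite ler_pdivrMr// ler_peMr ?sqr_ge0// lerDl sqr_ge0.
  apply: (le_trans (ler_normD _ _)); rewrite mulrDl mulrDl mul1r.
  by have := sqr_ge0 x; lra.
have x2 : 1 <= x ^+ 2 by rewrite -(real_normK (num_real x)) exprn_ege1// ltW.
have -> : levy_weight x = 1 by rewrite /levy_weight min_r.
rewrite mulr1; apply: (le_trans (ler_normB _ _)).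
have : `|t * x / (1 + x ^+ 2)| <= `|t|.
  rewrite -mulrA normrM ler_piMr// normrM [X in _ * X]ger0_norm ?invr_ge0 ?(ltW D0)//.
  rewrite ler_pdivrMr// mul1r -(real_normK (num_real x)).
  have := sqr_ge0 (`|x| - 1); nra.
have := sin_max (t * x); have : 0 <= `|t| ^+ 3 by rewrite exprn_ge0.
lra.
Qed.

Lemma measurable_cosM t : measurable_fun setT (fun x : R => cos (t * x)).
Proof. by apply: continuous_measurable_fun; exact: continuous_cosM. Qed.

Lemma measurable_sinM t : measurable_fun setT (fun x : R => sin (t * x)).
Proof. by apply: continuous_measurable_fun; exact: continuous_sinM. Qed.

Lemma oneDsqr_neq0 (x : R) : 1 + x ^+ 2 != 0.
Proof. by rewrite gt_eqF// ltr_pwDl// sqr_ge0. Qed.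

Lemma continuous_compensator t : continuous (fun x : R => t * x / (1 + x ^+ 2)).
Proof.
move=> x; apply: cvgM; first by apply: cvgM; [exact: cvg_cst|exact: cvg_id].
apply: cvgV; first exact: oneDsqr_neq0.
by apply: cvgD; [exact: cvg_cst|exact: exprn_continuous].
Qed.

Lemma integrable_cos_levy eta t : levy_measure eta ->
  eta.-integrable setT (EFin \o (fun x => cos (t * x) - 1)).
Proof.
move=> le; apply: (levy_integrable le _ (cos_levy_bound t)).
by apply: measurable_funB => //; exact: measurable_cosM.
Qed.

Lemma integrable_sin_levy eta t : levy_measure eta ->
  eta.-integrable setT (EFin \o (fun x => sin (t * x) - t * x / (1 + x ^+ 2))).
Proof.
move=> le; apply: (levy_integrable le _ (sin_levy_bound t)).
apply: measurable_funB; first exact: measurable_sinM.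
by apply: continuous_measurable_fun; exact: continuous_compensator.
Qed.

Lemma lk_Im0 gamma eta : lk_Im gamma eta 0 = 0.
Proof.
rewrite /lk_Im mulr0 add0r; under eq_Rintegral do rewrite !mul0r sin0 subr0.
by rewrite Rintegral_cst// mul0r.
Qed.

Lemma continuous_lk_Im gamma eta : levy_measure eta -> continuous (lk_Im gamma eta).
Proof.
move=> le t; apply: cvgD; first by apply: cvgM; [exact: cvg_cst|exact: cvg_id].
pose g (x : R) : R := (1 + (`|t| + 1) + (`|t| + 1) ^+ 3) * levy_weight x.
have gi : eta.-integrable setT (EFin \o g).
  apply: (levy_integrable le (C := (1 + (`|t| + 1) + (`|t| + 1) ^+ 3))).
    by apply: measurable_funM => //; exact: measurable_levy_weight.
  by move=> x; rewrite ger0_norm// mulr_ge0 ?levy_weight_ge0// !addr_ge0// exprn_ge0// addr_ge0.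
have := @continuity_under_integral R _ _ eta
  (fun s x => sin (s * x) - s * x / (1 + x ^+ 2)) setT measurableT (t - 1) (t + 1).
move=> /(_ (fun s _ => integrable_sin_levy s le)) /(_ _ g gi)/wrap[|H].
  apply: aeW => x _ s _; apply: cvgB.
    by under eq_fun do rewrite mulrC; rewrite mulrC; exact: continuous_sinM.
  by apply: cvgM; [apply: cvgM; [exact: cvg_id|exact: cvg_cst]|exact: cvg_cst].
apply: H; last by rewrite inE/= in_itv/=; apply/andP; split; lra.
move=> s /=; rewrite in_itv/= => /andP[s1 s2]; apply: aeW => x _.
apply: (le_trans (sin_levy_bound s x)); rewrite /g ler_wpM2r ?levy_weight_ge0//.
have st : `|s| <= `|t| + 1.
  rewrite -[s](subrK t) addrC (le_trans (ler_normD _ _))// lerD2l ler_norml.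
  by apply/andP; split; lra.
by rewrite lerD ?lerD2l// lerXn2r ?nnegrE// addr_ge0.
Qed.

Lemma cexp_eq (a b a' b' : R) : cexp (a +i* b) = cexp (a' +i* b') ->
  a = a' /\ cos (b - b') = 1.
Proof.
rewrite !cexpE => -[h1 h2].
have e : expR a = expR a'.
  have : expR a ^+ 2 = expR a' ^+ 2.
    rewrite -[LHS]mulr1 -(cos2Dsin2 b) mulrDr -!exprMn h1 h2 !exprMn -mulrDr.
    by rewrite cos2Dsin2 mulr1.
  by move/eqP; rewrite eqrXn2 ?expR_ge0// => /eqP.
split; first exact: expR_inj.
move: h1 h2; rewrite e => /mulfI -/(_ (lt0r_neq0 (expR_gt0 _))) h1.
move=> /mulfI -/(_ (lt0r_neq0 (expR_gt0 _))) h2.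
by rewrite cosB h1 h2 -!expr2 cos2Dsin2.
Qed.

(** The values of D lie in the multiples of 2 pi. If D t were not 0, the path s |-> D (s t) would
    attain, by intermediate values, the number [v] with 0 < |v| < 1, where the cosine is not 1. This
    removes the ambiguity of the complex logarithm. *)
Lemma continuous_cos_eq1 (D : R -> R) : continuous D -> D 0 = 0 ->
  (forall t, cos (D t) = 1) -> forall t, D t = 0.
Proof.
move=> cD D0 D1 t; apply/eqP; apply: contraT => Dt.
pose v := D t / (1 + `|D t|).
have d0 : 0 < 1 + `|D t| by rewrite ltr_pwDl.
have v1 : `|v| < 1.
  by rewrite normrM normfV [X in _ / X]gtr0_norm// ltr_pdivrMr// mul1r ltrDr.
have v0 : v != 0 by rewrite mulf_neq0// invr_neq0// gt_eqF.
have cE : continuous (fun s : R => D (s * t)).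
  move=> s; apply: (@continuous_comp _ _ _ (fun s : R => s * t) D); last exact: cD.
  by apply: cvgM; [exact: cvg_id|exact: cvg_cst].
have [|c _ cv] := @IVT R (fun s => D (s * t)) 0 1 v ler01 (continuous_subspaceT cE).
  rewrite mul0r mul1r D0 ge_min le_max /v.
  have [Dt0|Dt0] := leP 0 (D t).
    apply/andP; split; first by rewrite divr_ge0// ltW.
    by apply/orP; right; rewrite ler_pdivrMr// ler_peMr// lerDl.
  apply/andP; split.
    by apply/orP; right; rewrite ler_pdivlMr// ler_neMr ?(ltW Dt0)// lerDl.
  by apply/orP; left; rewrite pmulr_lle0 ?invr_gt0// ltW.
have := D1 (c * t); rewrite cv -cos_norm -cos0 => /cos_inj.
rewrite !in_itv/= pi_ge0 lexx normr_ge0/= => /(_ _ isT).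
have -> : `|v| <= pi by rewrite (le_trans (ltW v1))// (le_trans _ (pi_ge2 _))// ler1n.
by move=> /(_ isT)/normr0_eq0/eqP; rewrite (negbTE v0).
Qed.

Lemma lk_exponent_unique nu g1 s1 eta1 g2 s2 eta2 :
  levy_khintchine_triplet nu g1 s1 eta1 -> levy_khintchine_triplet nu g2 s2 eta2 ->
  (forall t, lk_Re s1 eta1 t = lk_Re s2 eta2 t) /\
  (forall t, lk_Im g1 eta1 t = lk_Im g2 eta2 t).
Proof.
move=> /levy_khintchine_tripletE[_ le1 c1] /levy_khintchine_tripletE[_ le2 c2].
have H t : lk_Re s1 eta1 t = lk_Re s2 eta2 t /\
    cos (lk_Im g1 eta1 t - lk_Im g2 eta2 t) = 1.
  by apply: cexp_eq; rewrite -c1 -c2.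
split => t; first by have [] := H t.
apply/eqP; rewrite -subr_eq0; apply/eqP.
apply: (@continuous_cos_eq1 (fun t => lk_Im g1 eta1 t - lk_Im g2 eta2 t)).
- by move=> u; apply: cvgB; exact: continuous_lk_Im.
- by rewrite !lk_Im0 subrr.
- by move=> u; have [] := H u.
Qed.

Section second_difference.
Variables (sigma2 : R) (eta : {measure set R -> \bar R}) (h : R).
Hypotheses (sigma2_ge0 : 0 <= sigma2) (eta_levy : levy_measure eta).

Lemma onemcos_ge0 x : 0 <= 1 - cos (h * x).
Proof. by rewrite subr_ge0 cos_le1. Qed.

Lemma measurable_onemcos : measurable_fun setT (fun x => 1 - cos (h * x)).
Proof. by apply: measurable_funB => //; exact: measurable_cosM. Qed.

Definition jump_measure := density_measure eta measurable_onemcos onemcos_ge0.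

Let sh0 (x : R) : 0 <= (cst (sigma2 * h ^+ 2 / 2) : R -> R) x.
Proof. by rewrite /cst divr_ge0// mulr_ge0// sqr_ge0. Qed.

Let msh : measurable_fun setT (cst (sigma2 * h ^+ 2 / 2) : R -> R).
Proof. exact: measurable_cst. Qed.

(** The measure (1 - cos (hx)) eta(dx) + (sigma2 h^2 / 2) delta_0. It is finite even when eta is
    not, and its Fourier transform is psi(t) - (psi(t + h) + psi(t - h)) / 2, with psi the exponent;
    hence psi determines it. *)
Definition second_diff_measure : {measure set R -> \bar R} :=
  measure_add jump_measure (density_measure (dirac (0 : R)) msh sh0).

Lemma integrable_jump (f : R -> R) : measurable_fun setT f -> (forall x, `|f x| <= 1) ->
  eta.-integrable setT (EFin \o (fun x => f x * (1 - cos (h * x)))).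
Proof.
move=> mf f1; apply: (levy_integrable eta_levy (C := 2 + h ^+ 2)).
  by apply: measurable_funM => //; exact: measurable_onemcos.
move=> x; rewrite normrM; apply: le_trans (cos_levy_bound h x).
by rewrite distrC ler_piMl.
Qed.

Lemma integrable_dirac0 (f : R -> R) : measurable_fun setT f ->
  (dirac (0 : R)).-integrable setT (EFin \o f).
Proof.
move=> mf; apply/integrableP; split; first exact/measurable_EFinP.
rewrite integral_dirac ?diracT ?mul1e ?ltry//.
by apply: measurableT_comp => //; exact/measurable_EFinP.
Qed.

Lemma jump_measureT : (jump_measure setT < +oo)%E.
Proof.
have c1 (x : R) : `|(cst 1 : R -> R) x| <= 1 by rewrite /cst normr1.
have /integrableP[_] := @integrable_jump (cst 1) (measurable_cst _) c1.
apply: le_lt_trans; rewrite -[leLHS]/(mdensity _ _ _) /mdensity le_eqVlt; apply/orP; left.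
by apply/eqP; apply: eq_integral => x _ /=; rewrite mul1r ger0_norm ?onemcos_ge0.
Qed.

Lemma second_diff_measureE A : measurable A ->
  second_diff_measure A = (jump_measure A + (sigma2 * h ^+ 2 / 2 * \1_A 0)%:E)%E.
Proof.
move=> mA; rewrite -[LHS]/(measure_add _ _ A) measure_addE; congr (_ + _)%E.
rewrite -[LHS]/(\int[\d_(0%R : R)]_(x in A) (cst (sigma2 * h ^+ 2 / 2)%:E) x)%E.
by rewrite integral_cst// diracE EFinM indicE.
Qed.

Lemma second_diff_measureT : (second_diff_measure setT < +oo)%E.
Proof. by rewrite second_diff_measureE// lte_add_pinfty ?jump_measureT ?ltry. Qed.

Lemma Rintegral_second_diff (f : R -> R) : measurable_fun setT f ->
  (forall x, `|f x| <= 1) ->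
  \int[second_diff_measure]_x f x =
  \int[eta]_x (f x * (1 - cos (h * x))) + sigma2 * h ^+ 2 / 2 * f 0.
Proof.
move=> mf f1.
have ji : jump_measure.-integrable setT (EFin \o f).
  by apply: integrable_mdensity => //; exact: integrable_jump.
have fc : measurable_fun setT (fun x => f x * cst (sigma2 * h ^+ 2 / 2) x).
  exact: measurable_funM.
have di : (density_measure (dirac (0 : R)) msh sh0).-integrable setT (EFin \o f).
  by apply: integrable_mdensity => //; exact: integrable_dirac0.
rewrite /Rintegral integral_measure_add// fineD; last 2 first.
- exact: integrable_fin_num.
- exact: integrable_fin_num.
congr (_ + _).
  by apply: Rintegral_mdensity => //; exact: integrable_jump.
have := Rintegral_mdensity msh sh0 mf (integrable_dirac0 fc).
rewrite /Rintegral => ->; rewrite integral_dirac//; last exact/measurable_EFinP.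
by rewrite diracT mul1e /= mulrC.
Qed.

Lemma Rintegral_second_diff_cos t : \int[second_diff_measure]_x cos (t * x) =
  lk_Re sigma2 eta t - (lk_Re sigma2 eta (t + h) + lk_Re sigma2 eta (t - h)) / 2.
Proof.
rewrite Rintegral_second_diff; [|exact: measurable_cosM|by move=> x; exact: cos_max].
rewrite mulr0 cos0 mulr1 /lk_Re.
have ci s := integrable_cos_levy s eta_levy.
have -> : \int[eta]_x (cos (t * x) * (1 - cos (h * x))) =
    \int[eta]_x (1 * (cos (t * x) - 1) +
      (- 2^-1 * (cos ((t + h) * x) - 1) + - 2^-1 * (cos ((t - h) * x) - 1))).
  apply: eq_Rintegral => x _.
  have -> : cos ((t + h) * x) = cos (t * x) * cos (h * x) - sin (t * x) * sin (h * x).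
    by rewrite mulrDl cosD.
  have -> : cos ((t - h) * x) = cos (t * x) * cos (h * x) + sin (t * x) * sin (h * x).
    by rewrite mulrBl cosB.
  by field.
have ciZ a s : eta.-integrable setT (EFin \o (fun x => a * (cos (s * x) - 1))).
  have := integrableZl measurableT a (ci s).
  by apply: eq_integrable => // x _; rewrite /= EFinM.
have -> : \int[eta]_x (1 * (cos (t * x) - 1) +
      (- 2^-1 * (cos ((t + h) * x) - 1) + - 2^-1 * (cos ((t - h) * x) - 1))) =
    \int[eta]_x (cos (t * x) - 1) + (- 2^-1 * \int[eta]_x (cos ((t + h) * x) - 1) +
      - 2^-1 * \int[eta]_x (cos ((t - h) * x) - 1)).
  rewrite [LHS]RintegralD//; last first.
    have := integrableD measurableT (ciZ (- 2^-1) (t + h)) (ciZ (- 2^-1) (t - h)).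
    exact: eq_integrable.
  congr (_ + _); first by apply: eq_Rintegral => x _; rewrite mul1r.
  by rewrite [LHS]RintegralD//; congr (_ + _); rewrite RintegralZl.
by field.
Qed.

(** The drift is linear in t and has zero second difference, so [gamma] cancels on the right. *)
Lemma Rintegral_second_diff_sin gamma t : \int[second_diff_measure]_x sin (t * x) =
  lk_Im gamma eta t - (lk_Im gamma eta (t + h) + lk_Im gamma eta (t - h)) / 2.
Proof.
rewrite Rintegral_second_diff; [|exact: measurable_sinM|by move=> x; exact: sin_max].
rewrite mulr0 sin0 mulr0 addr0 /lk_Im.
pose f (s x : R) := sin (s * x) - s * x / (1 + x ^+ 2).
have ci s : eta.-integrable setT (EFin \o f s) := integrable_sin_levy s eta_levy.
have -> : \int[eta]_x (sin (t * x) * (1 - cos (h * x))) =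
    \int[eta]_x (1 * f t x + (- 2^-1 * f (t + h) x + - 2^-1 * f (t - h) x)).
  apply: eq_Rintegral => x _; rewrite /f.
  have -> : sin ((t + h) * x) = sin (t * x) * cos (h * x) + cos (t * x) * sin (h * x).
    by rewrite mulrDl sinD.
  have -> : sin ((t - h) * x) = sin (t * x) * cos (h * x) - cos (t * x) * sin (h * x).
    by rewrite mulrBl sinB.
  by field; exact: oneDsqr_neq0.
have ciZ a s : eta.-integrable setT (EFin \o (fun x => a * f s x)).
  have := integrableZl measurableT a (ci s).
  by apply: eq_integrable => // x _; rewrite /= EFinM.
have -> : \int[eta]_x (1 * f t x + (- 2^-1 * f (t + h) x + - 2^-1 * f (t - h) x)) =
    \int[eta]_x f t x + (- 2^-1 * \int[eta]_x f (t + h) x +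
      - 2^-1 * \int[eta]_x f (t - h) x).
  rewrite [LHS]RintegralD//; last first.
    have := integrableD measurableT (ciZ (- 2^-1) (t + h)) (ciZ (- 2^-1) (t - h)).
    exact: eq_integrable.
  congr (_ + _); first by apply: eq_Rintegral => x _; rewrite mul1r.
  by rewrite [LHS]RintegralD//; congr (_ + _); rewrite RintegralZl.
by rewrite /f; field.
Qed.

End second_difference.

(** Fourier uniqueness identifies the second-difference measures for every step [h]. Their mass at 0
    gives the variance; dividing the rest by 1 - cos (hx) gives the Levy measure where this factor
    is positive. *)
Theorem levy_khintchine_unique nu g1 s1 eta1 g2 s2 eta2 :
  levy_khintchine_triplet nu g1 s1 eta1 -> levy_khintchine_triplet nu g2 s2 eta2 ->
  s1 = s2 /\ forall A, measurable A -> eta1 A = eta2 A.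
Proof.
move=> t1 t2; have [eRe eIm] := lk_exponent_unique t1 t2.
have [s10 le1 _] := t1; have [s20 le2 _] := t2.
have meq (h : R) (A : set R) : measurable A ->
    @second_diff_measure s1 eta1 h s10 A = @second_diff_measure s2 eta2 h s20 A.
  apply: fourier_unique; [exact: second_diff_measureT|exact: second_diff_measureT| |].
    by move=> t; rewrite !Rintegral_second_diff_cos// !eRe.
  by move=> t; rewrite (Rintegral_second_diff_sin _ _ _ g1)// (Rintegral_second_diff_sin _ _ _ g2)// !eIm.
have j0 (h : R) eta : levy_measure eta -> jump_measure eta h [set 0] = 0%E.
  move=> [eta0 _]; rewrite -[LHS]/(mdensity _ _ _) /mdensity.
  rewrite (eq_integral (cst 0%E)) ?integral0// => x; rewrite inE/= => ->.
  by rewrite mulr0 cos0 subrr.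
have s12 : s1 = s2.
  (* The jump part has no mass at 0, where only the Gaussian term remains. *)
  have := meq 1 [set 0] (measurable_set1 _).
  rewrite !second_diff_measureE//.
  rewrite !j0// !add0e !indicE !mem_set// => -[].
  by rewrite !mulr1 expr1n !mulr1 => /(congr1 (fun z => z * 2)); rewrite !divfK.
split=> //; subst s2.
have jeq (h : R) (A : set R) : measurable A ->
    jump_measure eta1 h A = jump_measure eta2 h A.
  move=> mA; have := meq h A mA; rewrite !second_diff_measureE//.
  by move=> /(congr1 (fun z => z - (s1 * h ^+ 2 / 2 * \1_A 0)%:E)%E); rewrite !addeK.
have bounded (n : nat) (A : set R) : measurable A -> A `<=` [set x | `|x| <= n.+1%:R] ->
    ~ A 0 -> eta1 A = eta2 A.
  (* On [A] one has |h x| <= 1, so cos (h x) = 1 would force x = 0, a point that [A] avoids. *)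
  move=> mA An A0; pose h : R := n.+1%:R^-1.
  have cosA x : A x -> 0 < 1 - cos (h * x).
    move=> Ax; rewrite lt0r onemcos_ge0 andbT subr_eq0; apply/eqP => c1.
    have hx : `|h * x| <= 1.
      by rewrite normrM ger0_norm ?invr_ge0// mulrC ler_pdivrMr// mul1r; exact: An.
    move: c1; rewrite -cos_norm -cos0 => /cos_inj.
    rewrite !in_itv/= pi_ge0 lexx normr_ge0/= => /(_ isT).
    have -> : `|h * x| <= pi by rewrite (le_trans hx)// (le_trans _ (pi_ge2 _))// ler1n.
    move=> /(_ isT)/esym/normr0_eq0/eqP; rewrite mulf_eq0 invr_eq0 pnatr_eq0/= => /eqP x0.
    by apply: A0; rewrite -x0.
  pose g x : \bar R := (\1_A x / (1 - cos (h * x)))%:E.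
  have mg : measurable_fun setT g.
    apply/measurable_EFinP; apply: measurable_funM => //.
    by apply: measurable_funV_ge0; [exact: measurable_onemcos|exact: onemcos_ge0].
  have g0 x : (0 <= g x)%E by rewrite lee_fin divr_ge0// onemcos_ge0.
  have E eta : eta A = (\int[jump_measure eta h]_x g x)%E.
    rewrite ge0_integral_mdensity// -[X in eta X]setIT -integral_indic//.
    apply: eq_integral => x _; rewrite -EFinM /g; congr EFin.
    have [Ax|Ax] := pselect (A x); last by rewrite indicE memNset// !mul0r.
    by rewrite divfK// gt_eqF// cosA.
  by rewrite !E; apply: eq_measure_integral => B mB _; exact: jeq.
move=> A mA.
pose B (n : nat) := (A `\ 0) `&` [set x | `|x| <= n.+1%:R].
have mB n : measurable (B n).
  apply: measurableI; first by apply: measurableD => //; exact: measurable_set1.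
  have -> : [set x : R | `|x| <= n.+1%:R] = `[- n.+1%:R, n.+1%:R]%classic.
    by apply/seteqP; split => x /=; rewrite in_itv/= ler_norml.
  exact: measurable_itv.
have BE : A `\ 0 = \bigcup_n B n.
  apply/seteqP; split => [x Ax|x [n _ []]//].
  exists (Num.bound `|x|) => //; split => //=; rewrite (le_trans (ltW (archi_boundP _)))//.
  by rewrite ler_nat.
have lim eta : levy_measure eta -> eta (B n) @[n --> \oo] --> eta A.
  move=> [eta0 _]; have -> : eta A = eta (A `\ 0).
    rewrite (measureDI eta mA (measurable_set1 0)) [X in (_ + X)%E](_ : _ = 0%E) ?adde0//.
    apply/eqP; rewrite -measure_le0 -eta0; apply: le_measure; rewrite ?inE//.
      by apply: measurableI => //; exact: measurable_set1.
  rewrite BE; apply: nondecreasing_cvg_mu => //; first exact: bigcup_measurable.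
  move=> i j ij; apply/subsetPset => x [Ax /= xi]; split => //=.
  by rewrite (le_trans xi)// ler_nat.
apply: (cvg_unique _ (lim _ le1)) => //.
rewrite (_ : (fun n => _) = (fun n => eta2 (B n))); first exact: lim.
apply/funext => n; apply: (bounded n) => //; first by move=> x [].
by move=> [[_ /=]].
Qed.

Lemma eq_Rintegral_nneg (m : {measure set R -> \bar R}) (f g : R -> R) :
  m `]-oo, 0[%classic = 0%E -> measurable_fun setT f -> measurable_fun setT g ->
  (forall x, 0 <= x -> f x = g x) -> \int[m]_x f x = \int[m]_x g x.
Proof.
move=> m0 mf mg fg; rewrite /Rintegral; congr fine.
apply: ae_eq_integral => //; [exact/measurable_EFinP|exact/measurable_EFinP|].
exists `]-oo, 0[%classic; split => // x /= /not_implyP[_].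
rewrite in_itv/=; apply: contra_notP => /negP; rewrite -leNgt => x0.
by rewrite fg.
Qed.

Section levy_existence.
Variables (m : {measure set R -> \bar R}) (s : R).
Hypotheses (mT : (m setT < +oo)%E) (m0 : m `]-oo, 0[%classic = 0%E).
Hypothesis s01 : s = 0 \/ s = 1.

(** With respect to [m], [s = 0] gives the density of eta_1 and [s = 1] that of eta_2. *)
Definition levy_density (x : R) : R :=
  \1_(`]0, +oo[%classic) x * (expR (s * x) / hell x).

Lemma levy_density_gt0 x : 0 < x -> levy_density x = expR (s * x) / hell x.
Proof.
by move=> x0; rewrite /levy_density indicE mem_set/= ?in_itv/= ?x0// mul1r.
Qed.

Lemma levy_density_le0 x : x <= 0 -> levy_density x = 0.
Proof.
move=> x0; rewrite /levy_density indicE memNset/= ?mul0r//.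
by rewrite in_itv/= andbT ltNge x0.
Qed.

Lemma levy_density_ge0 x : 0 <= levy_density x.
Proof. by rewrite /levy_density mulr_ge0// divr_ge0 ?expR_ge0// hell_ge0. Qed.

Lemma measurable_levy_density : measurable_fun setT levy_density.
Proof.
apply: measurable_funM => //; apply: measurable_funM.
  by apply: continuous_measurable_fun; exact: continuous_expRM.
apply: measurable_funV_ge0; last exact: hell_ge0.
by apply: continuous_measurable_fun; exact: continuous_hell.
Qed.

Definition levy_of := density_measure m measurable_levy_density levy_density_ge0.

Let s_itv : 0 <= s <= 1.
Proof. by case: s01 => ->; rewrite ?lexx ?ler01. Qed.

(** 64 is 16, from the lower bounds on [hell], times 4, a bound for e^x on [0, 1]. *)
Lemma levy_weight_density x : levy_weight x * levy_density x <= 64.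
Proof.
have [x0|x0] := leP x 0; first by rewrite levy_density_le0// mulr0.
rewrite levy_density_gt0// mulrA ler_pdivrMr ?hell_gt0 ?gt_eqF//.
have /andP[s0 s1] := s_itv.
have es : expR (s * x) <= expR x by rewrite ler_expR ler_piMl// ltW.
have [x1|x1] := leP x 1.
  have nx : `|x| <= 1 by rewrite gtr0_norm.
  have := hell_lb nx; have e4 : expR (s * x) <= 4.
    by apply: (le_trans es); have := ler_norm (expR x - 1); have := expR_cst_bound nx; lra.
  have : levy_weight x <= x ^+ 2 by rewrite /levy_weight ge_min lexx.
  have := levy_weight_ge0 x; have := expR_ge0 (s * x) => *.
  apply: (@le_trans _ _ (x ^+ 2 * 4)); last by lra.
  exact: ler_pM.
have := hell_lb_expR (ltW x1).
have : levy_weight x <= 1 by rewrite /levy_weight ge_min lexx orbT.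
have := levy_weight_ge0 x; have := expR_ge0 (s * x) => *.
apply: (@le_trans _ _ (1 * expR x)); first exact: ler_pM.
by have := expR_ge0 x; lra.
Qed.

Lemma levy_ofP : levy_measure levy_of.
Proof.
split.
  rewrite -[LHS]/(mdensity _ _ _) /mdensity (eq_integral (cst 0%E)) ?integral0// => x.
  by rewrite inE/= => ->; rewrite levy_density_le0.
have wd : m.-integrable setT (EFin \o (fun x => levy_weight x * levy_density x)).
  apply: (bounded_integrable (M := 64)) => //.
    apply: measurable_funM; first exact: measurable_levy_weight.
    exact: measurable_levy_density.
  move=> x; rewrite ger0_norm ?levy_weight_density//.
  by rewrite mulr_ge0// ?levy_density_ge0// levy_weight_ge0.
have /integrableP[_] := integrable_mdensity measurable_levy_density levy_density_ge0
  measurable_levy_weight wd.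
apply: le_lt_trans; rewrite [leLHS]integral_mkcond; apply: ge0_le_integral => //.
- by move=> x _; rewrite patchE; case: ifP => // _; rewrite lee_fin levy_weight_ge0.
- apply/(measurable_restrictT _ _).1.
    by apply: measurableC; exact: measurable_set1.
  by apply/measurable_funTS/measurable_EFinP; exact: measurable_levy_weight.
- by apply: measurableT_comp => //; apply/measurable_EFinP; exact: measurable_levy_weight.
- move=> x _; rewrite patchE; case: ifP => // _; rewrite /= lee_fin.
    exact: ler_norm.
  exact: normr_ge0.
Qed.

Lemma integrable_levy_of (f : R -> R) (C : R) : measurable_fun setT f ->
  (forall x, `|f x| <= C * levy_weight x) ->
  m.-integrable setT (EFin \o (fun x => f x * levy_density x)).
Proof.
move=> mf fC; have C0 : 0 <= C * levy_weight 1 by rewrite (le_trans _ (fC 1)).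
apply: (bounded_integrable (M := `|C| * 64)) => //.
  by apply: measurable_funM => //; exact: measurable_levy_density.
move=> x; rewrite normrM (ger0_norm (levy_density_ge0 x)).
apply: (@le_trans _ _ (`|C| * levy_weight x * levy_density x)).
  rewrite ler_wpM2r ?levy_density_ge0// (le_trans (fC x))//.
  by rewrite ler_wpM2r ?levy_weight_ge0// ler_norm.
by rewrite -mulrA ler_wpM2l// levy_weight_density.
Qed.

(** This is where [s] being 0 or 1 enters: on the two boundary lines the numerator of r_z becomes
    e^{su} (e^{itu} - 1) - i t (e^u - 1), a Levy-Khintchine integrand up to a drift. *)
Let expRs x : expR (s * x) - 1 = s * (expR x - 1).
Proof. by case: s01 => ->; rewrite ?mul0r ?expR0 ?subrr// !mul1r. Qed.

Let mfin A : measurable A -> m A \is a fin_num.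
Proof. by move=> mA; rewrite ge0_fin_numE// (le_lt_trans _ mT)// le_measure// inE. Qed.

(** At 0 the kernel is -2 t^2, which against the mass of [m] at 0 is the Gaussian term of variance 4
    m{0}; on (0, +oo) it is cos (tx) - 1 times the Levy density. *)
Lemma Rintegral_rRe t :
  \int[m]_x rRe s t x = lk_Re (4 * fine (m [set 0])) levy_of t.
Proof.
have ci := integrable_levy_of (measurable_funB (measurable_cosM t) (measurable_cst _))
  (cos_levy_bound t).
have mr : measurable_fun setT (rRe s t).
  by apply: continuous_measurable_fun; exact: continuous_rRe.
have m1 : measurable [set (0 : R)] := measurable_set1 0.
rewrite (@eq_Rintegral_nneg m _ (fun x => (cos (t * x) - 1) * levy_density x +
    - (2 * t ^+ 2) * \1_([set 0]) x))//; last 2 first.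
- apply: measurable_funD; last exact: measurable_funM.
  apply: measurable_funM; last exact: measurable_levy_density.
  by apply: measurable_funB => //; exact: measurable_cosM.
- move=> x; rewrite le_eqVlt => /predU1P[<-|x0].
    rewrite levy_density_le0// mulr0 add0r indicE mem_set// mulr1 /rRe eqxx.
    by case: s01 => ->; ring.
  rewrite levy_density_gt0// indicE memNset ?mulr0 ?addr0; last first.
    by move=> /= /eqP; rewrite gt_eqF.
  rewrite /rRe gt_eqF// mulrA; congr (_ / _).
  rewrite /pRe -expRs; ring.
have ii := integrableZl measurableT (- (2 * t ^+ 2)) (indic_integrable mT m1).
rewrite RintegralD//.
rewrite RintegralZl//; last exact: indic_integrable.
rewrite Rintegral_indic// /lk_Re addrC; congr (_ + _); first by field.
rewrite (Rintegral_mdensity measurable_levy_density levy_density_ge0)//.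
by apply: measurable_funB => //; exact: measurable_cosM.
Qed.

(** All that is left beside the compensated sine is linear in t and goes into the drift: the change
    of compensator, the value of the kernel at 0, and [c]. *)
Lemma Rintegral_rIm (c : R) : exists gamma, forall t,
  \int[m]_x rIm s t x - t * c = lk_Im gamma levy_of t.
Proof.
pose F t (x : R) := sin (t * x) - t * x / (1 + x ^+ 2).
have mF t : measurable_fun setT (F t).
  apply: measurable_funB; first exact: measurable_sinM.
  by apply: continuous_measurable_fun; exact: continuous_compensator.
have mFd t : measurable_fun setT (fun x => F t x * levy_density x).
  by apply: measurable_funM => //; exact: measurable_levy_density.
have Fi t := integrable_levy_of (mF t) (sin_levy_bound t).
have mr t : measurable_fun setT (rIm s t).
  by apply: continuous_measurable_fun; exact: continuous_rIm.
have m1 : measurable [set (0 : R)] := measurable_set1 0.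
(* On (0, +oo) the difference between the kernel and the compensated integrand is linear in t, so
   its coefficient is read off at t = 1. *)
pose ks x := \1_(`]0, +oo[%classic) x * (rIm s 1 x - F 1 x * levy_density x).
have mks : measurable_fun setT ks.
  by apply: measurable_funM => //; apply: measurable_funB.
have [C rC] := rIm_bounded (1 : R).
have ki : m.-integrable setT (EFin \o ks).
  have ri : m.-integrable setT (EFin \o rIm s 1).
    by apply: (bounded_integrable (M := C)) => // x; exact: rC.
  have := integrable_abse (integrableB measurableT ri (Fi 1)).
  apply: (le_integrable measurableT); first exact/measurable_EFinP.
  move=> x _ /=; rewrite lee_fin normr_id /ks normrM ler_piMl//.
  exact: normr_indic_le1.
exists (\int[m]_x ks x + 2 * (2 * s - 1) * fine (m [set 0]) - c) => t.
rewrite (@eq_Rintegral_nneg m _ (fun x => F t x * levy_density x + (t * ks x +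
    (2 * (2 * s * t - t)) * \1_([set 0]) x)))//; last 2 first.
- apply: measurable_funD => //; apply: measurable_funD; first exact: measurable_funM.
  exact: measurable_funM.
- move=> x; rewrite le_eqVlt => /predU1P[<-|x0].
    rewrite levy_density_le0// mulr0 add0r /ks indicE memNset/=; last first.
      by rewrite in_itv/= ltxx.
    by rewrite mul0r mulr0 add0r indicE mem_set// mulr1 /rIm eqxx.
  rewrite /ks !indicE [X in _ + (t * (X * _) + _)](_ : _ = 1); last first.
    by rewrite mem_set//= in_itv/= x0.
  rewrite [X in _ + (_ + _ * X)](_ : _ = 0) ?mulr0 ?addr0; last first.
    by rewrite memNset//= => /eqP; rewrite gt_eqF.
  rewrite levy_density_gt0// /rIm gt_eqF// /pIm /F; field.
  by rewrite oneDsqr_neq0 hell_neq0// gt_eqF.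
have ii := integrableZl measurableT (2 * (2 * s * t - t)) (indic_integrable mT m1).
have ki' := integrableZl measurableT t ki.
have ii' : m.-integrable setT (EFin \o (fun x => 2 * (2 * s * t - t) * \1_([set 0]) x)).
  by move: ii; apply: eq_integrable => // x _; rewrite /= EFinM.
have ki'' : m.-integrable setT (EFin \o (fun x => t * ks x)).
  by move: ki'; apply: eq_integrable => // x _; rewrite /= EFinM.
rewrite RintegralD//; last by have := integrableD measurableT ki'' ii'; exact: eq_integrable.
rewrite RintegralD// RintegralZl// RintegralZl//; last exact: indic_integrable.
rewrite Rintegral_indic// /lk_Im.
rewrite (Rintegral_mdensity measurable_levy_density levy_density_ge0 (mF t) (Fi t)).
by rewrite /F; ring.
Qed.

End levy_existence.

End levy_khintchine_real.

(** * A single coordinate *)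

Section mixture_density.
Context d (T : measurableType d) (R : realType) (P mu : probability T R).
Hypothesis muP : mu `<< P.

(** A real version of dmu/dP that is nonnegative everywhere, so that later inequalities hold
    pointwise. *)
Definition pdensity w : R := Num.max 0 (fine (density mu P w)).

Lemma pdensity_ge0 w : 0 <= pdensity w.
Proof. by rewrite /pdensity le_max lexx. Qed.

Lemma measurable_density : measurable_fun setT (density mu P).
Proof. exact: (measurable_int P (@Radon_Nikodym_integrable _ _ _ (charge_of_finite_measure mu) P muP)). Qed.

Lemma measurable_pdensity : measurable_fun setT pdensity.
Proof.
apply: measurable_maxr => //.
by apply: measurableT_comp => //; exact: measurable_density.
Qed.

Lemma ae_density_pdensity : {ae P, forall w, density mu P w = (pdensity w)%:E}.
Proof.
have := ae_eq_Radon_Nikodym_SigmaFinite muP measurableT.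
apply: filterS => w /(_ I) fE.
have d0 : (0 <= density mu P w)%E.
  by rewrite /density -fE; exact: Radon_Nikodym_SigmaFinite.f_ge0.
have dfin : density mu P w \is a fin_num by exact: Radon_Nikodym_fin_num.
by rewrite /pdensity max_r ?fineK// fine_ge0.
Qed.

Lemma integral_pdensity A : measurable A ->
  mu A = (\int[P]_(x in A) (pdensity x)%:E)%E.
Proof.
move=> mA; rewrite -[LHS]/(charge_of_finite_measure mu A).
rewrite (@Radon_Nikodym_integral _ _ _ (charge_of_finite_measure mu) P A muP mA); apply: ae_eq_integral => //.
- by apply: measurable_funTS; exact: measurable_density.
- by apply/measurable_EFinP; apply: measurable_funTS; exact: measurable_pdensity.
- by apply: filterS ae_density_pdensity => w + _.
Qed.

Lemma integrable_pdensity : P.-integrable setT (EFin \o pdensity).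
Proof.
apply/integrableP; split; first by apply/measurable_EFinP; exact: measurable_pdensity.
under eq_integral do rewrite /= ger0_norm ?pdensity_ge0//.
by rewrite -integral_pdensity// probability_setT ltry.
Qed.

Variable e : {i01 R}.
Local Notation eps := (e%:num : R).

Definition mdens w : R := 1 - eps + eps * pdensity w.

Lemma mdens_ge w : 1 - eps <= mdens w.
Proof. by rewrite lerDl mulr_ge0// pdensity_ge0. Qed.

Lemma mdens_ge0 w : 0 <= mdens w.
Proof. by rewrite (le_trans _ (mdens_ge w))// subr_ge0. Qed.

Lemma measurable_mdens : measurable_fun setT mdens.
Proof.
apply: measurable_funD => //; apply: measurable_funM => //; exact: measurable_pdensity.
Qed.

Lemma integrable_mdens : P.-integrable setT (EFin \o mdens).
Proof.
have h1 := finite_measure_integrable_cst P (1 - eps) measurableT.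
have h2 := integrableZl measurableT eps integrable_pdensity.
have := integrableD measurableT h1 h2; apply: eq_integrable => // w _.
Qed.

Lemma integral_mdens A : measurable A ->
  mixture e P mu A = (\int[P]_(x in A) (mdens x)%:E)%E.
Proof.
move=> mA; have h1 := finite_measure_integrable_cst P (1 - eps) mA.
have h2 := integrableZl mA eps (integrableS measurableT mA (subsetT _) integrable_pdensity).
have -> : (\int[P]_(x in A) (mdens x)%:E =
    \int[P]_(x in A) (((1 - eps)%:E) + (eps%:E * (pdensity x)%:E)))%E.
  by apply: eq_integral.
rewrite integralD// integral_cst// integralZl//; last first.
  exact: (integrableS measurableT mA (subsetT _) integrable_pdensity).
by rewrite -integral_pdensity.
Qed.

Lemma mixture_dominates : mixture e P mu `<< P.
Proof.
apply/null_content_dominatesP => A mA PA; rewrite integral_mdens//.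
by rewrite null_set_integral//; apply: measurable_funTS; apply/measurable_EFinP; exact: measurable_mdens.
Qed.

Lemma ae_density_mixture :
  {ae P, forall w, density (mixture e P mu) P w = (mdens w)%:E}.
Proof.
have : ae_eq P setT (density (mixture e P mu) P) (EFin \o mdens).
  apply: integral_ae_eq => //.
  - exact: (@Radon_Nikodym_integrable _ _ _
      (charge_of_finite_measure (mixture e P mu)) P mixture_dominates).
  - by apply/measurable_EFinP; exact: measurable_mdens.
  - move=> A _ mA; rewrite -[RHS]integral_mdens//.
    by rewrite -(@Radon_Nikodym_integral _ _ _
      (charge_of_finite_measure (mixture e P mu)) P A mixture_dominates mA).
by apply: filterS => w /(_ I).
Qed.

Lemma Rintegral_mdens : \int[P]_x mdens x = 1.
Proof. by rewrite /Rintegral -integral_mdens// probability_setT. Qed.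

Definition llr w : R := ln (mdens w).

Lemma measurable_llr : measurable_fun setT llr.
Proof. by apply: measurableT_comp => //; exact: measurable_mdens. Qed.

Lemma hell_llr_le w : hell (llr w) <= mdens w + 1.
Proof.
(* The density can vanish when eps = 1; then [ln 0 = 0] makes the log-likelihood ratio, and with it
   [hell], equal to 0. *)
have := mdens_ge0 w; rewrite le_eqVlt => /predU1P[f0|f0].
  by rewrite /llr -f0 ln0// hell0 add0r.
rewrite /hell; have -> : mdens w = expR (llr w / 2) ^+ 2.
  by rewrite -expRM_natl mulrC divfK// lnK.
by have := expR_ge0 (llr w / 2); nra.
Qed.

Lemma integrable_hell_llr : P.-integrable setT (EFin \o (fun w => hell (llr w))).
Proof.
have h1 := finite_measure_integrable_cst P 1 measurableT.
have := integrableD measurableT integrable_mdens h1; apply: le_integrable => //.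
  apply/measurable_EFinP; apply: measurableT_comp; last exact: measurable_llr.
  by apply: continuous_measurable_fun; exact: continuous_hell.
move=> w _ /=; rewrite lee_fin ger0_norm ?hell_ge0// (le_trans (hell_llr_le w))//.
exact: ler_norm.
Qed.

(** The quantity that the truncations in (a) and (b) refer to. *)
Definition signal w : R := eps * pdensity w.

Lemma signalE w : signal w = mdens w - 1 + eps.
Proof. by rewrite /signal /mdens; ring. Qed.

Lemma signal_ge0 w : 0 <= signal w.
Proof. by rewrite mulr_ge0// pdensity_ge0. Qed.

Lemma measurable_signal : measurable_fun setT signal.
Proof. by apply: measurable_funM => //; exact: measurable_pdensity. Qed.

Lemma measurable_signal_gt x : measurable [set w | x < signal w].
Proof.
rewrite -[X in measurable X]setTI; apply: measurable_fun_ltr => //.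
exact: measurable_signal.
Qed.

Lemma measurable_signal_le x : measurable [set w | signal w <= x].
Proof.
rewrite -[X in measurable X]setTI; apply: measurable_fun_ler => //.
exact: measurable_signal.
Qed.

Lemma integrable_signal_gt x :
  P.-integrable setT (EFin \o (fun w => \1_[set v | x < signal v] w * signal w)).
Proof.
have := integrableZl measurableT eps integrable_pdensity.
apply: le_integrable => //.
  apply/measurable_EFinP; apply: measurable_funM; last exact: measurable_signal.
  by apply: measurable_indic; exact: measurable_signal_gt.
by move=> w _; rewrite /= lee_fin normrM ler_piMl// normr_indic_le1.
Qed.

Lemma I1_coord x :
  (eps%:E * mu [set w | x%:E < eps%:E * density mu P w] =
   (\int[P]_w (\1_[set v | (x < signal v)%R] w * signal w))%:E)%E.
Proof.
have mA : measurable [set w | (x%:E < eps%:E * density mu P w)%E].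
  rewrite -[X in measurable X]setTI; apply: emeasurable_fun_lt => //.
  by apply: emeasurable_funM => //; exact: measurable_density.
rewrite fineK; last by apply: integral_fune_fin_num => //; exact: integrable_signal_gt.
rewrite integral_pdensity// -integralZl//; last first.
  exact: (integrableS measurableT mA (subsetT _) integrable_pdensity).
rewrite integral_mkcond; apply: ae_eq_integral => //.
- apply/(measurable_restrictT _ mA).1; apply: measurable_funTS.
  by apply: emeasurable_funM => //; apply/measurable_EFinP; exact: measurable_pdensity.
- exact: measurable_int (integrable_signal_gt x).
apply: filterS ae_density_pdensity => w dw _; rewrite patchE.
have -> : (w \in [set w | (x%:E < eps%:E * density mu P w)%E]) = (x < signal w).
  by rewrite -lte_fin /signal EFinM -dw; apply/idP/idP; rewrite inE.
rewrite indicE (_ : (w \in _) = (x < signal w)); last by apply/idP/idP; rewrite inE.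
by case: ifP => _; rewrite ?mul1r ?mul0r.
Qed.

Lemma signal_sqr_le x w : 0 <= x ->
  `|signal w ^+ 2 * \1_[set v | signal v <= x] w - eps ^+ 2| <= x ^+ 2 + eps ^+ 2.
Proof.
move=> x0; apply: (le_trans (ler_normB _ _)).
rewrite [X in _ + X]ger0_norm ?sqr_ge0// lerD2r ger0_norm ?mulr_ge0 ?sqr_ge0 ?signal_ge0 ?pdensity_ge0//.
rewrite indicE; have [sx|sx] := pselect (signal w <= x).
  by rewrite mem_set// mulr1 lerXn2r ?nnegrE// signal_ge0.
by rewrite memNset// mulr0 sqr_ge0.
Qed.

Lemma measurable_signal_sqr x : measurable_fun setT
  (fun w => signal w ^+ 2 * \1_[set v | signal v <= x] w - eps ^+ 2).
Proof.
apply: measurable_funB => //; apply: measurable_funM.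
  by apply: measurable_funX; exact: measurable_signal.
by apply: measurable_indic; exact: measurable_signal_le.
Qed.

Lemma I2_coord x : 0 <= x ->
  ((eps ^+ 2)%:E * \int[P]_w (density mu P w ^+ 2 *
      (\1_[set v | (eps%:E * density mu P v <= x%:E)%E] w)%:E - 1) =
   (\int[P]_w (signal w ^+ 2 * \1_[set v | (signal v <= x)%R] w - eps ^+ 2))%:E)%E.
Proof.
move=> x0; have PT : (P setT < +oo)%E by rewrite probability_setT ltry.
(* For eps = 0 the integral on the left may be infinite, and the left-hand side is 0 by the
   convention on 0 times +oo. *)
have [e0|e0] := eqVneq eps 0.
  rewrite e0 expr0n/= mul0e; under eq_Rintegral do rewrite /signal e0 mul0r expr0n/= mul0r subrr.
  by rewrite Rintegral_cst// mul0r.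
have e_gt0 : 0 < eps by rewrite lt0r e0/=.
have fi : P.-integrable setT (EFin \o (fun w =>
    signal w ^+ 2 * \1_[set v | signal v <= x] w - eps ^+ 2)).
  apply: (bounded_integrable (M := x ^+ 2 + eps ^+ 2)) => //.
    exact: measurable_signal_sqr.
  by move=> w; exact: signal_sqr_le.
rewrite fineK; last by apply: integral_fune_fin_num.
have /= gi := integrableZl measurableT (eps ^- 2) fi.
rewrite [X in (_ * X)%E](_ : _ = \int[P]_w ((eps ^- 2)%:E *
    (signal w ^+ 2 * \1_[set v | (signal v <= x)%R] w - eps ^+ 2)%:E))%E.
  by rewrite integralZl// muleA -EFinM divff ?mul1e// expf_neq0.
apply: ae_eq_integral => //.
- apply: emeasurable_funD => //; apply: emeasurable_funM.
    by apply: emeasurable_funM; exact: measurable_density.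
  apply/measurable_EFinP; apply: measurable_indic.
  rewrite -[X in measurable X]setTI; apply: emeasurable_fun_le => //.
  by apply: emeasurable_funM => //; exact: measurable_density.
- exact: measurable_int gi.
apply: filterS ae_density_pdensity => w dw _; rewrite dw.
rewrite !indicE (_ : (w \in _) = (signal w <= x)); last first.
  by rewrite -lee_fin /signal EFinM -dw; apply/idP/idP; rewrite inE.
rewrite (_ : (w \in _) = (signal w <= x)); last by apply/idP/idP; rewrite inE.
by rewrite -!EFinM -EFinD; congr EFin; rewrite /signal; field.
Qed.

End mixture_density.

(** * Continuous test functions for the jumps and for the variance *)

Section test_functions.
Context (R : realType).
Implicit Types a b u : R.

Definition ramp a b u := Num.max 0 (Num.min 1 ((u - a) / (b - a))).

Lemma ramp_ge0 a b u : 0 <= ramp a b u.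
Proof. by rewrite le_max lexx. Qed.

Lemma ramp_le1 a b u : ramp a b u <= 1.
Proof. by rewrite ge_max ler01 ge_min lexx. Qed.

Lemma normr_ramp_le1 a b u : `|ramp a b u| <= 1.
Proof. by rewrite ger0_norm ?ramp_ge0 ?ramp_le1. Qed.

Lemma ramp0 a b u : a < b -> u <= a -> ramp a b u = 0.
Proof.
move=> ab ua; apply/eqP; rewrite /ramp eq_le le_max lexx andbT ge_max lexx/=.
by rewrite ge_min; apply/orP; right; rewrite pmulr_lle0 ?invr_gt0 ?subr_gt0// subr_le0.
Qed.

Lemma ramp1 a b u : a < b -> b <= u -> ramp a b u = 1.
Proof.
move=> ab bu; rewrite /ramp min_l ?max_r//.
by rewrite ler_pdivlMr ?subr_gt0// mul1r lerD2r.
Qed.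

Lemma continuous_ramp a b : continuous (ramp a b).
Proof.
move=> u; apply: (@continuous_max R R (cst 0) (fun u => Num.min 1 ((u - a) / (b - a)))).
  exact: cvg_cst.
apply: (@continuous_min R R (cst 1) (fun u => (u - a) / (b - a))); first exact: cvg_cst.
by apply: cvgM; [apply: cvgB; [exact: cvg_id|exact: cvg_cst]|exact: cvg_cst].
Qed.

Lemma cvgy_ramp a b : a < b -> ramp a b u @[u --> +oo] --> (1 : R).
Proof.
move=> ab; apply: cvg_near_cst; near=> u; exact: ramp1.
Unshelve. all: by end_near.
Qed.

(** Times [hell] this is a smoothed (e^u - 1) 1_{u > a}, so its integral against kap_n imitates the
    sum [I1]. Being continuous with limit 1 at +oo, it passes to the limit and counts escaped mass
    with weight 1. *)
Definition jump_test a b u := ramp a b u * ((expR u - 1) / hell u).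

Lemma jump_testK a b u : 0 < a -> a < b ->
  jump_test a b u * hell u = ramp a b u * (expR u - 1).
Proof.
move=> a0 ab; rewrite /jump_test -mulrA; have [u0|u0] := leP u 0.
  by rewrite ramp0 ?mul0r// (le_trans u0)// ltW.
by rewrite divfK// hell_neq0// gt_eqF.
Qed.

Lemma jump_test_ge0 a b u : 0 < a -> a < b -> 0 <= jump_test a b u.
Proof.
move=> a0 ab; have [u0|u0] := leP u 0.
  by rewrite /jump_test ramp0 ?mul0r// (le_trans u0)// ltW.
rewrite mulr_ge0 ?ramp_ge0// divr_ge0 ?hell_ge0// subr_ge0 -expR0 ler_expR ltW//.
Qed.

Lemma jump_test0 a b u : 0 < a -> a < b -> u <= a -> jump_test a b u = 0.
Proof. by move=> a0 ab ua; rewrite /jump_test ramp0// mul0r. Qed.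

Lemma continuous_jump_test a b : 0 < a -> a < b -> continuous (jump_test a b).
Proof.
move=> a0 ab u; have [ua|ua] := ltP u a.
  have : jump_test a b x @[x --> u] --> (0 : R).
    apply: cvg_near_cst; near=> x; apply: jump_test0 => //; apply: ltW.
    by near: x; exact: lt_nbhsl.
  by rewrite -[X in _ --> X](@jump_test0 a b u)// ltW.
apply: cvgM; first exact: continuous_ramp.
apply: cvgM; first by apply: cvgB; [exact: continuous_expR|exact: cvg_cst].
apply: cvgV; last exact: continuous_hell.
by rewrite hell_neq0// gt_eqF// (lt_le_trans a0).
Unshelve. all: by end_near.
Qed.

(** (e^u - 1) / [hell u] = 1 + 2 / (e^{u/2} - 1) decreases on (0, +oo), so its value at [a] is a
    bound. *)
Lemma jump_test_bounded a b : 0 < a -> a < b ->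
  exists M : R, forall u, `|jump_test a b u| <= M.
Proof.
move=> a0 ab; have r0 : 0 < expR (a / 2) - 1.
  by rewrite subr_gt0 -expR0 ltr_expR divr_gt0.
exists (1 + 2 / (expR (a / 2) - 1)) => u.
have M0 : 0 <= 1 + 2 / (expR (a / 2) - 1) by rewrite addr_ge0// divr_ge0// ltW.
have [ua|ua] := leP u a; first by rewrite jump_test0// normr0.
rewrite /jump_test normrM -[leRHS]mul1r; apply: ler_pM => //.
  exact: normr_ramp_le1.
have ra : expR (a / 2) - 1 <= expR (u / 2) - 1.
  by rewrite lerD2r ler_expR; lra.
have r1 : 0 < expR (u / 2) - 1 by rewrite (lt_le_trans r0).
have -> : expR u = expR (u / 2) ^+ 2 by rewrite -expRM_natl; congr expR; lra.
have -> : (expR (u / 2) ^+ 2 - 1) / hell u = 1 + 2 / (expR (u / 2) - 1).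
  by rewrite /hell; field; rewrite gt_eqF.
rewrite ger0_norm ?addr_ge0 ?divr_ge0 ?(ltW r1)// lerD2l ler_wpM2l// lef_pV2//.
Qed.

Lemma cvgy_jump_test a b : a < b -> jump_test a b u @[u --> +oo] --> (1 : R).
Proof.
move=> ab; rewrite -[X in _ --> X]mulr1; apply: cvgM; first exact: cvgy_ramp.
by apply: (@cvgy_quotient_hell _ (fun u => expR u - 1)) => //; exact: cvgy_expRm1.
Qed.

(** Since (e^u - 1)^2 = (e^{u/2} + 1)^2 [hell u], its integral against kap_n is a smoothed [I2]. For
    0 < a < b its value 4 at 0 is the factor of m{0}, and its limit 0 at +oo ignores escaped
    mass. *)
Definition variance_test a b u := (1 - ramp a b u) * (expR (u / 2) + 1) ^+ 2.

Lemma variance_testK a b u :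
  variance_test a b u * hell u = (1 - ramp a b u) * (expR u - 1) ^+ 2.
Proof.
have -> : expR u = expR (u / 2) ^+ 2 by rewrite -expRM_natl; congr expR; lra.
by rewrite /variance_test /hell; ring.
Qed.

Lemma variance_test_ge0 a b u : 0 <= variance_test a b u.
Proof. by rewrite mulr_ge0 ?sqr_ge0// subr_ge0 ramp_le1. Qed.

Lemma variance_test_le a b u : a < b ->
  variance_test a b u <= (expR (b / 2) + 1) ^+ 2.
Proof.
move=> ab; have [ub|ub] := leP b u.
  by rewrite /variance_test ramp1// subrr mul0r sqr_ge0.
rewrite -[leRHS]mul1r ler_pM ?sqr_ge0 ?subr_ge0 ?ramp_le1//.
  by rewrite gerBl ramp_ge0.
rewrite lerXn2r ?nnegrE ?addr_ge0 ?expR_ge0// lerD2r ler_expR; lra.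
Qed.

Lemma continuous_variance_test a b : continuous (variance_test a b).
Proof.
move=> u; apply: cvgM; first by apply: cvgB; [exact: cvg_cst|exact: continuous_ramp].
apply: (@cvg_comp _ _ _ (fun u : R => expR (u / 2) + 1) (fun v => v ^+ 2) _
  (nbhs (expR (u / 2) + 1))); last exact: exprn_continuous.
apply: cvgD; last exact: cvg_cst.
by under eq_fun do rewrite mulrC; rewrite mulrC; exact: continuous_expRM.
Qed.

Lemma cvgy_variance_test a b : a < b -> variance_test a b u @[u --> +oo] --> (0 : R).
Proof.
move=> ab; apply: cvg_near_cst; near=> u.
by rewrite /variance_test ramp1 ?subrr ?mul0r.
Unshelve. all: by end_near.
Qed.

End test_functions.

Lemma Rintegral_prob_cst d (T : measurableType d) (R : realType)
  (P : probability T R) (c : R) : \int[P]_x c = c.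
Proof.
by rewrite Rintegral_cst//= [P _](@probability_setT _ _ _ P)/= mulr1.
Qed.

Lemma probability_setT_lty d (T : measurableType d) (R : realType)
  (P : probability T R) : (P setT < +oo)%E.
Proof. by rewrite [P _](@probability_setT _ _ _ P) ltry. Qed.

Lemma ler_norm_Rintegral d (T : measurableType d) (R : realType)
    (mu : {measure set T -> \bar R}) (f g : T -> R) :
  mu.-integrable setT (EFin \o f) -> mu.-integrable setT (EFin \o g) ->
  (forall x, `|f x| <= g x) -> `|\int[mu]_x f x| <= \int[mu]_x g x.
Proof.
move=> fi gi fg; apply: (le_trans (le_normr_Rintegral _ _)) => //.
apply: le_Rintegral => //.
by have := integrable_norm fi.
Qed.

(** * Moments and truncated moments of one log-likelihood ratio *)

Section coordinate.
Context d (T : measurableType d) (R : realType) (P mu : probability T R) (e : {i01 R}).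
Hypothesis muP : mu `<< P.
Local Notation eps := (e%:num : R).
Hypothesis e1 : eps < 1.
Local Notation u := (llr P mu e).
Local Notation g := (signal P mu e).

Lemma expR_llr w : expR (u w) = mdens P mu e w.
Proof. by rewrite /llr lnK// posrE (lt_le_trans _ (mdens_ge _ _ _ _))// subr_gt0. Qed.

Lemma signal_llr w : g w = expR (u w) - 1 + eps.
Proof. by rewrite signalE expR_llr. Qed.

Lemma llr_ge w : ln (1 - eps) <= u w.
Proof.
rewrite ler_ln ?posrE ?subr_gt0 ?mdens_ge//.
by rewrite (lt_le_trans _ (mdens_ge _ _ _ _))// subr_gt0.
Qed.

Lemma measurable_llr_comp (h : R -> R) : measurable_fun setT h ->
  measurable_fun setT (fun w => h (u w)).
Proof. by move=> mh; apply: measurableT_comp => //; exact: measurable_llr. Qed.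

Lemma integrable_llr (h : R -> R) (C : R) : measurable_fun setT h ->
  (forall x, `|h x| <= C * (expR x + 1)) ->
  P.-integrable setT (EFin \o (fun w => h (u w))).
Proof.
move=> mh hC; have h1 := finite_measure_integrable_cst P 1 measurableT.
have := integrableZl measurableT C (integrableD measurableT (integrable_mdens muP e) h1).
apply: le_integrable => //; first by apply/measurable_EFinP; exact: measurable_llr_comp.
move=> w _; rewrite [leRHS]/= lee_fin -expR_llr (le_trans (hC _))//.
exact: ler_norm.
Qed.

Lemma expR_scale_le s (x : R) : 0 <= s <= 1 -> expR (s * x) <= expR x + 1.
Proof.
move=> /andP[s0 s1]; have [x0|/ltW x0] := leP 0 x.
  by rewrite ler_wpDr// ler_expR ler_piMl.
by rewrite ler_wpDl ?expR_ge0// expR_le1 mulr_ge0_le0.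
Qed.

Lemma integrable_expR_llr s (c : R -> R) : 0 <= s <= 1 ->
  measurable_fun setT c -> (forall x, `|c x| <= 1) ->
  P.-integrable setT (EFin \o (fun w => expR (s * u w) * c (u w))).
Proof.
move=> s01 mc c1; apply: (@integrable_llr (fun x => expR (s * x) * c x) 1).
  apply: measurable_funM => //.
  by apply: continuous_measurable_fun; exact: continuous_expRM.
move=> x; rewrite mul1r normrM ger0_norm ?expR_ge0//.
apply: le_trans (expR_scale_le x s01).
by rewrite ler_piMr// expR_ge0.
Qed.

(** P and the mixture both have mass 1, so the centring term z (e^u - 1) of r_z integrates to 0. *)
Lemma Rintegral_expR_llr : \int[P]_w (expR (u w) - 1) = 0.
Proof.
under eq_Rintegral do rewrite expR_llr.
rewrite RintegralB//; first by rewrite Rintegral_mdens// Rintegral_prob_cst subrr.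
- exact: integrable_mdens.
- exact: finite_measure_integrable_cst.
Qed.

Lemma integrable_expRm1_llr :
  P.-integrable setT (EFin \o (fun w => expR (u w) - 1)).
Proof.
apply: (@integrable_llr (fun x => expR x - 1) 1).
  by apply: measurable_funB => //; exact: measurable_expR.
move=> x; rewrite mul1r (le_trans (ler_normB _ _))// normr1 ger0_norm// expR_ge0.
Qed.

Lemma Rintegral_expR_cos_llr s t : 0 <= s <= 1 ->
  \int[P]_w (expR (s * u w) * cos (t * u w)) = 1 + \int[P]_w pRe s t (u w).
Proof.
move=> s01; have i1 := integrable_expR_llr s01 (measurable_cosM t) (fun x => cos_max (t * x)).
have i2 := finite_measure_integrable_cst P 1 measurableT.
have i3 := integrableB measurableT i1 i2.
have i4 := integrableZl measurableT s integrable_expRm1_llr.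
rewrite /pRe RintegralB// RintegralB// RintegralZl//; last exact: integrable_expRm1_llr.
by rewrite Rintegral_expR_llr Rintegral_prob_cst; ring.
Qed.

Lemma Rintegral_expR_sin_llr s t : 0 <= s <= 1 ->
  \int[P]_w (expR (s * u w) * sin (t * u w)) = \int[P]_w pIm s t (u w).
Proof.
move=> s01; have i1 := integrable_expR_llr s01 (measurable_sinM t) (fun x => sin_max (t * x)).
have i4 := integrableZl measurableT t integrable_expRm1_llr.
rewrite /pIm RintegralB// RintegralZl//; last exact: integrable_expRm1_llr.
by rewrite Rintegral_expR_llr; ring.
Qed.

Definition hellinger := \int[P]_w hell (u w).

Lemma hellinger_ge0 : 0 <= hellinger.
Proof. by apply: Rintegral_ge0 => w _; exact: hell_ge0. Qed.

(** Pointwise [hell u] <= (e^u - 1) + 2 eps: with r = e^{u/2} this says r >= 1 - eps, which follows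
    from r^2 >= 1 - eps. *)
Lemma hellinger_le : hellinger <= 2 * eps.
Proof.
have e0 : 0 <= eps by [].
have i2 := finite_measure_integrable_cst P (2 * eps) measurableT.
have i3 := integrableD measurableT integrable_expRm1_llr i2.
rewrite /hellinger -[leRHS]add0r -Rintegral_expR_llr -[X in _ + X](Rintegral_prob_cst P).
rewrite -RintegralD//; last exact: integrable_expRm1_llr.
apply: le_Rintegral => //; first exact: integrable_hell_llr.
move=> w _; rewrite /hell.
have E : expR (u w) = expR (u w / 2) ^+ 2 by rewrite -expRM_natl; congr expR; lra.
have := mdens_ge P mu e w; rewrite -expR_llr E; have := expR_ge0 (u w / 2).
by move: e1; nra.
Qed.

Definition large_signal x := \int[P]_w (\1_[set v | x < g v] w * g w).

(** The summand of [I2] with f - 1 in place of [signal] and without the correction eps^2: apart from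
    the truncation it is a function of u, and so can be compared with an integral against kap_n. *)
Definition small_signal_var x := \int[P]_w ((expR (u w) - 1) ^+ 2 * \1_[set v | g v <= x] w).

Definition small_signal_sqr x :=
  \int[P]_w (g w ^+ 2 * \1_[set v | g v <= x] w - eps ^+ 2).

Lemma integrable_small_signal_var x : P.-integrable setT
  (EFin \o (fun w => (expR (u w) - 1) ^+ 2 * \1_[set v | g v <= x] w)).
Proof.
apply: (bounded_integrable (M := (`|x| + 1) ^+ 2)).
- exact: probability_setT_lty.
- apply: measurable_funM.
    apply: measurable_funX; apply: (@measurable_llr_comp (fun x => expR x - 1)).
    by apply: measurable_funB => //; exact: measurable_expR.
  by apply: measurable_indic; exact: measurable_signal_le.
move=> w; rewrite indicE; have [gx|gx] := pselect (g w <= x); last first.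
  by rewrite memNset// mulr0 normr0 sqr_ge0.
rewrite mem_set// mulr1 ger0_norm ?sqr_ge0// -[leLHS]real_normK ?num_real//.
rewrite lerXn2r ?nnegrE// ?addr_ge0//; move: gx; rewrite signal_llr => gx.
have := ler_norm x; have := normr_ge0 x; have := expR_ge0 (u w); have e0 : 0 <= eps by [].
by move=> *; rewrite ler_norml; apply/andP; split; move: e1; lra.
Qed.

Lemma integrable_small_signal_sqr x : 0 <= x -> P.-integrable setT
  (EFin \o (fun w => g w ^+ 2 * \1_[set v | g v <= x] w - eps ^+ 2)).
Proof.
move=> x0; apply: (bounded_integrable (M := x ^+ 2 + eps ^+ 2)).
- exact: probability_setT_lty.
- exact: measurable_signal_sqr.
- by move=> w; exact: signal_sqr_le.
Qed.

(** Here g = f - 1 + eps. After subtraction of 2 eps (f - 1), whose integral is 0, the integrands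
    coincide where g <= x; where g > x they differ by at most 2 eps g + eps, and 1 < g / x. *)
Lemma small_signal_sqr_var x : 0 < x ->
  `|small_signal_sqr x - small_signal_var x| <= eps * (2 + x^-1) * large_signal x.
Proof.
move=> x0; have e0 : 0 <= eps by [].
have i1 := integrable_small_signal_sqr (ltW x0).
have i2 := integrable_small_signal_var x.
have i3 := integrableB measurableT i1 i2.
have i4 := integrableZl measurableT (2 * eps) integrable_expRm1_llr.
have i5 := integrableB measurableT i3 i4.
have i6 := integrableZl measurableT (eps * (2 + x^-1)) (integrable_signal_gt muP e x).
rewrite /small_signal_sqr /small_signal_var /large_signal -RintegralB//.
rewrite -[X in `|X|]subr0 -[X in `|_ - X|](mulr0 (2 * eps)) -Rintegral_expR_llr.
rewrite -!RintegralZl//; [|exact: integrable_signal_gt|exact: integrable_expRm1_llr].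
rewrite -RintegralB//; apply: ler_norm_Rintegral => // w.
rewrite signal_llr !indicE; set f := expR (u w).
have gf : g w = f - 1 + eps by rewrite signal_llr.
have [gx|gx] := leP (g w) x.
  rewrite mem_set//= memNset/=; last by rewrite ltNge gx.
  rewrite mul0r mulr0 [X in `|X|](_ : _ = 0) ?normr0//; ring.
rewrite memNset/=; last by rewrite leNgt gx.
rewrite mem_set//=; have xg : 1 <= x^-1 * (f - 1 + eps).
  by rewrite mulrC ler_pdivlMr// mul1r -gf ltW.
have p1 : eps <= eps * (x^-1 * (f - 1 + eps)) by rewrite ler_peMr.
have g0 : 0 <= eps * (f - 1 + eps) by rewrite -gf mulr_ge0// (le_trans (ltW x0))// ltW.
have e2 : eps ^+ 2 <= eps by rewrite expr2 ler_piMl// ltW.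
have e3 := sqr_ge0 eps.
by rewrite ler_norml; apply/andP; split; lra.
Qed.

(** With r = e^{u/2}: (r - 1)^2 <= (r^2 - 1)^2 for all r >= 0, used for small signals; where the
    signal exceeds x >= eps one has r >= 1, and (r - 1)^2 <= r^2 - 1 is at most the signal. *)
Lemma hellinger_le_signal x : 0 < x -> eps <= x ->
  hellinger <= small_signal_var x + large_signal x.
Proof.
move=> x0 ex; have i2 := integrable_small_signal_var x.
have i3 := integrable_signal_gt muP e x.
have i4 := integrableD measurableT i2 i3.
rewrite /hellinger /small_signal_var /large_signal -RintegralD//.
apply: le_Rintegral => //; first exact: integrable_hell_llr.
move=> w _; rewrite !indicE.
have E : expR (u w) = expR (u w / 2) ^+ 2 by rewrite -expRM_natl; congr expR; lra.
have r0 := expR_ge0 (u w / 2).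
have gf := signal_llr w; rewrite /hell; have [gx|gx] := leP (g w) x.
  rewrite mem_set//= memNset/=; last by rewrite ltNge gx.
  rewrite mul0r addr0 mulr1 E; set r := expR (u w / 2) in r0 *.
  have : 0 <= (r - 1) ^+ 2 * (r ^+ 2 + 2 * r).
    by rewrite mulr_ge0 ?sqr_ge0// addr_ge0 ?sqr_ge0// mulr_ge0.
  lra.
rewrite memNset/=; last by rewrite leNgt gx.
rewrite mem_set//= mulr0 add0r mul1r gf.
have f1 : 1 <= expR (u w) by rewrite gf in gx; lra.
have e0 : 0 <= eps by [].
have r1 : 1 <= expR (u w / 2) by rewrite E in f1; nra.
by rewrite E; nra.
Qed.

Lemma integrable_llr_hell (h : R -> R) (M : R) : measurable_fun setT h ->
  (forall x, `|h x| <= M) ->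
  P.-integrable setT (EFin \o (fun w => h (u w) * hell (u w))).
Proof.
move=> mh hM; have i1 := integrableZl measurableT M (integrable_hell_llr muP e).
apply: le_integrable i1 => //.
  apply/measurable_EFinP; apply: (@measurable_llr_comp (fun x => h x * hell x)).
  by apply: measurable_funM => //; apply: continuous_measurable_fun; exact: continuous_hell.
move=> w _; rewrite /= lee_fin !normrM ler_wpM2r//.
by rewrite (le_trans (hM _))// ler_norm.
Qed.

Lemma large_signal_ge x b : 0 < x -> x < b ->
  \int[P]_w (jump_test x b (u w) * hell (u w)) <= large_signal (expR x - 1).
Proof.
move=> x0 xb; have [M hM] := jump_test_bounded x0 xb.
have mt : measurable_fun setT (jump_test x b).
  by apply: continuous_measurable_fun; exact: continuous_jump_test.
apply: le_Rintegral => //; first exact: (integrable_llr_hell mt hM).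
  exact: integrable_signal_gt.
move=> w _; rewrite jump_testK// indicE; have e0 : 0 <= eps by [].
have [ux|ux] := leP (u w) x.
  by rewrite ramp0// mul0r mulr_ge0// signal_ge0.
have fx : expR x < expR (u w) by rewrite ltr_expR.
rewrite mem_set/=; last by rewrite signal_llr; lra.
have := expR_gt1 x; rewrite x0 => f1.
apply: ler_pM; rewrite ?ramp_ge0 ?ramp_le1//; last by rewrite signal_llr; lra.
by rewrite subr_ge0 ltW// (lt_trans f1).
Qed.

(** The signal exceeds f - 1 by eps. Lowering the threshold from [x] to [x'] makes up for this in
    the truncation, and the factor 1 + delta in the integrand, since eps <= delta (f - 1) once f >
    e^{x'}. *)
Lemma large_signal_le a x' x delta : 0 < a -> a < x' -> x' < x -> 0 < delta ->
  eps <= expR x - expR x' -> eps <= delta * (expR x' - 1) ->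
  large_signal (expR x - 1) <=
  (1 + delta) * \int[P]_w (jump_test a x' (u w) * hell (u w)).
Proof.
move=> a0 ax' xx' d0 ex ed; have [M hM] := jump_test_bounded a0 ax'.
have mt : measurable_fun setT (jump_test a x').
  by apply: continuous_measurable_fun; exact: continuous_jump_test.
have i1 := integrable_llr_hell mt hM.
have i2 := integrableZl measurableT (1 + delta) i1.
rewrite -RintegralZl//; apply: le_Rintegral => //.
  exact: integrable_signal_gt.
move=> w _; rewrite indicE.
have [gx|gx] := leP (g w) (expR x - 1).
  rewrite memNset/=; last by rewrite ltNge gx.
  rewrite mul0r; apply: mulr_ge0; first by lra.
  by rewrite mulr_ge0 ?hell_ge0 ?jump_test_ge0.
rewrite mem_set//= mul1r jump_testK//.
rewrite signal_llr in gx *; have fx' : expR x' < expR (u w) by lra.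
rewrite ramp1//; last by rewrite ltr_expR in fx'; exact: ltW.
nra.
Qed.

Lemma small_signal_var_ge a b x : 0 < a -> a < b -> expR b - 1 + eps <= x ->
  \int[P]_w (variance_test a b (u w) * hell (u w)) <= small_signal_var x.
Proof.
move=> a0 ab bx.
have mt : measurable_fun setT (variance_test a b).
  by apply: continuous_measurable_fun; exact: continuous_variance_test.
have hM y : `|variance_test a b y| <= (expR (b / 2) + 1) ^+ 2.
  by rewrite ger0_norm ?variance_test_ge0 ?variance_test_le.
apply: le_Rintegral => //; first exact: (integrable_llr_hell mt hM).
  exact: integrable_small_signal_var.
move=> w _; rewrite variance_testK indicE mulrC.
have [ub|ub] := leP b (u w).
  by rewrite ramp1// subrr mulr0 mulr_ge0// sqr_ge0.
rewrite mem_set/=; last first.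
  rewrite signal_llr; move: ub; rewrite -ltr_expR; lra.
by rewrite ler_wpM2l ?sqr_ge0// gerBl ramp_ge0.
Qed.

Lemma small_signal_var_le a b x : a < b -> 1 + x <= expR a ->
  small_signal_var x <= \int[P]_w (variance_test a b (u w) * hell (u w)).
Proof.
move=> ab ax.
have mt : measurable_fun setT (variance_test a b).
  by apply: continuous_measurable_fun; exact: continuous_variance_test.
have hM y : `|variance_test a b y| <= (expR (b / 2) + 1) ^+ 2.
  by rewrite ger0_norm ?variance_test_ge0 ?variance_test_le.
apply: le_Rintegral => //; first exact: integrable_small_signal_var.
  exact: (integrable_llr_hell mt hM).
move=> w _; rewrite variance_testK indicE mulrC.
have [gx|gx] := pselect (g w <= x); last first.
  by rewrite memNset// mul0r mulr_ge0 ?sqr_ge0// subr_ge0 ramp_le1.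
rewrite mem_set// mul1r ramp0// ?subr0 ?mul1r//.
rewrite -ler_expR (le_trans _ ax)//; move: gx; rewrite signal_llr.
by have e0 : 0 <= eps by []; lra.
Qed.

End coordinate.

(** * Comparison of complex products and exponentials *)

Lemma norm_prodB_le (R : numDomainType) (I : Type) (s : seq I) (z w : I -> R) :
  (forall i, `|z i| <= 1) -> (forall i, `|w i| <= 1) ->
  `|\prod_(i <- s) z i - \prod_(i <- s) w i| <= \sum_(i <- s) `|z i - w i|.
Proof.
move=> z1 w1; have p1 (v : I -> R) r : (forall i, `|v i| <= 1) -> `|\prod_(i <- r) v i| <= 1.
  move=> v1; rewrite normr_prod.
  by apply: prodr_ile1 => i _; rewrite normr_ge0 v1.
elim: s => [|i s IH]; first by rewrite !big_nil subrr normr0.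
rewrite !big_cons.
set p := \prod_(j <- s) z j in IH *; set q := \prod_(j <- s) w j in IH *.
have -> : z i * p - w i * q = (z i - w i) * p + w i * (p - q) by ring.
apply: (le_trans (ler_normD _ _)); rewrite lerD// !normrM.
  by rewrite ler_piMr//; exact: p1.
by apply: le_trans IH; rewrite ler_piMl.
Qed.

Section complex_estimates.
Context (R : realType).
Local Open Scope complex_scope.
Implicit Types z w : R[i].

Lemma normc_le z : `|z| <= (`|complex.Re z| + `|complex.Im z|)%:C.
Proof.
rewrite normc_def lecR -[leRHS]ger0_norm ?addr_ge0// -sqrtr_sqr ler_wsqrtr//.
rewrite -(real_normK (num_real (complex.Re z))) -(real_normK (num_real (complex.Im z))).
by have := normr_ge0 (complex.Re z); have := normr_ge0 (complex.Im z); nra.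
Qed.

Lemma Re_le_normc z (c : R) : `|z| <= c%:C -> `|complex.Re z| <= c.
Proof. by move=> zc; rewrite -lecR (le_trans (normc_ge_Re z)). Qed.

Lemma Im_le_normc z (c : R) : `|z| <= c%:C -> `|complex.Im z| <= c.
Proof.
rewrite normc_def lecR => zc; apply: le_trans zc.
by rewrite -sqrtr_sqr ler_wsqrtr// lerDr sqr_ge0.
Qed.

Lemma normc_cexp z : complex.Re z <= 0 -> `|cexp z| <= 1.
Proof.
case: z => a b /= a0; rewrite cexpE normc_def /= -[leRHS]/(1%:C) lecR.
rewrite !exprMn -mulrDr cos2Dsin2 mulr1 sqrtr_sqr ger0_norm ?expR_ge0//.
by rewrite expR_le1.
Qed.

Lemma cexp_lin_bound (a b : R) : `|a| <= 1 -> `|b| <= 1 ->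
  `|1 + (a +i* b) - cexp (a +i* b)| <= (10 * (a ^+ 2 + b ^+ 2))%:C.
Proof.
move=> a1 b1; apply: (le_trans (normc_le _)); rewrite lecR cexpE /=.
have hq := expR_lin_bound a1; have ha := expR_cst_bound a1.
have hb : `|b| ^+ 3 <= b ^+ 2 by exact: cube_le.
have A4 : expR a <= 4 by have := ler_norm (expR a - 1); lra.
have hRe : `|1 + a - expR a * cos b| <= 2 * a ^+ 2 + 2 * b ^+ 2.
  have -> : 1 + a - expR a * cos b = - (expR a - 1 - a) + expR a * (1 - cos b) by ring.
  apply: (le_trans (ler_normD _ _)); rewrite normrN lerD//.
  rewrite [leLHS]ger0_norm; last by rewrite mulr_ge0 ?expR_ge0// subr_ge0 cos_le1.
  apply: (@le_trans _ _ (4 * (b ^+ 2 / 2))); last by lra.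
  by rewrite ler_pM ?expR_ge0 ?subr_ge0 ?cos_le1// cos_quad_le.
have hIm : `|0 + b - expR a * sin b| <= b ^+ 2 + 3 * (`|a| * `|b|).
  have -> : 0 + b - expR a * sin b = - (sin b - b) + - ((expR a - 1) * sin b) by ring.
  apply: (le_trans (ler_normD _ _)); rewrite !normrN lerD//.
    exact: (le_trans (sin_lin_bound _)).
  by rewrite normrM mulrA ler_pM// sin_norm_le.
have := real_normK (num_real a); have := real_normK (num_real b) => eb ea.
rewrite -?ea -?eb in hRe hIm *; nra.
Qed.

Lemma cexpD z w : cexp (z + w) = cexp z * cexp w.
Proof.
case: z w => [a b] [c d]; rewrite -[_ +i* _ + _]/((a + c) +i* (b + d)) !cexpE expRD cosD sinD.
by apply/eqP; rewrite eq_complex /=; apply/andP; split; apply/eqP; ring.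
Qed.

Lemma cexp0 : cexp (0 : R[i]) = 1.
Proof.
rewrite -[0 in LHS]/(0 +i* 0) cexpE expR0 cos0 sin0 !mul1r.
by apply/eqP; rewrite eq_complex /= !eqxx.
Qed.

Lemma cexp_sum (I : Type) (s : seq I) (z : I -> R[i]) :
  cexp (\sum_(i <- s) z i) = \prod_(i <- s) cexp (z i).
Proof.
elim: s => [|i s IH]; first by rewrite !big_nil cexp0.
by rewrite !big_cons cexpD IH.
Qed.

End complex_estimates.

Section sum_measure.
Context d (T : measurableType d) (R : realType) (k : nat)
  (m : 'I_k -> {measure set T -> \bar R}).

(** [msum] ranges over natural numbers, hence the partial inverse [insub], with the zero measure
    outside ['I_k]. *)
Definition sum_measure : {measure set T -> \bar R} :=
  msum (fun j => if insub j is Some i then m i else mzero) k.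

Lemma sum_measureE A : sum_measure A = (\sum_(i < k) m i A)%E.
Proof. by rewrite /sum_measure/= /msum; apply: eq_bigr => i _; rewrite valK. Qed.

Lemma ge0_integral_sum_measure (f : T -> \bar R) : measurable_fun setT f ->
  (forall x, 0 <= f x)%E ->
  (\int[sum_measure]_x f x = \sum_(i < k) \int[m i]_x f x)%E.
Proof.
move=> mf f0; rewrite /sum_measure ge0_integral_measure_sum//.
by apply: eq_bigr => i _; rewrite valK.
Qed.

Lemma Rintegral_sum_measure (f : T -> R) : measurable_fun setT f ->
  (forall i, (m i).-integrable setT (EFin \o f)) ->
  \int[sum_measure]_x f x = \sum_(i < k) \int[m i]_x f x.
Proof.
move=> mf fi; have mfE : measurable_fun setT (EFin \o f) by exact/measurable_EFinP.
rewrite /Rintegral [in LHS]integralE ge0_integral_sum_measure//; last exact: measurable_funepos.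
rewrite ge0_integral_sum_measure//; last exact: measurable_funeneg.
have pf i : (\int[m i]_x (EFin \o f)^\+ x)%E \is a fin_num.
  exact: integrable_pos_fin_num.
have nf i : (\int[m i]_x (EFin \o f)^\- x)%E \is a fin_num.
  exact: integrable_neg_fin_num.
rewrite fineB; [|exact/sum_fin_numP|exact/sum_fin_numP].
rewrite -!sum_fine// -sumrB; apply: eq_bigr => i _.
by rewrite -[LHS](fineB (pf i) (nf i)) -integralE.
Qed.

End sum_measure.

Section product_ae.
Context (R : realType) (k : nat) (d : 'I_k -> measure_display)
  (T : forall i, measurableType (d i)) (P : forall i, probability (T i) R).

Lemma ae_product (Q : forall i, T i -> Prop) :
  (forall i, {ae P i, forall x, Q i x}) ->
  {ae product_probability P, forall w : product_space T, forall i, Q i (w i)}.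
Proof.
move=> aeQ; apply: filter_forall => i; have [N [mN N0 QN]] := aeQ i.
(* The null set at coordinate [i] and everything at the others; dependent types require a transport
   along [j = i]. *)
pose A j : set (T j) := [set x | forall e : j = i, N (eq_rect j (fun j => T j) x i e)].
have AN : A i = N.
  apply/seteqP; split => [x /(_ erefl)//|x Nx e].
  by rewrite (eq_irrelevance e erefl).
have AT j : j != i -> A j = setT.
  by move=> ji; apply/seteqP; split => // x _ e; rewrite e eqxx in ji.
exists [set w : product_space T | N (w i)]; split.
- rewrite -[X in measurable X]setTI; exact: (@measurable_coord _ _ T i).
- rewrite (_ : [set w | _] = [set w : product_space T | forall j, A j (w j)]).
    rewrite product_probabilityE; last first.
      move=> j; have [->|ji] := eqVneq j i; first by rewrite AN.
      by rewrite AT.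
    by rewrite (bigD1 i)//= AN N0 mul0e.
  apply/seteqP; split => [w /= wN j|w /(_ i)]; last by rewrite AN.
  by have [->|ji] := eqVneq j i; [rewrite AN|rewrite AT].
- by move=> w /= Qw; apply: QN.
Qed.

End product_ae.

(** * Functions on R as test functions on [-oo, +oo] *)

Section extension.
Context (R : realType).

(** Value 0 at both infinite points: the extension is continuous once [h] vanishes at both ends, and
    its integral sees only the restriction of the law to R. *)
Definition ext (h : R -> R) (y : \bar R) : R := if y \is a fin_num then h (fine y) else 0.

Lemma measurable_ext h : measurable_fun setT h -> measurable_fun setT (ext h).
Proof.
move=> mh; rewrite (_ : ext h = fun y => \1_(range EFin) y * h (fine y)); last first.
  apply/funext => y; rewrite /ext indicE; case: ifPn => yfin.
    by rewrite mem_set ?mul1r//; exists (fine y) => //; rewrite fineK.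
  rewrite memNset ?mul0r// => -[x _ xy]; by rewrite -xy in yfin.
apply: measurable_funM.
  by apply: measurable_indic; apply: measurable_image_EFin; exact: measurableT.
by apply: measurableT_comp.
Qed.

Lemma continuous_ext h : continuous h -> h x @[x --> +oo] --> 0 ->
  h x @[x --> -oo] --> 0 -> continuous (ext h).
Proof.
move=> ch hy hNy [r| |].
- by move=> A Ar; apply: (nbhs_EFin (ext h @^-1` A) r).2; exact: (ch r A Ar).
- move=> A A0; have [M [Mr HM]] := hy A A0; exists M; split => // -[s| |] //=.
    by rewrite lte_fin => /HM.
  by move=> _; exact: (nbhs_singleton A0).
- move=> A A0; have [M [Mr HM]] := hNy A A0; exists M; split => // -[s| |] //=.
    by rewrite lte_fin => /HM.
  by move=> _; exact: (nbhs_singleton A0).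
Qed.

Lemma integral_ext (nu : {measure set (\bar R) -> \bar R}) (h : R -> R) (M : R) :
  (nu setT < +oo)%E -> measurable_fun setT h -> (forall x, `|h x| <= M) ->
  \int[nu]_y ext h y = \int[restr_R nu]_x h x.
Proof.
move=> nuT mh hM; have mE : measurable_fun setT (@EFin R) by [].
have mR : measurable (range (@EFin R)) by apply: measurable_image_EFin; exact: measurableT.
have onrange (m : {measure set (\bar R) -> \bar R}) :
    \int[m]_y ext h y = \int[m]_(y in range EFin) ext h y.
  rewrite [RHS]Rintegral_mkcond; apply: eq_Rintegral => y _; rewrite patchE.
  case: ifPn => //; rewrite notin_setE /ext; case: y => [r| |]//= rR.
  by exfalso; apply: rR; exists r.
transitivity (\int[image_measure (restr_R nu) mE]_y ext h y).
  rewrite !onrange /Rintegral; congr fine; apply: eq_measure_integral => A mA AR.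
  rewrite /image_measure/= /pushforward /restr_R; congr (nu _).
  apply/seteqP; split => [y Ay|_ [x Ax <-]//].
  by have [x _ xy] := AR _ Ay; exists x => //=; rewrite xy.
rewrite Rintegral_image//; first exact: measurable_ext.
apply: (bounded_integrable (M := M)) => //.
by apply: (le_lt_trans _ nuT); apply: le_measure; rewrite ?inE.
Qed.

End extension.

(** * A product experiment *)

Section experiment.
Context (R : realType) (k : nat) (d : 'I_k -> measure_display)
  (T : forall i, measurableType (d i)) (P mu : forall i, probability (T i) R)
  (eps : 'I_k -> {i01 R}).
Hypothesis muP : forall i, mu i `<< P i.
Local Notation u i := (llr (P i) (mu i) (eps i)).
Local Notation PP := (null_law P).
Local Notation QQ := (alt_law P mu eps).

Definition total_llr (w : product_space T) : R := \sum_(i < k) u i (w i).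

Lemma measurable_total_llr : measurable_fun setT total_llr.
Proof.
apply: measurable_sum => i.
by apply: (@measurable_coord_comp _ _ _ _ (fun i => u i)); exact: measurable_llr.
Qed.

Let measurable_hell_llr i : measurable_fun setT (fun w => hell (u i w)).
Proof.
apply: measurableT_comp; last exact: measurable_llr.
by apply: continuous_measurable_fun; exact: continuous_hell.
Qed.

(** The measure kap_n of a single experiment. *)
Definition hell_measure : {measure set R -> \bar R} :=
  sum_measure (fun i => image_measure
    (density_measure (P i) (@measurable_hell_llr i) (fun w => hell_ge0 (u i w)))
    (measurable_llr (@muP i) (eps i))).

Lemma integrable_hell_coord i (h : R -> R) (M : R) : measurable_fun setT h ->
  (forall x, `|h x| <= M) ->
  (P i).-integrable setT (EFin \o (fun w => h (u i w) * hell (u i w))).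
Proof.
move=> mh hM; have i1 := integrableZl measurableT M (integrable_hell_llr (@muP i) (eps i)).
apply: le_integrable i1 => //.
  apply/measurable_EFinP; apply: measurable_funM => //.
  by apply: measurableT_comp => //; exact: measurable_llr.
move=> w _; rewrite /= lee_fin !normrM ler_wpM2r//.
by rewrite (le_trans (hM _))// ler_norm.
Qed.

Lemma Rintegral_hell_measure (h : R -> R) (M : R) : measurable_fun setT h ->
  (forall x, `|h x| <= M) ->
  \int[hell_measure]_x h x = \sum_(i < k) \int[P i]_w (h (u i w) * hell (u i w)).
Proof.
move=> mh hM; have mhu i : measurable_fun setT (fun w => h (u i w)).
  by apply: measurableT_comp => //; exact: measurable_llr.
have di i : (density_measure (P i) (@measurable_hell_llr i)
    (fun w => hell_ge0 (u i w))).-integrable setT (EFin \o (h \o u i)).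
  by apply: integrable_mdensity => //; exact: integrable_hell_coord mh hM.
rewrite Rintegral_sum_measure//; last by move=> i; exact: integrable_image.
apply: eq_bigr => i _; rewrite Rintegral_image// Rintegral_mdensity//.
exact: integrable_hell_coord mh hM.
Qed.

Lemma hell_measure_fin : (hell_measure setT < +oo)%E.
Proof.
rewrite sum_measureE; apply/lte_sum_pinfty => i _.
have /integrableP[_] := integrable_hell_llr (@muP i) (eps i).
apply: le_lt_trans; rewrite -[leLHS]/(\int[P i]_(w in u i @^-1` setT) (hell (u i w))%:E)%E.
rewrite preimage_setT le_eqVlt; apply/orP; left; apply/eqP.
by apply: eq_integral => w _; rewrite /= ger0_norm ?hell_ge0.
Qed.

Lemma hell_measureT :
  fine (hell_measure setT) = \sum_(i < k) hellinger (P i) (mu i) (eps i).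
Proof.
have := @Rintegral_hell_measure (cst 1) 1 (measurable_cst _).
rewrite Rintegral_cst// mul1r => -> //; last by move=> x /=; rewrite normr1.
by apply: eq_bigr => i _; apply: eq_Rintegral => w _; rewrite /= mul1r.
Qed.

Hypothesis eps1 : forall i, (eps i)%:num < 1 :> R.

Lemma hell_measure_itv0 a : (forall i, a < ln (1 - (eps i)%:num)) ->
  hell_measure `]-oo, a]%classic = 0%E.
Proof.
move=> alt; rewrite sum_measureE big1// => i _.
rewrite -[LHS]/(\int[P i]_(w in u i @^-1` `]-oo, a]%classic) (hell (u i w))%:E)%E.
rewrite (_ : _ @^-1` _ = set0) ?integral_set0//.
apply/seteqP; split => // w /=; rewrite in_itv/= => ua.
by have := llr_ge (P i) (mu i) (eps1 i) w; rewrite leNgt (le_lt_trans ua (alt i)).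
Qed.

Lemma ae_loglik (Q : forall i, probability (T i) R) : (forall i, Q i `<< P i) ->
  {ae product_probability Q, forall w, loglik P mu eps w = (total_llr w)%:E}.
Proof.
move=> QP; have := @ae_product _ _ _ _ Q (fun i x =>
  density (mixture (eps i) (P i) (mu i)) (P i) x = (mdens (P i) (mu i) (eps i) x)%:E).
have aeQ i : {ae Q i, forall x,
    density (mixture (eps i) (P i) (mu i)) (P i) x = (mdens (P i) (mu i) (eps i) x)%:E}.
  have [A [mA A0 AN]] := ae_density_mixture (@muP i) (eps i).
  by exists A; split => //; apply: ((null_content_dominatesP _ _).1 (QP i)).
move=> /(_ aeQ); apply: filterS => w Hw; rewrite /loglik /total_llr -sumEFin.
apply: eq_bigr => i _; rewrite Hw lne_EFin//.
by rewrite (lt_le_trans _ (mdens_ge _ _ _ _))// subr_gt0 eps1.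
Qed.

Lemma measurable_loglik : measurable_fun setT (loglik P mu eps).
Proof.
apply: emeasurable_sum => i.
pose f := density (mixture (eps i) (P i) (mu i)) (P i).
have mf : measurable_fun setT f.
  exact: (measurable_int (P i) (@Radon_Nikodym_integrable _ _ _ (charge_of_finite_measure
    (mixture (eps i) (P i) (mu i))) (P i) (mixture_dominates (@muP i) (eps i)))).
apply: (measurableT_comp (f := fun x => lne (f x))); last exact: measurable_coord.
rewrite (_ : (fun x => _) = fun x => if fine (f x) <= 0 then -oo%E else (ln (fine (f x)))%:E).
  apply: measurable_fun_ifT => //.
    by apply: measurable_fun_ler => //; apply: measurableT_comp.
  by apply/measurable_EFinP; apply: measurableT_comp => //; apply: measurableT_comp.
apply/funext => x; have : f x \is a fin_num.
  exact: (@Radon_Nikodym_fin_num _ _ _ (charge_of_finite_measure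
    (mixture (eps i) (P i) (mu i))) (P i) x (mixture_dominates (@muP i) (eps i))).
by case: (f x) => //= r _.
Qed.

Lemma Rintegral_ext_loglik (Q : forall i, probability (T i) R) (h : R -> R) :
  (forall i, Q i `<< P i) -> measurable_fun setT h ->
  \int[product_probability Q]_w ext h (loglik P mu eps w) =
  \int[product_probability Q]_w h (total_llr w).
Proof.
move=> QP mh; rewrite /Rintegral; congr fine; apply: ae_eq_integral => //.
- apply/measurable_EFinP; apply: (measurableT_comp (measurable_ext mh)).
  exact: measurable_loglik.
- by apply/measurable_EFinP; apply: measurableT_comp => //; exact: measurable_total_llr.
- by apply: filterS (ae_loglik QP) => w -> _.
Qed.

Lemma integral_alt_law (g : R -> R) : measurable_fun setT g -> (forall x, 0 <= g x) ->
  (\int[QQ]_w (g (total_llr w))%:E =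
   \int[PP]_w (g (total_llr w) * expR (total_llr w))%:E)%E.
Proof.
move=> mg g0; rewrite (@product_probability_density _ _ _ _ P _ (fun i => mdens (P i) (mu i) (eps i))).
- apply: eq_integral => w _; rewrite -EFinM; congr (_ * _)%:E.
  by rewrite /total_llr expR_sum; apply: eq_bigr => i _; rewrite expR_llr.
- by move=> i; exact: measurable_mdens.
- by move=> i x; exact: mdens_ge0.
- by move=> i A mA; exact: integral_mdens.
- by apply/measurable_EFinP; apply: measurableT_comp => //; exact: measurable_total_llr.
- by move=> w; rewrite lee_fin.
Qed.

Lemma Rintegral_alt_law (h : R -> R) (M : R) : measurable_fun setT h ->
  (forall x, `|h x| <= M) ->
  PP.-integrable setT (EFin \o (fun w => h (total_llr w) * expR (total_llr w))) /\
  \int[QQ]_w h (total_llr w) = \int[PP]_w (h (total_llr w) * expR (total_llr w)).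
Proof.
move=> mh hM; have M0 : 0 <= M by rewrite (le_trans _ (hM 0)).
have mexp : measurable_fun setT (fun w => expR (total_llr w)).
  by apply: measurableT_comp => //; exact: measurable_total_llr.
have expi : PP.-integrable setT (EFin \o (fun w => expR (total_llr w))).
  apply/integrableP; split; first exact/measurable_EFinP.
  have c1 : (\int[QQ]_w (cst (1 : R) (total_llr w))%:E = 1)%E.
    rewrite -[LHS]/(\int[QQ]_w (cst 1%E) w)%E integral_cst// mul1e.
    exact: (@probability_setT _ _ _ QQ).
  have := @integral_alt_law (cst 1) (measurable_cst _) (fun _ => ler01).
  rewrite c1; under eq_integral do rewrite mul1r.
  by under [X in _ -> (X < _)%E]eq_integral do rewrite /= ger0_norm ?expR_ge0//; move=> <-; exact: ltry.
have ib (g : R -> R) (C : R) : measurable_fun setT g -> (forall x, `|g x| <= C) ->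
    PP.-integrable setT (EFin \o (fun w => g (total_llr w) * expR (total_llr w))).
  move=> mg gC; have := integrableZl measurableT C expi; apply: le_integrable => //.
    apply/measurable_EFinP; apply: measurable_funM => //.
    by apply: measurableT_comp => //; exact: measurable_total_llr.
  move=> w _; rewrite /= lee_fin !normrM ler_wpM2r//.
  by rewrite (le_trans (gC _))// ler_norm.
split; first exact: ib mh hM.
have ge0E (g : R -> R) : measurable_fun setT g -> (forall x, 0 <= g x) ->
    \int[QQ]_w g (total_llr w) = \int[PP]_w (g (total_llr w) * expR (total_llr w)).
  by move=> mg g0; rewrite /Rintegral integral_alt_law.
(* Adding [M] makes [h] nonnegative; the constant is then removed by the same identity for [M]. *)
have e1 := ge0E (fun x => h x + M).
have e2 := ge0E (cst M) (measurable_cst _) (fun _ => M0).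
have hi : QQ.-integrable setT (EFin \o (fun w => h (total_llr w))).
  apply: (bounded_integrable (M := M)) => //; first exact: probability_setT_lty.
  by apply: measurableT_comp => //; exact: measurable_total_llr.
have ci := finite_measure_integrable_cst QQ M measurableT.
have mhM : measurable_fun setT (fun x => h x + M) by exact: measurable_funD.
have hM0 x : 0 <= h x + M by have := hM x; rewrite ler_norml => /andP[]; lra.
have := e1 mhM hM0; rewrite RintegralD// [RHS](_ : _ =
    \int[PP]_w (h (total_llr w) * expR (total_llr w) + M * expR (total_llr w))); last first.
  by apply: eq_Rintegral => w _; rewrite mulrDl.
rewrite RintegralD//; [|exact: ib mh hM|]; last first.
  by apply: (@ib (cst M) M) => // x; rewrite /= ger0_norm.
by move=> E; apply: (@addIr _ (\int[QQ]_w M)); rewrite E e2.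
Qed.

Section characteristic_function.
Variables (s t : R).
Hypothesis s01 : 0 <= s <= 1.
Local Open Scope complex_scope.

Definition char_incr i : R[i] :=
  (\int[P i]_w pRe s t (u i w)) +i* (\int[P i]_w pIm s t (u i w)).

Lemma Rintegral_rRe_hell i :
  \int[P i]_w pRe s t (u i w) = \int[P i]_w (rRe s t (u i w) * hell (u i w)).
Proof. by apply: eq_Rintegral => w _; rewrite rReK. Qed.

Lemma Rintegral_rIm_hell i :
  \int[P i]_w pIm s t (u i w) = \int[P i]_w (rIm s t (u i w) * hell (u i w)).
Proof. by apply: eq_Rintegral => w _; rewrite rImK. Qed.

Let mrRe : measurable_fun setT (rRe s t).
Proof. by apply: continuous_measurable_fun; exact: continuous_rRe. Qed.

Let mrIm : measurable_fun setT (rIm s t).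
Proof. by apply: continuous_measurable_fun; exact: continuous_rIm. Qed.

Lemma sum_char_incr : \sum_(i < k) char_incr i =
  (\int[hell_measure]_x rRe s t x) +i* (\int[hell_measure]_x rIm s t x).
Proof.
have [C1 h1] := rRe_bounded t; have [C2 h2] := rIm_bounded t.
apply/eqP; rewrite eq_complex Re_sum Im_sum; apply/andP; split; apply/eqP.
  rewrite [RHS](Rintegral_hell_measure (M := C1))// => [|x]; last exact: h1.
  by apply: eq_bigr => i _; exact: Rintegral_rRe_hell.
rewrite [RHS](Rintegral_hell_measure (M := C2))// => [|x]; last exact: h2.
by apply: eq_bigr => i _; exact: Rintegral_rIm_hell.
Qed.

Lemma char_total_llr :
  (\int[PP]_w (expR (s * total_llr w) * cos (t * total_llr w))) +i*
  (\int[PP]_w (expR (s * total_llr w) * sin (t * total_llr w))) =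
  \prod_(i < k) (1 + char_incr i).
Proof.
pose h i x : R[i] := cexp ((s * u i x) +i* (t * u i x)).
have hi i : cintegrable (P i) (h i).
  split; rewrite /h; under [EFin \o _]eq_fun do rewrite cexpE.
    by apply: (integrable_expR_llr (@muP i) (eps1 i) s01 (measurable_cosM t)) => x; exact: cos_max.
  by apply: (integrable_expR_llr (@muP i) (eps1 i) s01 (measurable_sinM t)) => x; exact: sin_max.
have -> : \prod_(i < k) (1 + char_incr i) = \prod_(i < k) cexpectation (P i) (h i).
  apply: eq_bigr => i _; rewrite /cexpectation /h /char_incr.
  have -> : \int[P i]_x complex.Re (cexp ((s * u i x) +i* (t * u i x))) =
      1 + \int[P i]_w pRe s t (u i w).
    rewrite -(Rintegral_expR_cos_llr (@muP i) (eps1 i) t s01).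
    by apply: eq_Rintegral => x _; rewrite cexpE.
  have -> : \int[P i]_x complex.Im (cexp ((s * u i x) +i* (t * u i x))) =
      \int[P i]_w pIm s t (u i w).
    rewrite -(Rintegral_expR_sin_llr (@muP i) (eps1 i) t s01).
    by apply: eq_Rintegral => x _; rewrite cexpE.
  by apply/eqP; rewrite eq_complex /= add0r !eqxx.
rewrite -cexpectation_prod// /cexpectation.
have E w : \prod_(i < k) h i (w i) = cexp ((s * total_llr w) +i* (t * total_llr w)).
  rewrite /h -cexp_sum; congr cexp; rewrite /total_llr; apply/eqP.
  by rewrite eq_complex Re_sum Im_sum /= !mulr_sumr !eqxx.
apply/eqP; rewrite eq_complex; apply/andP; split; apply/eqP => /=.
  by apply: eq_Rintegral => w _; rewrite E cexpE.
by apply: eq_Rintegral => w _; rewrite E cexpE.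
Qed.

Lemma integral_expR_llr_le1 i : \int[P i]_w expR (s * u i w) <= 1.
Proof.
have := Rintegral_expR_cos_llr (@muP i) (eps1 i) 0 s01.
under eq_Rintegral do rewrite mul0r cos0 mulr1.
move=> ->; rewrite gerDl -[leRHS](mul0r (fine (P i setT))) -Rintegral_cst//.
have [C hC] := rRe_bounded (0 : R).
apply: le_Rintegral => //; last by move=> w _; exact: pRe_t0_le0.
- have := integrable_hell_coord i (M := C) (h := rRe s 0).
  under eq_fun do rewrite rReK.
  apply => [|x]; last exact: hC.
  by apply: continuous_measurable_fun; exact: continuous_rRe.
- exact: finite_measure_integrable_cst.
Qed.

(** 1 + [char_incr i] is E e^{zu} = a + i b. With r its modulus, r^2 = E e^{su} (a cos (tu) + b sin
    (tu)) <= r E e^{su}, and E e^{su} <= 1 by convexity. Factors of modulus at most 1 are what the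
    comparison of products requires. *)
Lemma norm_char_incr_le1 i : `|1 + char_incr i| <= 1.
Proof.
have i1 := integrable_expR_llr (@muP i) (eps1 i) s01 (measurable_cosM t) (fun x => cos_max (t * x)).
have i2 := integrable_expR_llr (@muP i) (eps1 i) s01 (measurable_sinM t) (fun x => sin_max (t * x)).
have i3 := integrable_expR_llr (@muP i) (eps1 i) s01 (@measurable_cst _ _ _ _ _ (1 : R)).
have i3' : (P i).-integrable setT (EFin \o (fun w => expR (s * u i w))).
  have := i3 (fun _ => _); under eq_fun do rewrite mulr1.
  by apply; rewrite /= normr1.
have := Rintegral_expR_cos_llr (@muP i) (eps1 i) t s01.
have := Rintegral_expR_sin_llr (@muP i) (eps1 i) t s01.
rewrite normc_def /char_incr /= add0r -[leRHS]/(1%:C) lecR.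
move=> <- <-; set a := \int[_]__ (_ * cos _); set b := \int[_]__ (_ * sin _).
set r := Num.sqrt _; have r0 : 0 <= r by exact: sqrtr_ge0.
have r2 : r ^+ 2 = a ^+ 2 + b ^+ 2 by rewrite sqr_sqrtr// addr_ge0// sqr_ge0.
have ia := integrableZl measurableT a i1; have ib := integrableZl measurableT b i2.
have ir := integrableZl measurableT r i3'.
have iab : (P i).-integrable setT (EFin \o (fun w =>
    a * (expR (s * u i w) * cos (t * u i w)) + b * (expR (s * u i w) * sin (t * u i w)))).
  by have := integrableD measurableT ia ib.
have : r ^+ 2 <= r * \int[P i]_w expR (s * u i w).
  rewrite r2 !expr2 -[X in X + _]RintegralZl// -[X in _ + X]RintegralZl// -RintegralD//.
  rewrite -RintegralZl//; apply: le_Rintegral => //.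
  move=> w _; set G := expR _; set c := cos _; set e := sin _.
  have G0 : 0 <= G by exact: expR_ge0.
  have ce : c ^+ 2 + e ^+ 2 = 1 by exact: cos2Dsin2.
  have H : a * c + b * e <= r.
    apply: (le_trans (ler_norm _)); rewrite -(ger0_norm r0) -ler_sqr ?nnegrE//.
    rewrite !real_normK ?num_real// r2 -[leRHS]mulr1 -ce.
    have := sqr_ge0 (a * e - b * c); lra.
  by have := ler_wpM2l G0 H; lra.
have := integral_expR_llr_le1 i => I1 rr.
have [->//|rn] := eqVneq r 0.
have r_gt0 : 0 < r by rewrite lt0r rn.
by apply: le_trans I1; rewrite -(ler_pM2l r_gt0) -expr2.
Qed.

Lemma Re_char_incr_le0 i : complex.Re (char_incr i) <= 0.
Proof.
have := Re_le_normc (c := 1) (norm_char_incr_le1 i).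
by move=> /(le_trans (ler_norm _)); rewrite /char_incr/=; lra.
Qed.

Variables (C eta : R).
Hypotheses (rReC : forall x, `|rRe s t x| <= C) (rImC : forall x, `|rIm s t x| <= C).
Hypotheses (eps_eta : forall i, (eps i)%:num <= eta) (eta_small : 2 * C * eta <= 1).

(** A factor 1 + x + i y differs from e^{x + i y} by at most 10 (x^2 + y^2), and |x|, |y| <= C H_i
    with H_i <= 2 eta the Hellinger term. Thus 40 is 10 times 2 (real and imaginary part) times 2
    (from H_i^2 <= 2 eta H_i). *)
Lemma char_total_llr_approx :
  let X := \int[hell_measure]_x rRe s t x in
  let Y := \int[hell_measure]_x rIm s t x in
  let e := 40 * C ^+ 2 * eta * fine (hell_measure setT) in
  `|\int[PP]_w (expR (s * total_llr w) * cos (t * total_llr w)) - expR X * cos Y| <= e /\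
  `|\int[PP]_w (expR (s * total_llr w) * sin (t * total_llr w)) - expR X * sin Y| <= e.
Proof.
move=> X Y e; suff H : `|\prod_(i < k) (1 + char_incr i) - cexp (X +i* Y)| <= e%:C.
  by split; [have := Re_le_normc H|have := Im_le_normc H];
    rewrite -char_total_llr cexpE /=.
rewrite -sum_char_incr cexp_sum.
apply: (le_trans (norm_prodB_le _ norm_char_incr_le1 (fun i => normc_cexp (Re_char_incr_le0 i)))).
have C0 : 0 <= C by rewrite (le_trans _ (rReC 0)).
have bound i (r : R -> R) : measurable_fun setT r -> (forall x, `|r x| <= C) ->
    `|\int[P i]_w (r (u i w) * hell (u i w))| <= C * hellinger (P i) (mu i) (eps i).
  move=> mr rC; rewrite /hellinger -RintegralZl//; last exact: integrable_hell_llr.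
  apply: ler_norm_Rintegral.
  - exact: integrable_hell_coord mr rC.
  - by have := integrableZl measurableT C (integrable_hell_llr (@muP i) (eps i)).
  - by move=> w; rewrite normrM ler_pM// ger0_norm// hell_ge0.
have hle i : hellinger (P i) (mu i) (eps i) <= 2 * eta.
  by rewrite (le_trans (hellinger_le (@muP i) (eps1 i)))// ler_wpM2l.
have -> : e = \sum_(i < k) 40 * C ^+ 2 * eta * hellinger (P i) (mu i) (eps i).
  by rewrite /e hell_measureT mulr_sumr.
rewrite (rmorph_sum (real_complex R)); apply: ler_sum => i _.
have hb1 := bound i _ mrRe rReC; have hb2 := bound i _ mrIm rImC.
rewrite -Rintegral_rRe_hell in hb1; rewrite -Rintegral_rIm_hell in hb2.
have h0 := hellinger_ge0 (P i) (mu i) (eps i).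
have C1 : C * hellinger (P i) (mu i) (eps i) <= 1.
  by apply: le_trans eta_small; rewrite [2 * C]mulrC -mulrA ler_wpM2l.
apply: (le_trans (cexp_lin_bound (le_trans hb1 C1) (le_trans hb2 C1))).
rewrite lecR; set x := \int[_]__ _ in hb1 *; set y := \int[_]__ _ in hb2 *.
set H := hellinger _ _ _ in hb1 hb2 h0 hle C1 *.
have x2 : x ^+ 2 <= (C * H) ^+ 2.
  by rewrite -(real_normK (num_real x)) lerXn2r ?nnegrE ?mulr_ge0.
have y2 : y ^+ 2 <= (C * H) ^+ 2.
  by rewrite -(real_normK (num_real y)) lerXn2r ?nnegrE ?mulr_ge0.
have : (C * H) ^+ 2 <= C ^+ 2 * (2 * eta) * H.
  by rewrite exprMn -mulrA ler_wpM2l ?sqr_ge0// expr2 ler_wpM2r// hle.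
lra.
Qed.

End characteristic_function.

(** At z = 1/2 the numerator of r_z is exactly - [hell u] / 2, so the affinity is the product of the
    1 - H_i / 2, and 1 - y <= e^{-y}. *)
Lemma half_moment_le :
  \int[PP]_w expR (2^-1 * total_llr w) <= expR (- (fine (hell_measure setT) / 2)).
Proof.
have s01 : 0 <= (2^-1 : R) <= 1.
  by apply/andP; split; lra.
have := @char_total_llr 2^-1 0 s01.
move=> /(congr1 (@complex.Re R))/=.
under eq_Rintegral do rewrite mul0r cos0 mulr1.
move=> ->; have E i : (1 + char_incr 2^-1 0 i)%R =
    ((1 - hellinger (P i) (mu i) (eps i) / 2)%:C)%C.
  rewrite /char_incr; apply/eqP; rewrite eq_complex /= add0r; apply/andP; split; apply/eqP.
    rewrite /hellinger mulrC -mulNr -RintegralZl//; last exact: integrable_hell_llr.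
    congr (_ + _); apply: eq_Rintegral => w _.
    rewrite /pRe /hell mul0r cos0 mulr1.
    have -> : expR (u i w) = expR (u i w / 2) ^+ 2.
      by rewrite -expRM_natl; congr expR; lra.
    by rewrite [2^-1 * u i w]mulrC; field.
  rewrite -[RHS](Rintegral_prob_cst (P i)).
  by apply: eq_Rintegral => w _; rewrite /pIm !mul0r sin0 mulr0 subr0.
under eq_bigr do rewrite E.
rewrite -(rmorph_prod (real_complex R))/= hell_measureT mulrC mulr_sumr -sumrN expR_sum.
apply: ler_prod => i _; rewrite subr_ge0.
have := hellinger_le (@muP i) (eps1 i); have := eps1 i => e1 h.
have := expR_ge1Dx (- (2^-1 * hellinger (P i) (mu i) (eps i))).
by move=> h'; apply/andP; split; move: e1 h h'; lra.
Qed.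

End experiment.

(** * The limit along an ultrafilter *)

Section limit_identification.
Context (R : realType).
Local Open Scope complex_scope.
Variables (rho1 rho2 m : {measure set R -> \bar R}) (c : R).
Hypotheses (rho1T : (rho1 setT < +oo)%E) (rho2T : (rho2 setT < +oo)%E)
  (mT : (m setT < +oo)%E).

(** The part of e^{sx} [tr x] that is integrated under P; the remaining part is e^x times it and is
    integrated under Q. For [s] in [0, 1] the weight e^{sx} / (1 + e^x) is bounded by 1. *)
Definition tilted s (tr : R -> R) x := expR (s * x) * tr x / (1 + expR x).

Lemma oneDexpR_gt0 (x : R) : 0 < 1 + expR x.
Proof. by rewrite ltr_pwDl// expR_ge0. Qed.

Lemma continuous_tilted s tr : continuous tr -> continuous (tilted s tr).
Proof.
move=> ctr x; apply: cvgM.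
  by apply: cvgM; [exact: continuous_expRM|exact: ctr].
apply: cvgV; first by rewrite gt_eqF// oneDexpR_gt0.
by apply: cvgD; [exact: cvg_cst|exact: continuous_expR].
Qed.

Lemma tilted_le s tr x : 0 <= s <= 1 -> (forall x, `|tr x| <= 1) -> `|tilted s tr x| <= 1.
Proof.
move=> s01 tr1; rewrite /tilted normrM normfV [X in _ / X]gtr0_norm ?oneDexpR_gt0//.
rewrite ler_pdivrMr ?oneDexpR_gt0// mul1r normrM ger0_norm ?expR_ge0//.
rewrite (@le_trans _ _ (expR (s * x)))// ?ler_piMr ?expR_ge0//.
by rewrite addrC expR_scale_le.
Qed.

Lemma integrable_tilted (rho : {measure set R -> \bar R}) s tr : (rho setT < +oo)%E ->
  0 <= s <= 1 -> continuous tr -> (forall x, `|tr x| <= 1) ->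
  rho.-integrable setT (EFin \o tilted s tr).
Proof.
move=> rT s01 ctr tr1; apply: (bounded_integrable (M := 1)) => //.
  by apply: continuous_measurable_fun; exact: continuous_tilted.
by move=> x; exact: tilted_le.
Qed.

Lemma integrable_bounded_cst (rho : {measure set R -> \bar R}) (M : R) : (rho setT < +oo)%E ->
  rho.-integrable setT (EFin \o cst M).
Proof. by move=> rT; apply: (bounded_integrable (M := `|M|)). Qed.

Lemma cvg_tilted (rho : {measure set R -> \bar R}) (s_ : nat -> R) s tr :
  (rho setT < +oo)%E -> (forall n, 0 <= s_ n <= 1) -> s_ n @[n --> \oo] --> s ->
  continuous tr -> (forall x, `|tr x| <= 1) ->
  \int[rho]_x tilted (s_ n) tr x @[n --> \oo] --> \int[rho]_x tilted s tr x.
Proof.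
move=> rT s01 ss ctr tr1.
apply: (@Rintegral_dct _ _ _ rho setT (fun n x => tilted (s_ n) tr x) _ (cst 1)) => //.
- by move=> n; apply: continuous_measurable_fun; exact: continuous_tilted.
- move=> x _; apply: cvgM; last exact: cvg_cst.
  apply: cvgM; last exact: cvg_cst.
  apply: (@cvg_comp _ _ _ s_ (fun v => expR (v * x)) _ (nbhs s)) => //.
  by under eq_fun do rewrite mulrC; rewrite mulrC; exact: continuous_expRM.
- exact: integrable_bounded_cst.
- by move=> n x _; exact: tilted_le.
Qed.

Lemma cvg_Rintegral_rRe (s_ : nat -> R) s t :
  (forall n, 0 <= s_ n <= 1) -> s_ n @[n --> \oo] --> s ->
  \int[m]_x rRe (s_ n) t x @[n --> \oo] --> \int[m]_x rRe s t x.
Proof.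
move=> s01 ss; have [C hC] := rRe_bounded t.
apply: (@Rintegral_dct _ _ _ m setT (fun n x => rRe (s_ n) t x) _ (cst C)) => //.
- by move=> n; apply: continuous_measurable_fun; exact: continuous_rRe.
- move=> x _; apply: (@cvg_comp _ _ _ s_ (fun v => rRe v t x) _ (nbhs s)) => //.
  exact: continuous_rRe_arg.
- exact: integrable_bounded_cst.
- by move=> n x _; exact: hC.
Qed.

Lemma cvg_Rintegral_rIm (s_ : nat -> R) s t :
  (forall n, 0 <= s_ n <= 1) -> s_ n @[n --> \oo] --> s ->
  \int[m]_x rIm (s_ n) t x @[n --> \oo] --> \int[m]_x rIm s t x.
Proof.
move=> s01 ss; have [C hC] := rIm_bounded t.
apply: (@Rintegral_dct _ _ _ m setT (fun n x => rIm (s_ n) t x) _ (cst C)) => //.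
- by move=> n; apply: continuous_measurable_fun; exact: continuous_rIm.
- move=> x _; apply: (@cvg_comp _ _ _ s_ (fun v => rIm v t x) _ (nbhs s)) => //.
  exact: continuous_rIm_arg.
- exact: integrable_bounded_cst.
- by move=> n x _; exact: hC.
Qed.

Let X s t := \int[m]_x rRe s t x - c * s.
Let Y s t := \int[m]_x rIm s t x - c * t.

Hypothesis interior_cos : forall s t, 0 < s < 1 ->
  \int[rho1]_x tilted s (fun x => cos (t * x)) x + \int[rho2]_x tilted s (fun x => cos (t * x)) x
  = expR (X s t) * cos (Y s t).
Hypothesis interior_sin : forall s t, 0 < s < 1 ->
  \int[rho1]_x tilted s (fun x => sin (t * x)) x + \int[rho2]_x tilted s (fun x => sin (t * x)) x
  = expR (X s t) * sin (Y s t).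
Hypothesis tilting : forall h : R -> R, continuous h -> (forall x, `|h x| <= 1) ->
  h x @[x --> +oo] --> 0 -> h x @[x --> -oo] --> 0 ->
  \int[rho1]_x tilted 1 h x = \int[rho2]_x tilted 0 h x.

(** Both sides are continuous in [s] on [0, 1] by dominated convergence, as the kernels are bounded
    uniformly in [s]. *)
Lemma closed_strip (tr : R -> R -> R) (F : R -> R) s t : 0 <= s <= 1 ->
  (forall t, continuous (tr t)) -> (forall t x, `|tr t x| <= 1) -> continuous F ->
  (forall s t, 0 < s < 1 -> \int[rho1]_x tilted s (tr t) x + \int[rho2]_x tilted s (tr t) x
    = expR (X s t) * F (Y s t)) ->
  \int[rho1]_x tilted s (tr t) x + \int[rho2]_x tilted s (tr t) x
    = expR (X s t) * F (Y s t).
Proof.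
move=> /andP[s0 s1] ctr tr1 cF H.
(* [s_ n] moves from [s] towards 1/2 by the fraction 1/(n+2) < 1 of the distance, so it lies
   strictly inside ]0, 1[. *)
pose r (n : nat) : R := n.+2%:R^-1; pose s_ n := s + r n * (2^-1 - s).
have r0 n : 0 < r n by rewrite invr_gt0.
have r1 n : r n < 1 by rewrite invf_lt1// ltr1n.
have s_01 n : 0 < s_ n < 1.
  by have := r0 n; have := r1 n; rewrite /s_ => *; apply/andP; split; nra.
have s_01' n : 0 <= s_ n <= 1 by have /andP[/ltW -> /ltW ->] := s_01 n.
have ss : s_ n @[n --> \oo] --> s.
  rewrite -[X in _ --> X]addr0 -[X in _ + X](mul0r (2^-1 - s)).
  apply: cvgD; first exact: cvg_cst.
  apply: cvgM; last exact: cvg_cst.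
  have := @cvg_harmonic R; rewrite -(cvg_shiftS); apply.
apply: (@cvg_unique _ _ ((fun n => \int[rho1]_x tilted (s_ n) (tr t) x +
    \int[rho2]_x tilted (s_ n) (tr t) x) @ \oo)).
- exact: norm_hausdorff.
- by apply: cvgD; apply: cvg_tilted.
- have -> : (fun n => \int[rho1]_x tilted (s_ n) (tr t) x +
      \int[rho2]_x tilted (s_ n) (tr t) x) = (fun n => expR (X (s_ n) t) * F (Y (s_ n) t)).
    by apply/funext => n; rewrite H.
  have cX : X (s_ n) t @[n --> \oo] --> X s t.
    apply: cvgB; first exact: cvg_Rintegral_rRe.
    by apply: cvgM => //; exact: cvg_cst.
  have cY : Y (s_ n) t @[n --> \oo] --> Y s t.
    apply: cvgB; last exact: cvg_cst; exact: cvg_Rintegral_rIm.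
  apply: cvgM.
    by apply: (cvg_comp _ _ cX); exact: continuous_expR.
  by apply: (cvg_comp _ _ cY); exact: cF.
Qed.

(** Cutoffs [b n] rising to 1 extend the tilting identity from functions vanishing at both ends to
    bounded ones. *)
Lemma tilting_trig (tr : R -> R) : continuous tr -> (forall x, `|tr x| <= 1) ->
  \int[rho1]_x tilted 1 tr x = \int[rho2]_x tilted 0 tr x.
Proof.
move=> ctr tr1; pose b (n : nat) (x : R) := 1 - ramp n%:R n.+1%:R `|x|.
have nn1 (n : nat) : n%:R < n.+1%:R :> R by rewrite ltr_nat.
have b1 n x : `|b n x| <= 1.
  rewrite ger0_norm ?subr_ge0 ?ramp_le1//; by rewrite gerBl ramp_ge0.
have cb n : continuous (b n).
  move=> x; apply: cvgB; first exact: cvg_cst.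
  apply: (@cvg_comp _ _ _ (fun x : R => `|x|) (ramp n%:R n.+1%:R) _ (nbhs `|x|)).
    exact: norm_continuous.
  exact: continuous_ramp.
pose h n x := tr x * b n x.
have ch n : continuous (h n) by move=> x; apply: cvgM; [exact: ctr|exact: cb].
have h1 n x : `|h n x| <= 1.
  by rewrite normrM -[leRHS]mulr1 ler_pM.
have hy n : h n x @[x --> +oo] --> 0.
  apply: cvg_near_cst; near=> x; rewrite /h /b ramp1 ?subrr ?mulr0//.
  by rewrite ler_normr; apply/orP; left.
have hNy n : h n x @[x --> -oo] --> 0.
  apply: cvg_near_cst; near=> x; rewrite /h /b ramp1 ?subrr ?mulr0//.
  by rewrite ler_normr; apply/orP; right; rewrite lerNr.
have lim (rho : {measure set R -> \bar R}) s : (rho setT < +oo)%E -> 0 <= s <= 1 ->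
    \int[rho]_x tilted s (h n) x @[n --> \oo] --> \int[rho]_x tilted s tr x.
  move=> rT s01.
  apply: (@Rintegral_dct _ _ _ rho setT (fun n x => tilted s (h n) x) _ (cst 1)) => //.
  - by move=> n; apply: continuous_measurable_fun; exact: continuous_tilted.
  - move=> x _; apply: cvg_near_cst; near=> n.
    rewrite /tilted /h /b ramp0 ?subr0 ?mulr1//.
    by near: n; exact: nbhs_infty_ger.
  - exact: integrable_bounded_cst.
  - by move=> n x _; exact: tilted_le.
apply: (@cvg_unique _ _ ((fun n => \int[rho1]_x tilted 1 (h n) x) @ \oo)).
- exact: norm_hausdorff.
- by apply: lim; rewrite ?lexx ?ler01.
- have -> : (fun n => \int[rho1]_x tilted 1 (h n) x) =
      (fun n => \int[rho2]_x tilted 0 (h n) x) by apply/funext => n; rewrite tilting.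
  by apply: lim; rewrite ?lexx ?ler01.
Unshelve. all: by end_near.
Qed.

Lemma untilt (rho : {measure set R -> \bar R}) (tr : R -> R) : (rho setT < +oo)%E ->
  continuous tr -> (forall x, `|tr x| <= 1) ->
  \int[rho]_x tilted 0 tr x + \int[rho]_x tilted 1 tr x = \int[rho]_x tr x.
Proof.
move=> rT ctr tr1; rewrite -RintegralD//; last 2 first.
- by apply: integrable_tilted => //; rewrite lexx ler01.
- by apply: integrable_tilted => //; rewrite lexx ler01.
apply: eq_Rintegral => x _; rewrite /tilted mul0r expR0 !mul1r; field.
by rewrite gt_eqF// oneDexpR_gt0.
Qed.

(** At s = 0 tilting turns the [rho2] integral into the part with weight e^x / (1 + e^x) of the
    [rho1] integral, which completes the characteristic function of [rho1]. At s = 1 the two roles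
    are exchanged. *)
Lemma char_rho1 t : char_fun rho1 t =
  cexp ((\int[m]_x rRe 0 t x) +i* (\int[m]_x rIm 0 t x - t * c)).
Proof.
have s01 : 0 <= (0 : R) <= 1 by rewrite lexx ler01.
have H1 := closed_strip t s01 (fun t => @continuous_cosM R t) (fun t x => cos_max (t * x))
  (@continuous_cos R) interior_cos.
have H2 := closed_strip t s01 (fun t => @continuous_sinM R t) (fun t x => sin_max (t * x))
  (@continuous_sin R) interior_sin.
rewrite -tilting_trig in H1; [|exact: continuous_cosM|by move=> x; exact: cos_max].
rewrite -tilting_trig in H2; [|exact: continuous_sinM|by move=> x; exact: sin_max].
rewrite untilt// in H1; [|exact: continuous_cosM|by move=> x; exact: cos_max].
rewrite untilt// in H2; [|exact: continuous_sinM|by move=> x; exact: sin_max].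
by rewrite char_funE cexpE H1 H2 /X /Y mulr0 subr0 [c * t]mulrC.
Qed.

Lemma char_rho2 t : char_fun rho2 t =
  cexp ((\int[m]_x rRe 1 t x - c) +i* (\int[m]_x rIm 1 t x - t * c)).
Proof.
have s01 : 0 <= (1 : R) <= 1 by rewrite lexx ler01.
have H1 := closed_strip t s01 (fun t => @continuous_cosM R t) (fun t x => cos_max (t * x))
  (@continuous_cos R) interior_cos.
have H2 := closed_strip t s01 (fun t => @continuous_sinM R t) (fun t x => sin_max (t * x))
  (@continuous_sin R) interior_sin.
rewrite tilting_trig in H1; [|exact: continuous_cosM|by move=> x; exact: cos_max].
rewrite tilting_trig in H2; [|exact: continuous_sinM|by move=> x; exact: sin_max].
rewrite untilt// in H1; [|exact: continuous_cosM|by move=> x; exact: cos_max].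
rewrite untilt// in H2; [|exact: continuous_sinM|by move=> x; exact: sin_max].
by rewrite char_funE cexpE H1 H2 /X /Y mulr1 [c * t]mulrC.
Qed.

End limit_identification.

(** * Passage to the limit in the sequence of experiments *)

Section sparse_model.
Context (R : realType) (k : nat -> nat) (d : forall n, 'I_(k n) -> measure_display)
  (T : forall n (i : 'I_(k n)), measurableType (@d n i))
  (P mu : forall n (i : 'I_(k n)), probability (@T n i) R)
  (eps : forall n, 'I_(k n) -> {i01 R}).
Variables (nu1 nu2 : probability (\bar R) R).
Hypothesis muP : forall n i, @mu n i `<< @P n i.
Hypothesis eps0 :
  \big[Num.max/0]_(i < k n) (@eps n i)%:num @[n --> \oo] --> (0 : R).
Hypothesis cvg1 : cvg_in_distribution (fun n => null_law (@P n))
  (fun n => loglik (@P n) (@mu n) (@eps n)) nu1.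
Hypothesis cvg2 : cvg_in_distribution (fun n => alt_law (@P n) (@mu n) (@eps n))
  (fun n => loglik (@P n) (@mu n) (@eps n)) nu2.

Local Notation rho1 := (restr_R nu1).
Local Notation rho2 := (restr_R nu2).
Local Notation PP n := (null_law (@P n)).
Local Notation TT n := (total_llr (@P n) (@mu n) (@eps n)).
Local Notation kap n := (hell_measure (@eps n) (@muP n)).

Lemma near_eps_le delta : 0 < delta ->
  \forall n \near \oo, forall i, (@eps n i)%:num <= delta.
Proof.
move=> d0; have /cvgr0Pnorm_le/(_ delta d0) := eps0; apply: filterS => n + i.
apply: le_trans; apply: le_trans (ler_norm _).
exact: (@le_bigmax _ _ _ 0 (fun i => (@eps n i)%:num : R) i).
Qed.

Lemma near_eps_lt1 : \forall n \near \oo, forall i, (@eps n i)%:num < 1 :> R.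
Proof.
have h2 : 0 < (2^-1 : R) by [].
apply: filterS (near_eps_le h2) => n H i; apply: (le_lt_trans (H i)); lra.
Qed.

Lemma cvg_integral_ext (Om : nat -> measure_display) (Omega : forall n, measurableType (Om n))
    (Q : forall n, probability (Omega n) R) (Y : forall n, Omega n -> \bar R)
    (nu : probability (\bar R) R) (h : R -> R) (M : R) :
  cvg_in_distribution Q Y nu -> continuous h -> (forall x, `|h x| <= M) ->
  h x @[x --> +oo] --> 0 -> h x @[x --> -oo] --> 0 ->
  \int[Q n]_w ext h (Y n w) @[n --> \oo] --> \int[restr_R nu]_x h x.
Proof.
move=> QY ch hM hy hNy; have mh : measurable_fun setT h.
  exact: continuous_measurable_fun.
have := QY _ (continuous_ext ch hy hNy).
rewrite -(integral_ext (M := M))//; last exact: probability_setT_lty.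
have ei : nu.-integrable setT (EFin \o ext h).
  apply: (bounded_integrable (M := `|M|)); first exact: probability_setT_lty.
    exact: measurable_ext.
  by move=> y; rewrite /ext; case: ifP => _; rewrite ?normr0// (le_trans (hM _))// ler_norm.
rewrite -[X in _ --> X]fineK; last exact: integral_fune_fin_num.
by move=> /fine_cvg.
Qed.

Lemma cvg_null_law (h : R -> R) (M : R) : continuous h -> (forall x, `|h x| <= M) ->
  h x @[x --> +oo] --> 0 -> h x @[x --> -oo] --> 0 ->
  \int[PP n]_w h (TT n w) @[n --> \oo] --> \int[rho1]_x h x.
Proof.
move=> ch hM hy hNy; have := cvg_integral_ext cvg1 ch hM hy hNy.
apply: cvg_trans; apply: near_eq_cvg; apply: filterS near_eps_lt1 => n e1.
apply: (Rintegral_ext_loglik (@muP n) e1 (Q := @P n)); first by move=> i.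
exact: continuous_measurable_fun.
Qed.

Lemma cvg_alt_law (h : R -> R) (M : R) : continuous h -> (forall x, `|h x| <= M) ->
  h x @[x --> +oo] --> 0 -> h x @[x --> -oo] --> 0 ->
  \int[PP n]_w (h (TT n w) * expR (TT n w)) @[n --> \oo] --> \int[rho2]_x h x.
Proof.
move=> ch hM hy hNy; have := cvg_integral_ext cvg2 ch hM hy hNy.
have mh : measurable_fun setT h by exact: continuous_measurable_fun.
apply: cvg_trans; apply: near_eq_cvg; apply: filterS near_eps_lt1 => n e1.
have [_ <-] := Rintegral_alt_law (@muP n) e1 mh hM.
apply: (Rintegral_ext_loglik (@muP n) e1) => // i.
exact: mixture_dominates.
Qed.

Lemma restr_R_setT_lty (nu : probability (\bar R) R) : (restr_R nu setT < +oo)%E.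
Proof.
apply: (le_lt_trans _ (probability_setT_lty nu)).
by apply: le_measure; rewrite ?inE//; apply: measurable_image_EFin; exact: measurableT.
Qed.

(** For each n, [tilted 1 h] is [tilted 0 h] times e^T, so its integral under P is that of
    [tilted 0 h] under Q. In the limit this says that [rho2] has density e^x with respect to
    [rho1]. *)
Lemma tilting_limit (h : R -> R) : continuous h -> (forall x, `|h x| <= 1) ->
  h x @[x --> +oo] --> 0 -> h x @[x --> -oo] --> 0 ->
  \int[rho1]_x tilted 1 h x = \int[rho2]_x tilted 0 h x.
Proof.
move=> ch h1 hy hNy.
have dom s x : 0 <= s <= 1 -> `|tilted s h x| <= `|h x|.
  move=> s01; rewrite /tilted normrM normfV [X in _ / X]gtr0_norm ?oneDexpR_gt0//.
  rewrite ler_pdivrMr ?oneDexpR_gt0// normrM [X in X * _]ger0_norm ?expR_ge0//.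
  by rewrite mulrC ler_wpM2l// addrC expR_scale_le.
have dom0 (F : set_system R) s : Filter F -> 0 <= s <= 1 -> h x @[x --> F] --> 0 ->
    tilted s h x @[x --> F] --> 0.
  move=> FF s01 /cvgr0Pnorm_le h0; apply/cvgr0Pnorm_le => e e0.
  by apply: filterS (h0 e e0) => x; exact: le_trans (dom s x s01).
have domy s : 0 <= s <= 1 -> tilted s h x @[x --> +oo] --> 0.
  by move=> s01; exact: dom0 hy.
have domNy s : 0 <= s <= 1 -> tilted s h x @[x --> -oo] --> 0.
  by move=> s01; exact: dom0 hNy.
have s0 : (0 : R) <= 0 <= (1 : R) by rewrite lexx ler01.
have s1 : (0 : R) <= 1 <= (1 : R) by rewrite lexx ler01.
have H1 := cvg_null_law (continuous_tilted (s := 1) ch) (fun x => tilted_le x s1 h1)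
  (domy _ s1) (domNy _ s1).
have H2 := cvg_alt_law (continuous_tilted (s := 0) ch) (fun x => tilted_le x s0 h1)
  (domy _ s0) (domNy _ s0).
apply: (cvg_unique _ H1) => //.
rewrite (_ : (fun n => _) = fun n => \int[PP n]_w (tilted 0 h (TT n w) * expR (TT n w)))//.
apply/funext => n; apply: eq_Rintegral => w _.
by rewrite /tilted mul0r expR0 mul1r mul1r; ring.
Qed.

Lemma cvgy_tilted s (c : R -> R) : s < 1 -> (forall u, `|c u| <= 1) ->
  tilted s c x @[x --> +oo] --> (0 : R).
Proof.
move=> s1 c1; have /cvgr0Pnorm_le H := cvgy_expR_trig s1 c1; apply/cvgr0Pnorm_le => e e0.
apply: filterS (H e e0) => x; apply: le_trans.
rewrite /tilted !normrM ler_wpM2l// normfV expRN normfV lef_pV2 ?posrE ?normr_gt0 ?gt_eqF ?expR_gt0 ?oneDexpR_gt0//.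
by rewrite !gtr0_norm ?expR_gt0 ?oneDexpR_gt0// lerDr.
Qed.

Lemma cvgNy_tilted s (c : R -> R) : 0 < s -> (forall u, `|c u| <= 1) ->
  tilted s c x @[x --> -oo] --> (0 : R).
Proof.
move=> s0 c1; apply/cvgr0Pnorm_le => e e0.
have /cvgr0Pnorm_le/(_ e e0) H : expR (- (s * u)) @[u --> +oo] --> (0 : R) by exact: cvgy_expRN.
have : \forall x \near -oo, `|expR (s * x)| <= e.
  have [M [Mr HM]] := H; exists (- M); split; first by rewrite realN.
  by move=> x xM; have := HM (- x); rewrite mulrN opprK ltrNr => /(_ xM).
apply: filterS => x; apply: le_trans.
rewrite /tilted !normrM -mulrA ler_piMr//.
rewrite normfV ler_pdivrMr ?normr_gt0 ?gt_eqF ?oneDexpR_gt0// mul1r.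
by rewrite (le_trans (c1 x))// gtr0_norm ?oneDexpR_gt0// lerDl expR_ge0.
Qed.

(** For 0 < s < 1 the weight [tilted s c] vanishes at both ends, so convergence on [-oo, +oo]
    applies to it, under P and under Q, without seeing the infinite points. *)
Lemma cvg_strip s (c : R -> R) : 0 < s < 1 -> continuous c -> (forall u, `|c u| <= 1) ->
  \int[PP n]_w (expR (s * TT n w) * c (TT n w)) @[n --> \oo] -->
  \int[rho1]_x tilted s c x + \int[rho2]_x tilted s c x.
Proof.
move=> /andP[s0 s1] cc c1; have s01 : 0 <= s <= 1 by rewrite !ltW.
have ct := continuous_tilted (s := s) cc.
have t1 x := tilted_le x s01 c1.
have H1 := cvg_null_law ct t1 (cvgy_tilted s1 c1) (cvgNy_tilted s0 c1).
have H2 := cvg_alt_law ct t1 (cvgy_tilted s1 c1) (cvgNy_tilted s0 c1).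
apply: (cvg_trans _ (cvgD H1 H2)); apply: near_eq_cvg.
apply: filterS near_eps_lt1 => n e1.
have mt : measurable_fun setT (tilted s c) by exact: continuous_measurable_fun.
have [ii _] := Rintegral_alt_law (@muP n) e1 mt t1.
transitivity (\int[PP n]_w tilted s c (TT n w) +
  \int[PP n]_w (tilted s c (TT n w) * expR (TT n w))) => //.
rewrite -RintegralD//; last first.
  apply: (bounded_integrable (M := 1)) => //; first exact: probability_setT_lty.
  apply: (measurableT_comp mt).
  exact: (@measurable_total_llr _ _ _ _ _ _ (@eps n) (@muP n)).
apply: eq_Rintegral => w _; rewrite /tilted; field.
by rewrite gt_eqF// oneDexpR_gt0.
Qed.

Section ultrafilter_limit.
Variables (U : set_system nat) (C : R).
Hypotheses (UU : UltraFilter U) (Uoo : U --> \oo)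
  (kapC : \forall n \near U, fine (kap n setT) <= C).

Lemma kap_itv0 a : a < 0 -> \forall n \near U, kap n `]-oo, a]%classic = 0%E.
Proof.
move=> a0; apply: Uoo; pose delta := Num.min 2^-1 ((1 - expR a) / 2).
have ea : expR a < 1 by rewrite -expR0 ltr_expR.
have d0 : 0 < delta by rewrite lt_min invr_gt0 ltr0n/= divr_gt0// subr_gt0.
have d1 : delta <= 2^-1 by rewrite ge_min lexx.
have d2 : delta <= (1 - expR a) / 2 by rewrite ge_min lexx orbT.
apply: filterS (near_eps_le d0) => n H.
have e1 i : (@eps n i)%:num < 1 :> R by have := H i; lra.
apply: hell_measure_itv0 => // i; rewrite -[ltLHS]expRK.
have := H i => Hi; have := expR_gt0 a => e0.
by rewrite ltr_ln ?posrE; lra.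
Qed.

Lemma char_approx_ultra s t (tr : R -> R) : 0 < s < 1 -> tr = cos \/ tr = sin ->
  \int[PP n]_w (expR (s * TT n w) * tr (t * TT n w)) -
  expR (\int[kap n]_x rRe s t x) * tr (\int[kap n]_x rIm s t x) @[n --> U] --> (0 : R).
Proof.
move=> /andP[s0 s1] trE; have s01 : 0 <= s <= 1 by rewrite !ltW.
have [C1 h1] := rRe_bounded t; have [C2 h2] := rIm_bounded t.
pose D := 1 + `|C1| + `|C2|.
have D1 : 1 <= D by have := normr_ge0 C1; have := normr_ge0 C2; rewrite /D; lra.
have rReD x : `|rRe s t x| <= D.
  have := h1 s x s01; have := ler_norm C1; have := normr_ge0 C2; rewrite /D; lra.
have rImD x : `|rIm s t x| <= D.
  have := h2 s x s01; have := ler_norm C2; have := normr_ge0 C1; rewrite /D; lra.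
have D0 : 0 < D by lra.
apply/cvgr0Pnorm_le => e e0.
pose K := `|C| + 1; have K0 : 0 < K by rewrite ltr_wpDl.
(* The three terms give, in this order, increments of modulus at most 1, all eps below 1, and a
   final error of at most [e]. *)
pose eta := Num.min ((2 * D)^-1) (Num.min 2^-1 (e / (40 * D ^+ 2 * K))).
have D2 : 0 < 40 * D ^+ 2 * K by rewrite !mulr_gt0// exprn_gt0.
have eta0 : 0 < eta.
  by rewrite !lt_min invr_gt0 mulr_gt0//= invr_gt0 ltr0n/= divr_gt0.
have eta1 : eta <= (2 * D)^-1 by rewrite ge_min lexx.
have eta2 : eta <= 2^-1 by rewrite !ge_min lexx orbT.
have eta3 : eta <= e / (40 * D ^+ 2 * K) by rewrite !ge_min lexx !orbT.
have H1 := Uoo (near_eps_le eta0).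
apply: filterS2 H1 kapC => n H1 H2.
have e1 i : (@eps n i)%:num < 1 :> R by have := H1 i; lra.
have eta_small : 2 * D * eta <= 1.
  by rewrite mulrC -ler_pdivlMr ?mulr_gt0// mul1r.
have [A1 A2] := char_total_llr_approx (@muP n) e1 s01 rReD rImD H1 eta_small.
have B : 40 * D ^+ 2 * eta * fine (kap n setT) <= e.
  apply: (@le_trans _ _ (40 * D ^+ 2 * eta * K)).
    rewrite ler_wpM2l//; first by rewrite !mulr_ge0 ?sqr_ge0// ltW.
    by rewrite (le_trans H2)// (le_trans (ler_norm C))// lerDl.
  by rewrite mulrAC mulrC -ler_pdivlMr.
by case: trE => ->; [exact: le_trans A1 B|exact: le_trans A2 B].
Qed.

Lemma ultra_limit : exists (m : {measure set R -> \bar R}) (c : R),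
  [/\ (m setT < +oo)%E, m `]-oo, 0[%classic = 0%E, 0 <= c,
  (forall (h : R -> R) (M l : R), continuous h -> (forall x, `|h x| <= M) ->
    h x @[x --> +oo] --> l ->
    \int[kap n]_x h x @[n --> U] --> \int[m]_x h x + c * l) &
  forall s t (tr : R -> R), 0 < s < 1 -> tr = cos \/ tr = sin ->
  \int[rho1]_x tilted s (fun x => tr (t * x)) x + \int[rho2]_x tilted s (fun x => tr (t * x)) x
  = expR (\int[m]_x rRe s t x - c * s) * tr (\int[m]_x rIm s t x - c * t)].
Proof.
have kapT n : (kap n setT < +oo)%E by exact: hell_measure_fin.
have [m [c [mT m0 c0 mlim]]] := vague_compactness UU kapT kapC kap_itv0.
exists m, c; split => // s t tr s01 trE; have /andP[s0 s1] := s01.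
have s01' : 0 <= s <= 1 by rewrite !ltW.
have [C1 h1] := rRe_bounded t; have [C2 h2] := rIm_bounded t.
(* The kernel tends to -z at +oo, so the escaped mass enters as - c s in the real part and - c t in
   the imaginary part. *)
have cX := mlim _ _ _ (continuous_rRe (t := t) s01') (fun x => h1 s x s01') (cvgy_rRe t s1).
have cY := mlim _ _ _ (continuous_rIm (t := t) s01') (fun x => h2 s x s01') (cvgy_rIm (t := t) s1).
rewrite mulrN in cX; rewrite mulrN in cY.
have ctr : continuous tr by case: trE => ->; [exact: continuous_cos|exact: continuous_sin].
have ctrt : continuous (fun x => tr (t * x)).
  by case: trE => ->; [exact: continuous_cosM|exact: continuous_sinM].
have tr1 x : `|tr (t * x)| <= 1.
  by case: trE => ->; [exact: cos_max|exact: sin_max].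
have H1 := cvg_trans (cvg_app _ Uoo) (cvg_strip s01 ctrt tr1).
have H2 : expR (\int[kap n]_x rRe s t x) * tr (\int[kap n]_x rIm s t x) @[n --> U] -->
    expR (\int[m]_x rRe s t x - c * s) * tr (\int[m]_x rIm s t x - c * t).
  apply: cvgM; first by apply: (cvg_comp _ _ cX); exact: continuous_expR.
  by apply: (cvg_comp _ _ cY); exact: ctr.
have H3 := cvgD (char_approx_ultra t s01 trE) H2.
have H4 : \int[PP n]_w (expR (s * TT n w) * tr (t * TT n w)) @[n --> U] -->
    expR (\int[m]_x rRe s t x - c * s) * tr (\int[m]_x rIm s t x - c * t).
  rewrite add0r in H3; apply: (cvg_trans _ (H3 _)).
  by apply: near_eq_cvg; apply: nearW => n; exact: subrK.
exact: (cvg_unique _ H1 H4).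
Qed.

End ultrafilter_limit.

End sparse_model.

Lemma Rintegral_mscale (R : realType) (rho : {measure set R -> \bar R}) (r : {nonneg R})
    (f : R -> R) : rho.-integrable setT (EFin \o f) ->
  \int[mscale r rho]_x f x = r%:num * \int[rho]_x f x.
Proof.
move=> fi; have mf : measurable_fun setT (EFin \o f) by exact: measurable_int fi.
have pf : (\int[rho]_x (EFin \o f)^\+ x)%E \is a fin_num by exact: integrable_pos_fin_num.
have nf : (\int[rho]_x (EFin \o f)^\- x)%E \is a fin_num by exact: integrable_neg_fin_num.
rewrite /Rintegral integralE ge0_integral_mscale//; last exact: measurable_funepos.
rewrite ge0_integral_mscale//; last exact: measurable_funeneg.
have E := integralE rho setT (EFin \o f).
set a := (\int[rho]_x (_ ^\+ x))%E in pf E *; set b := (\int[rho]_x (_ ^\- x))%E in nf E *.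
rewrite [in RHS](_ : (\int[rho]_x (f x)%:E)%E = (a - b)%E)//.
by rewrite -(fineK pf) -(fineK nf) -!EFinM -!EFinB /= mulrBr.
Qed.

(** * Triplets of the limit laws and uniqueness of the limiting measure *)

Section limit_law.
Context (R : realType).
Local Open Scope complex_scope.
Implicit Types (rho m : {measure set R -> \bar R}) (c : R).

Definition strip_identity rho1 rho2 m c := forall s t (tr : R -> R),
  0 < s < 1 -> tr = cos \/ tr = sin ->
  \int[rho1]_x tilted s (fun x => tr (t * x)) x + \int[rho2]_x tilted s (fun x => tr (t * x)) x
  = expR (\int[m]_x rRe s t x - c * s) * tr (\int[m]_x rIm s t x - c * t).

Definition tilt_of rho1 rho2 := forall h : R -> R, continuous h -> (forall x, `|h x| <= 1) ->
  h x @[x --> +oo] --> 0 -> h x @[x --> -oo] --> 0 ->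
  \int[rho1]_x tilted 1 h x = \int[rho2]_x tilted 0 h x.

Section identification.
Variables (rho1 rho2 m : {measure set R -> \bar R}) (c : R).
Hypotheses (rho1T : (rho1 setT < +oo)%E) (rho2T : (rho2 setT < +oo)%E)
  (mT : (m setT < +oo)%E) (m0 : m `]-oo, 0[%classic = 0%E).
Hypotheses (strip : strip_identity rho1 rho2 m c) (tilt : tilt_of rho1 rho2).

Lemma levy_khintchine_rho1 : exists gamma,
  levy_khintchine_triplet rho1 gamma (4 * fine (m [set 0])) (levy_of m 0).
Proof.
have [gamma Hg] := Rintegral_rIm mT m0 (or_introl erefl) c; exists gamma.
apply/levy_khintchine_tripletE; split.
- by rewrite mulr_ge0// fine_ge0.
- by apply: levy_ofP => //; left.
- move=> t; rewrite (char_rho1 (c := c) rho1T rho2T mT _ _ tilt); last 2 first.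
  + by move=> s u s01; apply: strip => //; left.
  + by move=> s u s01; apply: strip => //; right.
  by rewrite (Rintegral_rRe mT m0 (or_introl erefl)) Hg.
Qed.

Lemma char_rho2_levy : exists gamma, forall t, char_fun rho2 t =
  cexp ((lk_Re (4 * fine (m [set 0])) (levy_of m 1) t - c) +i* lk_Im gamma (levy_of m 1) t).
Proof.
have [gamma Hg] := Rintegral_rIm mT m0 (or_intror erefl) c; exists gamma => t.
rewrite (char_rho2 (c := c) rho1T rho2T mT _ _ tilt); last 2 first.
- by move=> s u s01; apply: strip => //; left.
- by move=> s u s01; apply: strip => //; right.
by rewrite (Rintegral_rRe mT m0 (or_intror erefl)) Hg.
Qed.

Lemma lk_Re0 sigma2 (eta : {measure set R -> \bar R}) : lk_Re sigma2 eta 0 = 0.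
Proof.
rewrite /lk_Re expr0n/= mulr0 mul0r oppr0 add0r.
under eq_Rintegral do rewrite mul0r cos0 subrr.
by rewrite Rintegral_cst// mul0r.
Qed.

Lemma fine_setT_char (rho : {measure set R -> \bar R}) (a b : R) : (rho setT < +oo)%E ->
  char_fun rho 0 = cexp (a +i* b) -> cos b = 1 -> rho setT = (expR a)%:E.
Proof.
move=> rT; rewrite char_funE cexpE => -[+ _] cb; rewrite cb mulr1.
under eq_Rintegral do rewrite mul0r cos0.
by rewrite Rintegral_cst// mul1r => <-; rewrite fineK// ge0_fin_numE.
Qed.

(** At t = 0 the Levy-Khintchine exponent vanishes, so the strip identity alone already excludes
    that nu_1 has mass at -oo or +oo. *)
Lemma rho1_setT : rho1 setT = 1%E.
Proof.
have [gamma /levy_khintchine_tripletE[_ _ ch]] := levy_khintchine_rho1.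
have := fine_setT_char rho1T (ch 0); rewrite lk_Im0 cos0 lk_Re0 expR0; exact.
Qed.

Lemma rho2_setT : rho2 setT = (expR (- c))%:E.
Proof.
have [gamma ch] := char_rho2_levy.
have := fine_setT_char rho2T (ch 0); rewrite lk_Im0 cos0 lk_Re0 sub0r; exact.
Qed.

(** Normalising by e^c cancels the constant -c in the exponent, the only deviation from
    Levy-Khintchine form. *)
Lemma levy_khintchine_rho2 (r : {nonneg R}) : r%:num = expR c -> exists gamma,
  levy_khintchine_triplet (mscale r rho2) gamma (4 * fine (m [set 0])) (levy_of m 1).
Proof.
move=> rc; have [gamma ch] := char_rho2_levy; exists gamma.
apply/levy_khintchine_tripletE; split.
- by rewrite mulr_ge0// fine_ge0.
- by apply: levy_ofP => //; right.
- move=> t; have := ch t; rewrite !char_funE !cexpE => -[h1 h2].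
  rewrite !Rintegral_mscale; last 2 first.
  + by apply: (bounded_integrable (M := 1)) => //; [exact: measurable_sinM|move=> x; exact: sin_max].
  + by apply: (bounded_integrable (M := 1)) => //; [exact: measurable_cosM|move=> x; exact: cos_max].
  by rewrite h1 h2 rc !mulrA -!expRD addrC subrK.
Qed.

End identification.

Lemma levy_of_hell m (A : set R) : measurable A ->
  m (A `&` `]0, +oo[%classic) =
  (\int[levy_of m 0]_(x in A) (hell x)%:E)%E.
Proof.
move=> mA; have mh : measurable_fun setT (@hell R).
  by apply: continuous_measurable_fun; exact: continuous_hell.
have mA1 : measurable_fun setT (fun x => \1_A x * hell x : R) by apply: measurable_funM.
transitivity (\int[levy_of m 0]_x (\1_A x * hell x)%:E)%E; last first.
  rewrite [RHS]integral_mkcond; apply: eq_integral => x _.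
  by rewrite epatch_indic -EFinM mulrC.
rewrite ge0_integral_mdensity//; last 2 first.
- exact/measurable_EFinP.
- by move=> x; rewrite lee_fin mulr_ge0// hell_ge0.
rewrite -[A `&` _]setIT -integral_indic//; last first.
  by apply: measurableI.
apply: eq_integral => x _; rewrite -EFinM indicI/=; congr EFin.
have [x0|x0] := leP x 0.
  rewrite levy_density_le0// [X in _ * X]indicE memNset ?mulr0//.
  by rewrite /= in_itv/= andbT; apply/negP; rewrite -leNgt.
rewrite levy_density_gt0// mul0r expR0 -mulrA mul1r divff ?hell_neq0 ?gt_eqF//.
by congr (_ * _); rewrite indicE mem_set//= in_itv/= x0.
Qed.

(** [c] is read from the mass e^{-c} of [rho2], the mass of [m] at 0 from the variance 4 m{0}, and
    [m] on (0, +oo) from eta_1 by multiplying back by [hell]. *)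
Lemma limit_law_unique rho1 rho2 m c m' c' :
  (rho1 setT < +oo)%E -> (rho2 setT < +oo)%E -> tilt_of rho1 rho2 ->
  (m setT < +oo)%E -> m `]-oo, 0[%classic = 0%E -> strip_identity rho1 rho2 m c ->
  (m' setT < +oo)%E -> m' `]-oo, 0[%classic = 0%E -> strip_identity rho1 rho2 m' c' ->
  c = c' /\ forall A, measurable A -> m A = m' A.
Proof.
move=> r1 r2 tilt mT m0 st m'T m'0 st'; split.
  have := rho2_setT r1 r2 mT m0 st tilt; rewrite (rho2_setT r1 r2 m'T m'0 st' tilt).
  by move=> [] /expR_inj/oppr_inj.
have [g lk] := levy_khintchine_rho1 r1 r2 mT m0 st tilt.
have [g' lk'] := levy_khintchine_rho1 r1 r2 m'T m'0 st' tilt.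
have [s0 eq_levy] := levy_khintchine_unique lk lk'.
have ms0 (mm : {measure set R -> \bar R}) : (mm setT < +oo)%E -> mm [set 0] \is a fin_num.
  move=> mmT; rewrite ge0_fin_numE//; apply: le_lt_trans mmT.
  by apply: le_measure; rewrite ?inE.
have e0 : m [set 0] = m' [set 0].
  rewrite -(fineK (ms0 _ mT)) -(fineK (ms0 _ m'T)); congr EFin.
  by have : (4 : R) != 0 by []; move/mulfI; apply.
move=> A mA.
have split3 (mm : {measure set R -> \bar R}) : mm `]-oo, 0[%classic = 0%E ->
    mm A = (mm (A `&` [set 0%R]) + mm (A `&` `]0%R, +oo[%classic))%E.
  move=> mm0; rewrite (measureDI mm mA (measurable_set1 0)) addeC; congr (_ + _)%E.
  have mA0 : measurable (A `\ 0) by apply: measurableD => //; exact: measurable_set1.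
  have mneg : measurable (`]-oo, 0[%classic : set R) by exact: measurable_itv.
  rewrite (measureDI mm mA0 mneg).
  rewrite [X in (_ + X)%E](_ : _ = 0%E); last first.
    apply/eqP; rewrite -measure_le0 -mm0; apply: le_measure; rewrite ?inE//.
    by apply: measurableI.
  rewrite adde0; congr (mm _); apply/seteqP; split => x /=.
    move=> [[Ax x0]]; rewrite !in_itv/= andbT => /negP; rewrite -leNgt => x1; split => //.
    by rewrite lt_neqAle x1 andbT; apply/eqP => x2; exact: x0.
  rewrite !in_itv/= andbT => -[Ax x0]; split; first by split => // x1; rewrite x1 ltxx in x0.
  by apply/negP; rewrite -leNgt ltW.
rewrite !split3//; congr (_ + _)%E.
  have [A0|A0] := pselect (A 0).
    by rewrite (_ : A `&` [set 0] = [set 0])//; apply/seteqP; split => [x []//|x ->].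
  rewrite (_ : A `&` [set 0] = set0) ?measure0//.
  by apply/seteqP; split => // x [Ax x0]; apply: A0; rewrite -x0.
rewrite !levy_of_hell//; apply: eq_measure_integral => B mB _; exact: eq_levy.
Qed.

End limit_law.

(** If some neighbourhood had a preimage outside F, then F restricted to the complement of this
    preimage would be proper, and an ultrafilter refining it would contradict the assumption. *)
Lemma cvg_ultrafilters (I : Type) (Y : topologicalType) (F : set_system I) (f : I -> Y) (l : Y) :
  Filter F -> (forall U, UltraFilter U -> U --> F -> f @ U --> l) -> f @ F --> l.
Proof.
move=> FF H A lA; apply: contrapT => nA.
pose D := ~` (f @^-1` A); pose G := within D F.
have PG : ProperFilter G.
  apply: Build_ProperFilter => G0; apply: nA.
  rewrite /nbhs/=; apply: (@filterS _ F _ _ _ _ (G0 : F [set x | D x -> False])) => x /= Dx.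
  by apply: contrapT => nAx; exact: Dx.
have [U [UU GU]] := ultraFilterLemma PG.
have UF : U --> F by move=> B FB; apply: GU; apply: filterS FB => x Bx _.
have UD : U D.
  by apply: GU; rewrite /G /within; apply: (@filterE _ F).
have UA : U (f @^-1` A) := H U UU UF A lA.
have [x [xD xA]] := filter_ex (filterI UD UA).
exact: xD.
Qed.

Section limn_esup_bounds.
Context (R : realType).
Local Open Scope ereal_scope.
Implicit Types (u : (\bar R)^nat) (l : \bar R).

Lemma limn_esup_le u l : (\forall n \near \oo, u n <= l) -> limn_esup u <= l.
Proof.
move=> ul; apply: ereal_inf_le; exists (ereal_sup (u @` [set n | u n <= l])).
  by exists [set n | u n <= l].
by apply: ge_ereal_sup => _ [n /= nl <-].
Qed.

Lemma limn_esup_lt u l : limn_esup u < l -> \forall n \near \oo, u n < l.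
Proof.
move=> /ereal_inf_lt[_ [A FA <-] Al]; apply: filterS FA => n An.
by apply: le_lt_trans Al; apply: ereal_sup_ubound; exists n.
Qed.

Lemma limn_einf_ge u l : (\forall n \near \oo, l <= u n) -> l <= limn_einf u.
Proof.
move=> ul; rewrite /limn_einf leeNr; apply: limn_esup_le.
by apply: filterS ul => n; rewrite leeN2.
Qed.

End limn_esup_bounds.

(** * Conditions (a) and (b) *)

Section full_limit.
Context (R : realType) (k : nat -> nat) (d : forall n, 'I_(k n) -> measure_display)
  (T : forall n (i : 'I_(k n)), measurableType (@d n i))
  (P mu : forall n (i : 'I_(k n)), probability (@T n i) R)
  (eps : forall n, 'I_(k n) -> {i01 R}).
Variables (nu1 nu2 : probability (\bar R) R).
Hypothesis muP : forall n i, @mu n i `<< @P n i.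
Hypothesis eps0 :
  \big[Num.max/0]_(i < k n) (@eps n i)%:num @[n --> \oo] --> (0 : R).
Hypothesis cvg1 : cvg_in_distribution (fun n => null_law (@P n))
  (fun n => loglik (@P n) (@mu n) (@eps n)) nu1.
Hypothesis cvg2 : cvg_in_distribution (fun n => alt_law (@P n) (@mu n) (@eps n))
  (fun n => loglik (@P n) (@mu n) (@eps n)) nu2.

Local Notation rho1 := (restr_R nu1).
Local Notation rho2 := (restr_R nu2).
Local Notation PP n := (null_law (@P n)).
Local Notation TT n := (total_llr (@P n) (@mu n) (@eps n)).
Local Notation kap n := (hell_measure (@eps n) (@muP n)).

Definition kap_limit (m : {measure set R -> \bar R}) (c : R) :=
  forall (h : R -> R) (M l : R), continuous h -> (forall x, `|h x| <= M) ->
    h x @[x --> +oo] --> l ->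
    \int[kap n]_x h x @[n --> \oo] --> \int[m]_x h x + c * l.

(** The pair found along one ultrafilter is the pair along every other one, so the sequence itself
    converges. *)
Lemma full_limit (C : R) : (\forall n \near \oo, fine (kap n setT) <= C) ->
  exists (m : {measure set R -> \bar R}) (c : R),
  [/\ (m setT < +oo)%E, m `]-oo, 0[%classic = 0%E, 0 <= c,
    strip_identity rho1 rho2 m c & kap_limit m c].
Proof.
move=> kapC; have [U0 [UU0 U0oo]] := ultraFilterLemma eventually_filter.
have lim U (UU : UltraFilter U) (Uoo : U --> \oo) :=
  ultra_limit eps0 cvg1 cvg2 UU Uoo (Uoo _ kapC).
have tilt : tilt_of rho1 rho2 by move=> h; exact: tilting_limit eps0 cvg1 cvg2 h.
have [m [c [mT m0 c0 _ st]]] := lim _ UU0 U0oo.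
exists m, c; split => // h M l ch hM hl; apply: cvg_ultrafilters => U UU Uoo.
have [m' [c' [m'T m'0 _ lim' st']]] := lim _ UU Uoo.
have [-> eqm] := limit_law_unique (restr_R_setT_lty nu1) (restr_R_setT_lty nu2) tilt
  mT m0 st m'T m'0 st'.
rewrite (_ : \int[m]_x h x = \int[m']_x h x); first exact: lim' ch hM hl.
rewrite /Rintegral; congr fine; apply: eq_measure_integral => A mA _; exact: eqm.
Qed.

(** The affinities have a positive limit, because the weight [tilted 2^-1 (cst 1)] is strictly
    positive and [rho1] is not the zero measure. *)
Lemma kap_bounded_of_mass : (0 < rho1 setT)%E ->
  exists C, \forall n \near \oo, fine (kap n setT) <= C.
Proof.
move=> rho1_gt0; have s01 : 0 < (2^-1 : R) < 1 by apply/andP; split; lra.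
have s01' : 0 <= (2^-1 : R) <= 1 by apply/andP; split; lra.
have c1 (x : R) : `|(cst 1 : R -> R) x| <= 1 by rewrite /cst normr1.
have cc : continuous (cst 1 : R -> R) by move=> x; exact: cvg_cst.
have H := cvg_strip muP eps0 cvg1 cvg2 s01 cc c1.
set a := (X in _ --> X) in H.
have t0 x : 0 < tilted 2^-1 (cst 1 : R -> R) x.
  by rewrite /tilted mulr1 divr_gt0 ?expR_gt0 ?oneDexpR_gt0.
have pos (rho : {measure set R -> \bar R}) : 0 <= \int[rho]_x tilted 2^-1 (cst 1) x.
  by apply: Rintegral_ge0 => x _; exact: ltW.
have a0 : 0 < a.
  rewrite ltr_pwDl// lt0r pos andbT; apply/eqP => I0.
  have mt : measurable_fun setT (tilted 2^-1 (cst 1 : R -> R)).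
    by apply: continuous_measurable_fun; exact: continuous_tilted.
  have ti := integrable_tilted (restr_R_setT_lty nu1) s01' cc c1.
  have E : (\int[rho1]_x `|(tilted 2^-1 (cst 1) x)%:E| = 0)%E.
    under eq_integral do rewrite /= gtr0_norm//.
    rewrite -[LHS]fineK; last exact: integral_fune_fin_num.
    by rewrite -[fine _]/(\int[rho1]_x tilted 2^-1 (cst 1) x) I0.
  have mtE : measurable_fun setT (EFin \o tilted 2^-1 (cst 1 : R -> R)).
    exact/measurable_EFinP.
  have [N [mN N0 NT]] := (ae_eq_integral_abs rho1 measurableT mtE).1 E.
  have : (rho1 setT <= rho1 N)%E.
    apply: le_measure; rewrite ?inE// => x _; apply: NT => /= /(_ I)[] /eqP.
    by rewrite gt_eqF.
  by rewrite N0 leNgt rho1_gt0.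
(* This solves a / 2 < exp (- K / 2) for the mass K of [kap n]. *)
exists (- 2 * ln (a / 2)).
have a2 : a / 2 < a by lra.
have a20 : 0 < a / 2 by lra.
have H2 : \forall n \near \oo, a / 2 < \int[PP n]_w (expR (2^-1 * TT n w) * (cst 1 (TT n w))).
  exact: (cvgr_gt a H).
apply: filterS2 H2 (near_eps_lt1 eps0) => n En e1.
have := half_moment_le (@muP n) e1; under eq_Rintegral do rewrite -[expR _]mulr1.
move=> /(lt_le_trans En); rewrite -ltr_ln ?posrE ?expR_gt0// expRK; lra.
Qed.

End full_limit.

Lemma dense_in_pos_itv (R : realType) (D : set R) (a b : R) : dense_in_pos D ->
  0 <= a -> a < b -> exists2 y, D y & a < y < b.
Proof.
move=> [_ Dd] a0 ab; have c_itv : (a + b) / 2 \in `]a, b[%R.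
  by rewrite in_itv/=; apply/andP; split; lra.
have c0 : 0 < (a + b) / 2 by lra.
have [y [Dy yab]] := Dd _ c0 _ (near_in_itvoo c_itv).
by exists y => //; move: yab; rewrite /= in_itv.
Qed.

(** * Truncated sums compared with integrals against kap_n *)

Section truncated_sums.
Context (R : realType) (k : nat -> nat) (d : forall n, 'I_(k n) -> measure_display)
  (T : forall n (i : 'I_(k n)), measurableType (@d n i))
  (P mu : forall n (i : 'I_(k n)), probability (@T n i) R)
  (eps : forall n, 'I_(k n) -> {i01 R}).
Hypothesis muP : forall n i, @mu n i `<< @P n i.
Hypothesis eps0 :
  \big[Num.max/0]_(i < k n) (@eps n i)%:num @[n --> \oo] --> (0 : R).
Local Notation kap n := (hell_measure (@eps n) (@muP n)).

Definition large_sum n x : R := \sum_(i < k n) large_signal (@P n i) (@mu n i) (@eps n i) x.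

Definition small_sum n x : R := \sum_(i < k n) small_signal_var (@P n i) (@mu n i) (@eps n i) x.

Definition sqr_sum n x : R := \sum_(i < k n) small_signal_sqr (@P n i) (@mu n i) (@eps n i) x.

Lemma I1E n x : I1 (@P n) (@mu n) (@eps n) x = (large_sum n x)%:E.
Proof.
rewrite /I1 /large_sum -sumEFin; apply: eq_bigr => i _.
exact: (I1_coord (@muP n i)).
Qed.

Lemma I2E n x : 0 <= x -> I2 (@P n) (@mu n) (@eps n) x = (sqr_sum n x)%:E.
Proof.
move=> x0; rewrite /I2 /sqr_sum -sumEFin; apply: eq_bigr => i _.
exact: (I2_coord (@muP n i)).
Qed.

Lemma large_sum_le n x y : x <= y -> large_sum n y <= large_sum n x.
Proof.
move=> xy; apply: ler_sum => i _; apply: le_Rintegral => //.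
- exact: (integrable_signal_gt (@muP n i)).
- exact: (integrable_signal_gt (@muP n i)).
move=> w _; rewrite ler_wpM2r ?signal_ge0// !indicE.
have [yw|yw] := pselect (y < signal (@P n i) (@mu n i) (@eps n i) w); last first.
  by rewrite memNset.
by rewrite !mem_set//=; exact: le_lt_trans yw.
Qed.

Lemma near_sqr_sum x delta : 0 < x -> 0 < delta ->
  \forall n \near \oo, `|sqr_sum n x - small_sum n x| <= delta * large_sum n x.
Proof.
move=> x0 d0; have D0 : 0 < 2 + x^-1 by rewrite ltr_wpDr ?invr_ge0// ltW.
have e0 : 0 < delta / (2 + x^-1) by rewrite divr_gt0.
apply: filterS2 (near_eps_lt1 eps0) (near_eps_le eps0 e0) => n e1 en.
rewrite /sqr_sum /small_sum /large_sum -sumrB mulr_sumr.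
apply: (le_trans (ler_norm_sum _ _ _)); apply: ler_sum => i _.
apply: (le_trans (small_signal_sqr_var (@muP n i) (e1 i) x0)).
rewrite ler_wpM2r//; last by rewrite -ler_pdivlMr.
by apply: Rintegral_ge0 => w _; rewrite mulr_ge0// signal_ge0.
Qed.

Lemma near_kap_le x : 0 < x ->
  \forall n \near \oo, fine (kap n setT) <= small_sum n x + large_sum n x.
Proof.
move=> x0; apply: filterS2 (near_eps_lt1 eps0) (near_eps_le eps0 x0) => n e1 en.
rewrite hell_measureT /small_sum /large_sum -big_split/=; apply: ler_sum => i _.
exact: (hellinger_le_signal (@muP n i) (e1 i)).
Qed.

Lemma near_large_sum_ge x b : 0 < x -> x < b ->
  \forall n \near \oo, \int[kap n]_u jump_test x b u <= large_sum n (expR x - 1).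
Proof.
move=> x0 xb; apply: filterS (near_eps_lt1 eps0) => n e1.
have [M hM] := jump_test_bounded x0 xb.
rewrite (Rintegral_hell_measure (@eps n) (@muP n) (M := M))//.
  by apply: ler_sum => i _; exact: (large_signal_ge (@muP n i) (e1 i)).
by apply: continuous_measurable_fun; exact: continuous_jump_test.
Qed.

Lemma near_large_sum_le a x' x delta : 0 < a -> a < x' -> x' < x -> 0 < delta ->
  \forall n \near \oo, large_sum n (expR x - 1) <=
    (1 + delta) * \int[kap n]_u jump_test a x' u.
Proof.
move=> a0 ax' xx' d0; have x'0 := lt_trans a0 ax'.
have e1' : 0 < expR x - expR x' by rewrite subr_gt0 ltr_expR.
have e2' : 0 < delta * (expR x' - 1) by rewrite mulr_gt0// subr_gt0 expR_gt1.
apply: filterS3 (near_eps_lt1 eps0) (near_eps_le eps0 e1') (near_eps_le eps0 e2').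
move=> n e1 h1 h2; have [M hM] := jump_test_bounded a0 ax'.
rewrite (Rintegral_hell_measure (@eps n) (@muP n) (M := M))//.
  rewrite mulr_sumr; apply: ler_sum => i _.
  exact: (large_signal_le (@muP n i) (e1 i)).
by apply: continuous_measurable_fun; exact: continuous_jump_test.
Qed.

Lemma variance_test_norm (a b : R) u : a < b ->
  `|variance_test a b u| <= (expR (b / 2) + 1) ^+ 2.
Proof. by move=> ab; rewrite ger0_norm ?variance_test_ge0 ?variance_test_le. Qed.

Lemma near_small_sum_ge a b x : 0 < a -> a < b -> expR b - 1 < x ->
  \forall n \near \oo, \int[kap n]_u variance_test a b u <= small_sum n x.
Proof.
move=> a0 ab bx; have e0 : 0 < x - (expR b - 1) by rewrite subr_gt0.
apply: filterS2 (near_eps_lt1 eps0) (near_eps_le eps0 e0) => n e1 h1.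
rewrite (Rintegral_hell_measure (@eps n) (@muP n) (M := (expR (b / 2) + 1) ^+ 2)).
- apply: ler_sum => i _; apply: (small_signal_var_ge (@muP n i) (e1 i)) => //.
  by have := h1 i; lra.
- by apply: continuous_measurable_fun; exact: continuous_variance_test.
- by move=> u; exact: variance_test_norm.
Qed.

Lemma near_small_sum_le a b x : a < b -> 1 + x <= expR a ->
  \forall n \near \oo, small_sum n x <= \int[kap n]_u variance_test a b u.
Proof.
move=> ab ax; apply: filterS (near_eps_lt1 eps0) => n e1.
rewrite (Rintegral_hell_measure (@eps n) (@muP n) (M := (expR (b / 2) + 1) ^+ 2)).
- by apply: ler_sum => i _; exact: (small_signal_var_le (@muP n i) (e1 i)).
- by apply: continuous_measurable_fun; exact: continuous_variance_test.
- by move=> u; exact: variance_test_norm.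
Qed.

Lemma near_large_sum_bounded (D : set R) M x : condition_a P mu eps D M -> 0 < x ->
  exists C, \forall n \near \oo, large_sum n x <= C.
Proof.
move=> [Dd _ Mlim] x0; have l0 : 0 < ln (1 + x) by rewrite ln_gt0// ltrDl.
(* A point [y] of [D] with e^y - 1 < x; the sum decreases in its threshold. *)
have [y Dy /andP[y0 yx]] := dense_in_pos_itv Dd (lexx 0) l0.
have [+ Mfin] := Mlim y Dy.
under eq_fun do rewrite I1E.
have Mfin' : M [set z | (y%:E < z)%E] \is a fin_num by rewrite ge0_fin_numE.
rewrite -(fineK Mfin') => /fine_cvg H.
exists (fine (M [set z | (y%:E < z)%E]) + 1).
have H2 := cvgr_lt (fine (M [set z | (y%:E < z)%E])) H.
have ltM : fine (M [set z | (y%:E < z)%E]) < fine (M [set z | (y%:E < z)%E]) + 1 by rewrite ltrDl.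
apply: filterS (H2 _ _ ltM) => n /ltW /=; apply: le_trans; apply: large_sum_le.
have : expR y < expR (ln (1 + x)) by rewrite ltr_expR.
by rewrite lnK ?posrE; lra.
Qed.

(** By (b) the limsup of [I2] is finite at one small x. There (a) bounds the large signals, [I2]
    bounds the small ones up to these, and together they bound the Hellinger mass. *)
Lemma kap_bounded_of_conditions (D : set R) M sigma2 :
  condition_a P mu eps D M -> condition_b P mu eps sigma2 ->
  exists C, \forall n \near \oo, fine (kap n setT) <= C.
Proof.
move=> ca [_ hb _].
have [x [x0 xb]] : exists x, 0 < x /\
    (limn_esup (fun n => I2 (@P n) (@mu n) (@eps n) x) < (sigma2 + 1)%:E)%E.
  have hlt : \forall y \near (sigma2%:E), (y < (sigma2 + 1)%:E)%E.
    apply/nbhs_EFin; near=> s; rewrite lte_fin; near: s.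
    by apply: lt_nbhsl; rewrite ltrDl.
  have hb' : \forall x \near 0^'+,
      (limn_esup (fun n => I2 (@P n) (@mu n) (@eps n) x) < (sigma2 + 1)%:E)%E := hb _ hlt.
  have h0 : \forall x \near (0 : R)^'+, 0 < x by exact: nbhs_right_gt.
  exact: (@filter_ex _ _ (at_right_proper_filter (0 : R)) _ (@filterI _ _ _ _ _ h0 hb')).
have [C1 hC1] := near_large_sum_bounded ca x0.
(* The large signals count twice: once in the bound on the mass of [kap n], once for replacing
   [small_sum] by [sqr_sum], taken with delta = 1. *)
exists (sigma2 + 1 + 2 * C1).
have h3 := near_sqr_sum x0 ltr01.
have h4 := limn_esup_lt xb.
near=> n.
have h1n : fine (kap n setT) <= small_sum n x + large_sum n x.
  by near: n; exact: near_kap_le.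
have h2n : large_sum n x <= C1 by near: n.
have : `|sqr_sum n x - small_sum n x| <= 1 * large_sum n x by near: n.
have : (I2 (@P n) (@mu n) (@eps n) x < (sigma2 + 1)%:E)%E by near: n.
by rewrite (I2E n (ltW x0)) lte_fin ler_norml => ? /andP[? ?]; lra.
Unshelve. all: by end_near.
Qed.

End truncated_sums.

(** * The limiting tail function and the limiting variance *)

Section jump_tail.
Context (R : realType) (m : {measure set R -> \bar R}) (c : R).
Hypotheses (mT : (m setT < +oo)%E) (m0 : m `]-oo, 0[%classic = 0%E) (c0 : 0 <= c).

(** The difference of the densities e^u / [hell u] of eta_2 and 1 / [hell u] of eta_1 on (0, +oo),
    so that [tilt_measure] is the candidate for M there. *)
Definition jump_density (u : R) : R := \1_(`]0, +oo[%classic) u * ((expR u - 1) / hell u).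

Lemma jump_density_gt0 u : 0 < u -> jump_density u = (expR u - 1) / hell u.
Proof. by move=> u0; rewrite /jump_density indicE mem_set/= ?in_itv/= ?u0// mul1r. Qed.

Lemma jump_density_le0 u : u <= 0 -> jump_density u = 0.
Proof.
move=> u0; rewrite /jump_density indicE memNset/= ?mul0r//.
by rewrite in_itv/= andbT ltNge u0.
Qed.

Lemma jump_density_ge0 u : 0 <= jump_density u.
Proof.
have [u0|u0] := leP u 0; first by rewrite jump_density_le0.
rewrite jump_density_gt0// divr_ge0 ?hell_ge0// subr_ge0 -expR0 ler_expR ltW//.
Qed.

Lemma measurable_jump_density : measurable_fun setT jump_density.
Proof.
apply: measurable_funM => //; apply: measurable_funM.
  by apply: measurable_funB => //; exact: measurable_expR.
apply: measurable_funV_ge0; last exact: hell_ge0.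
by apply: continuous_measurable_fun; exact: continuous_hell.
Qed.

Definition tilt_measure := density_measure m measurable_jump_density jump_density_ge0.

Lemma levy_density1E u : levy_density 1 u = levy_density 0 u + jump_density u.
Proof.
have [u0|u0] := leP u 0; first by rewrite !levy_density_le0// jump_density_le0// addr0.
rewrite !levy_density_gt0// jump_density_gt0// mul1r mul0r expR0 -mulrDl; congr (_ / _); ring.
Qed.

Lemma levy_of1E (A : set R) : measurable A ->
  levy_of m 1 A = (levy_of m 0 A + tilt_measure A)%E.
Proof.
move=> mA; rewrite -[levy_of m 1 A]/(\int[m]_(x in A) (levy_density 1 x)%:E)%E.
rewrite -[levy_of m 0 A]/(\int[m]_(x in A) (levy_density 0 x)%:E)%E.
rewrite -[tilt_measure A]/(\int[m]_(x in A) (jump_density x)%:E)%E.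
rewrite -ge0_integralD//.
- by apply: eq_integral => x _; rewrite levy_density1E EFinD.
- by move=> x _; rewrite lee_fin levy_density_ge0.
- by apply/measurable_EFinP; apply: measurable_funTS; exact: measurable_levy_density.
- by move=> x _; rewrite lee_fin jump_density_ge0.
- by apply/measurable_EFinP; apply: measurable_funTS; exact: measurable_jump_density.
Qed.

Lemma jump_density_bounded x : 0 < x -> exists2 M : R, 0 <= M &
  forall (y : R) u, x <= y -> `|\1_(`]y, +oo[%classic) u * jump_density u| <= M.
Proof.
move=> x0; have x2 : 0 < x / 2 by rewrite divr_gt0.
have x2x : x / 2 < x by lra.
have [M hM] := jump_test_bounded x2 x2x; exists `|M| => // y u xy.
have [uy|uy] := leP u y.
  rewrite indicE memNset/= ?mul0r ?normr0//.
  by rewrite in_itv/= andbT; apply/negP; rewrite -leNgt.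
have ux := le_lt_trans xy uy.
rewrite indicE mem_set/= ?in_itv/= ?uy// mul1r.
apply: le_trans (ler_norm M); apply: le_trans (hM u).
by rewrite /jump_test ramp1 ?mul1r ?jump_density_gt0// ?(lt_trans x0)// ltW.
Qed.

(** The candidate for M(x, +oo]: the jumps beyond x together with the atom [c] at +oo. *)
Definition tail x := \int[m]_u (\1_(`]x, +oo[%classic) u * jump_density u) + c.

Lemma measurable_tail x :
  measurable_fun setT (fun u : R => \1_(`]x, +oo[%classic) u * jump_density u : R).
Proof. by apply: measurable_funM => //; exact: measurable_jump_density. Qed.

Lemma integrable_tail x : 0 < x ->
  m.-integrable setT (EFin \o (fun u => \1_(`]x, +oo[%classic) u * jump_density u)).
Proof.
move=> x0; have [M _ hM] := jump_density_bounded x0.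
apply: (bounded_integrable (M := M)) => //; first exact: measurable_tail.
by move=> u; exact: hM.
Qed.

Lemma tilt_measure_ray x : 0 < x ->
  tilt_measure `]x, +oo[%classic = (tail x - c)%:E.
Proof.
move=> x0; rewrite /tail addrK fineK; last first.
  by apply: integral_fune_fin_num => //; exact: integrable_tail.
rewrite -[LHS]/(\int[m]_(u in `]x, +oo[%classic) (jump_density u)%:E)%E.
rewrite [LHS]integral_mkcond; apply: eq_integral => u _.
by rewrite epatch_indic -EFinM mulrC.
Qed.

Lemma tail_ge_jump_test a x : 0 < a -> a < x -> \int[m]_u jump_test a x u + c <= tail a.
Proof.
move=> a0 ax; rewrite lerD2r; have [M hM] := jump_test_bounded a0 ax.
apply: le_Rintegral => //; last 2 first.
- exact: integrable_tail.
- move=> u _; have [ua|ua] := leP u a.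
    rewrite jump_test0// mulr_ge0// jump_density_ge0//.
  rewrite indicE mem_set/= ?in_itv/= ?ua// mul1r jump_density_gt0 ?(lt_trans a0)//.
  rewrite /jump_test ler_piMl ?ramp_le1// -jump_density_gt0 ?(lt_trans a0)//.
  exact: jump_density_ge0.
apply: (bounded_integrable (M := M)) => //.
by apply: continuous_measurable_fun; exact: continuous_jump_test.
Qed.

Lemma tail_le_jump_test x b : 0 < x -> x < b -> tail b <= \int[m]_u jump_test x b u + c.
Proof.
move=> x0 xb; rewrite lerD2r; have [M hM] := jump_test_bounded x0 xb.
apply: le_Rintegral => //.
- by apply: integrable_tail; exact: lt_trans xb.
- apply: (bounded_integrable (M := M)) => //.
  by apply: continuous_measurable_fun; exact: continuous_jump_test.
move=> u _; have [ub|ub] := leP u b.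
  rewrite indicE memNset/= ?mul0r ?jump_test_ge0//.
  by rewrite in_itv/= andbT; apply/negP; rewrite -leNgt.
rewrite indicE mem_set/= ?in_itv/= ?ub// mul1r jump_density_gt0 ?(lt_trans x0) ?(lt_trans xb)//.
by rewrite /jump_test ramp1// ?mul1r// ltW.
Qed.

Lemma cvg_tail (y : nat -> R) (B : set R) x : 0 < x -> measurable B ->
  (forall n, x <= y n) ->
  (forall u, (\1_(`]y n, +oo[%classic) u : R) @[n --> \oo] --> (\1_B u : R)) ->
  tail (y n) @[n --> \oo] --> \int[m]_u (\1_B u * jump_density u) + c.
Proof.
move=> x0 mB xy yB; apply: cvgD; last exact: cvg_cst.
have [M M0 hM] := jump_density_bounded x0.
apply: (@Rintegral_dct _ _ _ m setT
  (fun n u => \1_(`]y n, +oo[%classic) u * jump_density u) _ (cst M)) => //.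
- by move=> n; exact: measurable_tail.
- by move=> u _; apply: cvgM; [exact: yB|exact: cvg_cst].
- exact: integrable_bounded_cst.
- by move=> n u _; exact: hM.
Qed.

Lemma tail_right x e : 0 < x -> 0 < e -> exists2 b, x < b & tail x - e <= tail b.
Proof.
move=> x0 e0; pose y (n : nat) := x + n.+1%:R^-1.
have xy n : x < y n by rewrite ltrDl.
have : tail (y n) @[n --> \oo] --> tail x.
  apply: (cvg_tail x0) => //; first by move=> n; exact: ltW.
  move=> u; apply: cvg_near_cst; have [ux|ux] := leP u x.
    near=> n; rewrite !indicE !memNset//=; rewrite in_itv/= andbT; apply/negP; rewrite -leNgt//.
    by rewrite (le_trans ux)// ltW.
  near=> n; rewrite !indicE !mem_set//= ?in_itv/= ?ux//.
  rewrite andbT /y -ltrBrDl; near: n.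
  have ux0 : 0 < u - x by rewrite subr_gt0.
  exact: (near_infty_natSinv_lt (PosNum ux0)).
move=> /cvgrPdist_le/(_ e e0)[n _ /(_ n (leqnn n))] /= H.
exists (y n) => //; by have := ler_norm (tail x - tail (y n)); lra.
Unshelve. all: by end_near.
Qed.

(** From the left the open rays decrease to the closed ray [x, +oo[, which gives the same integral
    when [x] is no atom of [m]. *)
Lemma tail_left x e : 0 < x -> m [set x] = 0%E -> 0 < e ->
  exists2 a, 0 < a < x & tail a <= tail x + e.
Proof.
(* Staying above x / 2 keeps the integrands bounded, as [jump_density] blows up at 0. *)
move=> x0 mx e0; pose y (n : nat) := x - x / 2 * n.+1%:R^-1.
have x20 : 0 < x / 2 by rewrite divr_gt0.
have yx n : y n < x by rewrite /y ltrBlDr ltrDl mulr_gt0.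
have xy n : x / 2 <= y n.
  rewrite /y lerBrDr -lerBrDl (_ : x - x / 2 = x / 2); last by lra.
  by rewrite ler_piMr ?(ltW x20)// invf_le1// ler1n.
have mB : measurable (`[x, +oo[%classic : set R) by [].
have : tail (y n) @[n --> \oo] --> tail x.
  rewrite {2}/tail.
  rewrite (_ : \int[m]_u (\1_(`]x, +oo[%classic) u * jump_density u) =
      \int[m]_u (\1_(`[x, +oo[%classic) u * jump_density u)); last first.
    rewrite /Rintegral; congr fine; apply: ae_eq_integral => //.
    - by apply/measurable_EFinP; exact: measurable_tail.
    - apply/measurable_EFinP; apply: measurable_funM => //; exact: measurable_jump_density.
    exists [set x]; split => //; move=> u /= /not_implyP[_]; apply: contra_notP => ux.
    congr ((_ * _)%:E); rewrite !indicE; congr ((_ : bool)%:R).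
    apply/idP/idP; rewrite !inE/= !in_itv/= !andbT; first exact: ltW.
    by rewrite le_eqVlt => /predU1P[xu|//]; exfalso; apply: ux.
  apply: (cvg_tail x20) => // u; apply: cvg_near_cst; have [ux|ux] := leP x u.
    near=> n; rewrite !indicE !mem_set//= in_itv/= ?ux// andbT.
    exact: lt_le_trans ux.
  have z0 : 0 < (x - u) / (x / 2) by rewrite divr_gt0// subr_gt0.
  near=> n; rewrite !indicE !memNset//=; rewrite in_itv/= andbT; apply/negP; rewrite -?leNgt -?ltNge//.
  rewrite /y lerBrDr -lerBrDl; apply: ltW.
  rewrite mulrC -ltr_pdivlMr//; near: n.
  exact: (near_infty_natSinv_lt (PosNum z0)).
move=> /cvgrPdist_le/(_ e e0)[n _ /(_ n (leqnn n))] /= H.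
exists (y n); first by rewrite yx (lt_le_trans x20)//.
by have := ler_norm (- (tail x - tail (y n))); rewrite normrN; lra.
Unshelve. all: by end_near.
Qed.

Lemma cvg_tail_infty : tail n.+1%:R @[n --> \oo] --> c.
Proof.
rewrite -[X in _ --> X]add0r.
have -> : 0 = \int[m]_u (\1_(set0 : set R) u * jump_density u).
  rewrite -[LHS](mul0r (fine (m setT))) -Rintegral_cst//; apply: eq_Rintegral => u _.
  by rewrite indicE in_set0 mul0r.
apply: (cvg_tail (x := 1)) => //; first by move=> n; rewrite ler1n.
move=> u; apply: cvg_near_cst; near=> n.
rewrite !indicE in_set0 memNset//= in_itv/= andbT; apply/negP; rewrite -leNgt.
near: n; exists (Num.bound `|u|) => // n /= un.
rewrite (le_trans (ler_norm _))// (le_trans (ltW (archi_boundP _)))//.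
by rewrite ler_nat (leq_trans un).
Unshelve. all: by end_near.
Qed.

(** As the ramp shrinks to 0 the test functions tend to (e^{u/2} + 1)^2 on u <= 0 and to 0
    elsewhere; [m] lives on [0, +oo[, so only the value 4 at 0 remains. *)
Lemma variance_test_small e : 0 < e -> exists2 a, 0 < a &
  \int[m]_u variance_test a (2 * a) u <= 4 * fine (m [set 0]) + e.
Proof.
move=> e0; pose a (n : nat) : R := n.+1%:R^-1.
have a0 n : 0 < a n by rewrite invr_gt0.
have a1 n : a n <= 1 by rewrite invf_le1// ler1n.
have ab n : a n < 2 * a n by have := a0 n; lra.
have mf (n : nat) : measurable_fun setT (variance_test (a n) (2 * a n)).
  by apply: continuous_measurable_fun; exact: continuous_variance_test.
pose g (u : R) : R := if u <= 0 then (expR (u / 2) + 1) ^+ 2 else 0.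
have : \int[m]_u variance_test (a n) (2 * a n) u @[n --> \oo] --> \int[m]_u g u.
  apply: (@Rintegral_dct _ _ _ m setT (fun n => variance_test (a n) (2 * a n)) _
    (cst ((expR 1 + 1) ^+ 2))) => //.
  - move=> u _; apply: cvg_near_cst; rewrite /g; have [u0|u0] := leP u 0.
      near=> n; rewrite /variance_test ramp0 ?subr0 ?mul1r//.
      by rewrite (le_trans u0)// ltW.
    have u2 : 0 < u / 2 by rewrite divr_gt0.
    near=> n; rewrite /variance_test ramp1 ?subrr ?mul0r//.
    have : a n < u / 2 by near: n; exact: (near_infty_natSinv_lt (PosNum u2)).
    lra.
  - exact: integrable_bounded_cst.
  - move=> n u _; apply: (le_trans (variance_test_norm u (ab n))).
    rewrite lerXn2r ?nnegrE ?addr_ge0 ?expR_ge0// lerD2r ler_expR.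
    by have := a1 n; lra.
have -> : \int[m]_u g u = 4 * fine (m [set 0]).
  rewrite (@eq_Rintegral_nneg _ m g (fun u => 4 * \1_([set 0]) u))//.
  - rewrite RintegralZl//; last by apply: indic_integrable => //; exact: measurable_set1.
    by rewrite Rintegral_indic//; exact: measurable_set1.
  - apply: measurable_fun_ifT => //; first exact: measurable_fun_ler.
    apply: measurable_funX; apply: measurable_funD => //.
    by apply: measurableT_comp => //; exact: measurable_funM.
  - by apply: measurable_funM => //; apply: measurable_indic; exact: measurable_set1.
  - move=> u; rewrite le_eqVlt => /predU1P[<-|u0].
      rewrite indicE mem_set// mulr1 /g lexx mul0r expR0; ring.
    rewrite /g leNgt u0/= indicE memNset ?mulr0//.
    by move=> /= u00; rewrite u00 ltxx in u0.
move=> /cvgrPdist_le/(_ e e0)[n _ /(_ n (leqnn n))] /= H.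
exists (a n) => //.
have := ler_norm (- (4 * fine (m [set 0]) - \int[m]_u variance_test (a n) (2 * a n) u)).
by rewrite normrN; lra.
Unshelve. all: by end_near.
Qed.

Lemma variance_test_large a b : 0 < a -> a < b ->
  4 * fine (m [set 0]) <= \int[m]_u variance_test a b u.
Proof.
move=> a0 ab; have m1 : measurable [set (0 : R)] by exact: measurable_set1.
rewrite -Rintegral_indic// -RintegralZl//; last exact: indic_integrable.
apply: le_Rintegral => //.
- by have := integrableZl measurableT 4 (indic_integrable mT m1).
- apply: (bounded_integrable (M := (expR (b / 2) + 1) ^+ 2)) => //.
    by apply: continuous_measurable_fun; exact: continuous_variance_test.
  by move=> u; exact: variance_test_norm.
move=> u _; rewrite indicE; have [->|u0] := eqVneq u 0.
  have -> : variance_test a b 0 = 4.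
    by rewrite /variance_test ramp0 ?(ltW a0)// mul0r expR0; ring.
  by rewrite mem_set// mulr1.
by rewrite memNset ?mulr0 ?variance_test_ge0//= => /eqP; exact/negP.
Qed.

End jump_tail.

Lemma cvge_right_of_bounds (R : realType) (f : R -> \bar R) (l : R) :
  (forall e, 0 < e -> \forall x \near (0 : R)^'+, (l%:E <= f x <= (l + e)%:E)%E) ->
  f x @[x --> 0^'+] --> l%:E.
Proof.
move=> H A /nbhs_EFin /nbhs_ballP[e /= e0 eA].
have e20 : 0 < e / 2 by rewrite divr_gt0.
have := H _ e20; apply: filterS => x; rewrite /preimage/=.
case: (f x) => [r| |] /andP[]//; rewrite !lee_fin => lr re.
apply: (eA r); rewrite /ball/= ltr_norml; apply/andP; split; lra.
Qed.

(** * Conditions (a) and (b) in terms of the limit of kap_n *)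

Section limit_conditions.
Context (R : realType) (k : nat -> nat) (d : forall n, 'I_(k n) -> measure_display)
  (T : forall n (i : 'I_(k n)), measurableType (@d n i))
  (P mu : forall n (i : 'I_(k n)), probability (@T n i) R)
  (eps : forall n, 'I_(k n) -> {i01 R}).
Hypothesis muP : forall n i, @mu n i `<< @P n i.
Hypothesis eps0 :
  \big[Num.max/0]_(i < k n) (@eps n i)%:num @[n --> \oo] --> (0 : R).
Local Notation kap n := (hell_measure (@eps n) (@muP n)).
Local Notation L n x := (large_sum P mu eps n x).
Variables (m : {measure set R -> \bar R}) (c : R).
Hypotheses (mT : (m setT < +oo)%E) (m0 : m `]-oo, 0[%classic = 0%E) (c0 : 0 <= c)
  (kaplim : kap_limit eps muP m c).

(** The limiting tail may jump at [x], so the sum is enclosed between tails at neighbouring points,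
    through the two continuous test functions. *)
Lemma near_large_sum a x b e : 0 < a -> a < x -> x < b -> 0 < e ->
  \forall n \near \oo, tail m c b - e <= L n (expR x - 1) <= tail m c a + e.
Proof.
move=> a0 ax xb e0; have x0 := lt_trans a0 ax.
pose x' := (a + x) / 2; have ax' : a < x' by rewrite /x'; lra.
have x'x : x' < x by rewrite /x'; lra.
have [M1 hM1] := jump_test_bounded x0 xb.
have [M2 hM2] := jump_test_bounded a0 ax'.
have H1 := kaplim (continuous_jump_test x0 xb) hM1 (cvgy_jump_test xb).
have H2 := kaplim (continuous_jump_test a0 ax') hM2 (cvgy_jump_test ax').
rewrite mulr1 in H1; rewrite mulr1 in H2.
set l1 := _ + c in H1; set l2 := _ + c in H2.
have hl1 : tail m c b <= l1 by exact: tail_le_jump_test.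
have hl2 : l2 <= tail m c a by exact: tail_ge_jump_test.
have l20 : 0 <= l2.
  by rewrite addr_ge0//; apply: Rintegral_ge0 => u _; exact: jump_test_ge0.
(* [eta] and [delta] are chosen so that (1 + delta)(l2 + eta) <= l2 + e. *)
pose eta := Num.min 1 (e / 2); have eta0 : 0 < eta by rewrite lt_min ltr01 divr_gt0.
have eta1 : eta <= 1 by rewrite ge_min lexx.
have eta2 : eta <= e / 2 by rewrite ge_min lexx orbT.
pose delta := e / 2 / (l2 + 1).
have d0 : 0 < delta by rewrite !divr_gt0// ltr_wpDl.
have dl : delta * (l2 + 1) = e / 2 by rewrite /delta divfK// gt_eqF// ltr_wpDl.
have /cvgrPdist_le/(_ _ e0) N1 := H1; have /cvgrPdist_le/(_ _ eta0) N2 := H2.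
have N3 := near_large_sum_ge muP eps0 x0 xb.
have N4 := near_large_sum_le muP eps0 a0 ax' x'x d0.
near=> n.
have A1 : `|l1 - \int[kap n]_u jump_test x b u| <= e by near: n.
have A2 : `|l2 - \int[kap n]_u jump_test a x' u| <= eta by near: n.
have A3 : \int[kap n]_u jump_test x b u <= L n (expR x - 1) by near: n.
have A4 : L n (expR x - 1) <= (1 + delta) * \int[kap n]_u jump_test a x' u by near: n.
apply/andP; split; first by have := ler_norm (l1 - \int[kap n]_u jump_test x b u); lra.
have A5 : \int[kap n]_u jump_test a x' u <= l2 + eta.
  by have := ler_norm (- (l2 - \int[kap n]_u jump_test a x' u)); rewrite normrN; lra.
have A6 : (1 + delta) * \int[kap n]_u jump_test a x' u <= (1 + delta) * (l2 + eta).
  by rewrite ler_wpM2l// addr_ge0// ltW.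
have A7 : delta * (l2 + eta) <= delta * (l2 + 1) by rewrite ler_wpM2l ?(ltW d0)// lerD2l.
move: A6; rewrite mulrDl mul1r; lra.
Unshelve. all: by end_near.
Qed.

Lemma cvg_large_sum x : 0 < x -> m [set x] = 0%E ->
  L n (expR x - 1) @[n --> \oo] --> tail m c x.
Proof.
move=> x0 mx; apply/cvgrPdist_le => e e0; have e20 : 0 < e / 2 by rewrite divr_gt0.
have [b xb hb] := tail_right c mT x0 e20.
have [a /andP[a0 ax] ha] := tail_left c mT x0 mx e20.
apply: filterS (near_large_sum a0 ax xb e20) => n /andP[h1 h2].
by rewrite ler_norml; apply/andP; split; lra.
Qed.

Lemma near_large_sum_le_cst x : 0 < x -> exists C, \forall n \near \oo, L n x <= C.
Proof.
move=> x0; have y0 : 0 < ln (1 + x) by rewrite ln_gt0// ltrDl.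
have a0 : 0 < ln (1 + x) / 2 by rewrite divr_gt0.
have ay : ln (1 + x) / 2 < ln (1 + x) by lra.
have yb : ln (1 + x) < ln (1 + x) + 1 by rewrite ltrDl.
exists (tail m c (ln (1 + x) / 2) + 1).
apply: filterS (near_large_sum a0 ay yb ltr01) => n /andP[_].
by rewrite lnK ?posrE ?ltr_wpDr// ?[1 + x]addrC ?addrK// ltW.
Qed.

(** The variance test vanishes far to the right, so [c] does not enter the limit; the large signals
    are bounded, which makes the passage from [small_sum] to [sqr_sum] negligible. *)
Lemma near_sqr_sum_bounds a b x e : 0 < x -> 0 < e -> a < b ->
  (1 + x <= expR a -> \forall n \near \oo,
    sqr_sum P mu eps n x <= \int[m]_u variance_test a b u + e) /\
  (0 < a -> expR b - 1 < x -> \forall n \near \oo,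
    \int[m]_u variance_test a b u - e <= sqr_sum P mu eps n x).
Proof.
move=> x0 e0 ab; have [C hC] := near_large_sum_le_cst x0.
have e20 : 0 < e / 2 by rewrite divr_gt0.
pose delta := e / 2 / (`|C| + 1).
have d0 : 0 < delta by rewrite !divr_gt0// ltr_wpDl.
have H := kaplim (continuous_variance_test (a := a) (b := b))
  (fun u => variance_test_norm u ab) (cvgy_variance_test ab).
rewrite mulr0 addr0 in H; have /cvgrPdist_le/(_ _ e20) N1 := H.
have N2 := near_sqr_sum muP eps0 x0 d0.
have base : \forall n \near \oo,
    `|sqr_sum P mu eps n x - small_sum P mu eps n x| <= e / 2.
  apply: filterS2 hC N2 => n h1 h2; apply: (le_trans h2).
  apply: (@le_trans _ _ (delta * (`|C| + 1))).
    by rewrite ler_wpM2l ?(ltW d0)// (le_trans h1)// (le_trans (ler_norm C))// lerDl.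
  by rewrite /delta divfK// gt_eqF// ltr_wpDl.
split=> [ax|a0 bx].
  have N3 := near_small_sum_le muP eps0 ab ax.
  apply: filterS3 base N1 N3 => n; rewrite !ler_norml => /andP[? ?] /andP[? ?] ?; lra.
have N3 := near_small_sum_ge muP eps0 a0 ab bx.
apply: filterS3 base N1 N3 => n; rewrite !ler_norml => /andP[? ?] /andP[? ?] ?; lra.
Qed.

Lemma I2_esup_le a x : 0 < x -> 0 < a -> 1 + x <= expR a ->
  (limn_esup (fun n => I2 (@P n) (@mu n) (@eps n) x) <=
   (\int[m]_u variance_test a (2 * a) u)%:E)%E.
Proof.
move=> x0 a0 ax; apply/lee_addgt0Pr => e e0; apply: limn_esup_le.
have ab : a < 2 * a by lra.
have [/(_ ax) H _] := near_sqr_sum_bounds x0 e0 ab.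
by apply: filterS H => n; rewrite (I2E eps muP n (ltW x0)) -EFinD lee_fin.
Qed.

Lemma I2_einf_ge x : 0 < x ->
  ((4 * fine (m [set 0%R]))%:E <= limn_einf (fun n => I2 (@P n) (@mu n) (@eps n) x))%E.
Proof.
(* e^b - 1 = x / 2 stays below x, which leaves room for eps. *)
move=> x0; pose b := ln (1 + x / 2); pose a := b / 2.
have x2 : 0 < 1 + x / 2 by have := x0; lra.
have b0 : 0 < b by rewrite ln_gt0//; lra.
have a0 : 0 < a by rewrite divr_gt0.
have ab : a < b by rewrite /a; lra.
have bx : expR b - 1 < x by rewrite lnK ?posrE//; lra.
apply/lee_subgt0Pr => e e0; apply: limn_einf_ge.
have [_ /(_ a0 bx) H] := near_sqr_sum_bounds x0 e0 ab.
apply: filterS H => n; rewrite (I2E eps muP n (ltW x0)) -EFinB lee_fin; apply: le_trans.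
by rewrite lerD2r variance_test_large.
Qed.

Lemma limit_condition_b : condition_b P mu eps (4 * fine (m [set 0])).
Proof.
have H e : 0 < e -> \forall x \near (0 : R)^'+,
    ((4 * fine (m [set 0%R]))%:E <= limn_einf (fun n => I2 (@P n) (@mu n) (@eps n) x))%E /\
    (limn_esup (fun n => I2 (@P n) (@mu n) (@eps n) x) <= (4 * fine (m [set 0%R]) + e)%:E)%E.
  move=> e0; have [a a0 ha] := variance_test_small mT m0 e0.
  have ea : 0 < expR a - 1 by rewrite subr_gt0 expR_gt1.
  near=> x; have x0 : 0 < x by [].
  split; first exact: I2_einf_ge.
  apply: (le_trans (I2_esup_le x0 a0 _)); last by rewrite lee_fin.
  by rewrite addrC -lerBrDr; apply: ltW; near: x; exact: nbhs_right_lt.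
split; first by rewrite mulr_ge0// fine_ge0.
- apply: cvge_right_of_bounds => e e0; apply: filterS (H e e0) => x [h1 ->].
  by rewrite (le_trans h1)// limn_einf_sup.
- apply: cvge_right_of_bounds => e e0; apply: filterS (H e e0) => x [-> h1].
  by rewrite (le_trans _ h1)// limn_einf_sup.
Unshelve. all: by end_near.
Qed.

Lemma condition_b_unique sigma2 : condition_b P mu eps sigma2 ->
  sigma2 = 4 * fine (m [set 0]).
Proof.
move=> [_ h _]; have [_ h' _] := limit_condition_b.
suff [] : sigma2%:E = (4 * fine (m [set 0%R]))%:E by [].
exact: (cvg_unique _ h h').
Qed.

Let measurable_EFin : measurable_fun setT (@EFin R).
Proof. by []. Qed.

(** The measure M dictated by the limit: eta_2 - eta_1 on (0, +oo), with mass [c] at +oo. *)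
Definition limit_tail_measure : {measure set (\bar R) -> \bar R} :=
  measure_add (image_measure (tilt_measure m) measurable_EFin)
    (mscale (NngNum c0) (dirac (+oo%E : \bar R))).

Lemma limit_tail_measureE (A : set (\bar R)) : limit_tail_measure A =
  (tilt_measure m (EFin @^-1` A) + c%:E * (\1_A +oo%E)%:E)%E.
Proof. by rewrite -[LHS]/(measure_add _ _ A) measure_addE; congr (_ + _)%E. Qed.

(** The set D consists of the points without mass, where the limiting tail is continuous; it is
    dense because [m] is finite. *)
Lemma limit_condition_a :
  condition_a P mu eps [set x | 0 < x /\ m [set x] = 0%E] limit_tail_measure.
Proof.
split.
- split; first by move=> x [].
  move=> x /= x0 B /nbhs_ballP[e /= e0 eB].
  have xe : x < x + e by rewrite ltrDl.
  have [y /andP[xy ye] my] := exists_null_point mT xe.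
  exists y; split; first by split=> //; exact: lt_trans xy.
  by apply: eB; rewrite /ball/= ltr_norml; apply/andP; split; lra.
- rewrite limit_tail_measureE indicE memNset/=; last by rewrite leNgt ltry.
  rewrite mule0 adde0.
  rewrite -[LHS]/(\int[m]_(u in EFin @^-1` [set y | (y <= 0)%E]) (jump_density u)%:E)%E.
  rewrite (eq_integral (cst 0%E)) ?integral0// => u; rewrite inE/= lee_fin => u0.
  by rewrite jump_density_le0.
- move=> x [x0 mx].
  have E : limit_tail_measure [set y | (x%:E < y)%E] = (tail m c x)%:E.
    rewrite limit_tail_measureE indicE mem_set ?mule1; last by rewrite /= ltry.
    rewrite (_ : _ @^-1` _ = `]x, +oo[%classic).
      by rewrite (tilt_measure_ray c mT x0) -EFinD subrK.
    by apply/seteqP; split => u /=; rewrite in_itv/= andbT lte_fin.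
  rewrite E ltry; split => //.
  under eq_fun do rewrite (I1E eps muP).
  by apply: cvg_EFin; [exact: nearW|exact: cvg_large_sum].
Qed.

Section given_condition_a.
Variables (D : set R) (M : {measure set (\bar R) -> \bar R}).
Hypothesis condM : condition_a P mu eps D M.

Lemma measurable_gt (y : R) : measurable [set z : \bar R | (y%:E < z)%E].
Proof. by rewrite -[X in measurable X]setTI; apply: emeasurable_fun_lt. Qed.

(** [D] and [M] are arbitrary here. As [D] may contain atoms of [m], where [cvg_large_sum] does not
    apply, tails at neighbouring points bound M from both sides. *)
Lemma condition_a_bounds a x b : D x -> 0 < a -> a < x -> x < b ->
  ((tail m c b)%:E <= M [set y | x%:E < y] <= (tail m c a)%:E)%E.
Proof.
move=> Dx a0 ax xb; have [_ _ /(_ x Dx)[+ Mfin]] := condM.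
have Mfin' : M [set z | (x%:E < z)%E] \is a fin_num by rewrite ge0_fin_numE.
under eq_fun do rewrite (I1E eps muP).
rewrite -(fineK Mfin') => /fine_cvg H; rewrite !lee_fin.
apply/andP; split.
  apply/ler_addgt0Pr => e e0; rewrite -lerBlDr.
  apply: (cvgr_to_ge H); apply: filterS (near_large_sum a0 ax xb e0) => n /andP[h _].
  exact: h.
apply/ler_addgt0Pr => e e0.
by apply: (cvgr_to_le H); apply: filterS (near_large_sum a0 ax xb e0) => n /andP[].
Qed.

(** Both sides are right-continuous in y, so the bounds at nearby points of [D] determine M at every
    y > 0, in [D] or not. *)
Lemma condition_a_tail y : 0 < y -> M [set z | (y%:E < z)%E] = (tail m c y)%:E.
Proof.
move=> y0; have [Dd _ _] := condM; apply/eqP; rewrite eq_le; apply/andP; split; last first.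
  apply/lee_subgt0Pr => e e0; have [b yb hb] := tail_right c mT y0 e0.
  have [x Dx /andP[yx xb]] := dense_in_pos_itv Dd (ltW y0) yb.
  have /andP[h _] := condition_a_bounds Dx y0 yx xb.
  apply: (@le_trans _ _ (tail m c b)%:E); first by rewrite -EFinB lee_fin.
  apply: (le_trans h); apply: le_measure; rewrite ?inE; [exact: measurable_gt..|].
  by move=> z /=; apply: lt_trans; rewrite lte_fin.
pose F (n : nat) := [set z : \bar R | ((y + n.+1%:R^-1)%:E < z)%E].
have FE : [set z | (y%:E < z)%E] = \bigcup_n F n.
  apply/seteqP; split => [[z| |]|z [n _]] //=.
  - rewrite lte_fin => yz; have zy0 : 0 < z - y by rewrite subr_gt0.
    have [n _ /(_ n (leqnn n)) /= h] := near_infty_natSinv_lt (PosNum zy0).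
    by exists n => //; rewrite /F/= lte_fin -ltrBrDl.
  - by exists 0 => //; rewrite /F/= ltry.
  - by rewrite /F/=; apply: lt_trans; rewrite lte_fin ltrDl.
have H : M (F n) @[n --> \oo] --> M (\bigcup_n F n).
  apply: nondecreasing_cvg_mu => //.
  - by move=> n; exact: measurable_gt.
  - by apply: bigcup_measurable => n _; exact: measurable_gt.
  move=> i j ij; apply/subsetPset => z /=; apply: le_lt_trans.
  by rewrite lee_fin lerD2l lef_pV2 ?posrE// ler_nat.
rewrite FE; apply: (cvge_to_le H); apply: nearW => n.
have yn : y < y + n.+1%:R^-1 by rewrite ltrDl.
have [x Dx /andP[yx xn]] := dense_in_pos_itv Dd (ltW y0) yn.
have x1 : x < x + 1 by rewrite ltrDl.
have /andP[_] := condition_a_bounds Dx y0 yx x1; apply: le_trans.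
apply: le_measure; rewrite ?inE; [exact: measurable_gt..|].
by move=> z /=; apply: lt_trans; rewrite lte_fin.
Qed.

Lemma condition_a_infty : M [set +oo%E] = c%:E.
Proof.
pose F (n : nat) := [set z : \bar R | (n.+1%:R%:E < z)%E].
have FE : [set +oo%E] = \bigcap_n F n.
  apply/seteqP; split => [_ -> n _|[z| |] h] //=; first by rewrite /F/= ltry.
    have := h (Num.bound `|z|) I; rewrite /F/= lte_fin ltNge.
    rewrite (le_trans (ler_norm z))// (le_trans (ltW (archi_boundP _)))//.
    by rewrite ler_nat.
  by have := h 0 I.
have H : M (F n) @[n --> \oo] --> M (\bigcap_n F n).
  apply: nonincreasing_cvg_mu => //.
  - by rewrite [M _]condition_a_tail// ltry.
  - by move=> n; exact: measurable_gt.
  - by apply: bigcap_measurable => // n _; exact: measurable_gt.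
  move=> i j ij; apply/subsetPset => z /=; apply: le_lt_trans.
  by rewrite lee_fin ler_nat.
rewrite FE; apply: (cvg_unique _ H) => //.
rewrite (_ : (fun n => _) = (fun n => (tail m c n.+1%:R)%:E)); last first.
  by apply/funext => n; rewrite condition_a_tail.
by apply: cvg_EFin; [exact: nearW|exact: cvg_tail_infty].
Qed.

Lemma condition_a_ray x : 0 < x ->
  restr_R M `]x, +oo[%classic = tilt_measure m `]x, +oo[%classic.
Proof.
move=> x0; rewrite (tilt_measure_ray c)//.
have := condition_a_tail x0.
have mr : measurable (EFin @` `]x, +oo[%classic) by apply: measurable_image_EFin; exact: measurable_itv.
rewrite (_ : [set z | (x%:E < z)%E] = (EFin @` `]x, +oo[%classic) `|` [set +oo%E]); last first.
  apply/seteqP; split => [[z| |]|z] //=.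
  - by rewrite lte_fin => xz; left; exists z => //; rewrite in_itv/= xz.
  - by move=> _; right.
  - by case=> [[u]|->]; rewrite ?ltry// in_itv/= andbT => xu <-; rewrite lte_fin.
rewrite measureU//; last first.
  by apply/seteqP; split => // z [[u _ <-]].
move=> h; have h' : (restr_R M `]x, +oo[%classic + c%:E = (tail m c x)%:E)%E.
  by rewrite -h; congr (_ + _)%E; exact/esym/condition_a_infty.
by rewrite EFinB -h' addeK.
Qed.

(** Both measures may be infinite near 0; they are compared on the rays from 1/(n+1), where they are
    finite and determined by their tails, and these rays exhaust (0, +oo). *)
Lemma condition_a_measure (A : set R) : measurable A -> A `<=` [set x | 0 < x] ->
  M (EFin @` A) = tilt_measure m A.
Proof.
move=> mA A0; pose B (n : nat) := (`]n.+1%:R^-1, +oo[%classic : set R).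
have mB n : measurable (B n) by exact: measurable_itv.
have restr n (C : set R) : measurable C -> restr_R M (C `&` B n) = tilt_measure m (C `&` B n).
  move=> mC; pose m1 : {measure set R -> \bar R} := mrestr (restr_R M) (mB n).
  pose m2 : {measure set R -> \bar R} := mrestr (tilt_measure m) (mB n).
  apply: (@measure_eq_rays _ m1 m2) => //.
    rewrite [m1 _](_ : _ = restr_R M (B n)); last by rewrite /m1/= /mrestr setTI.
    by rewrite condition_a_ray// (tilt_measure_ray c)// ltry.
  move=> a; rewrite /m1 /m2/= /mrestr.
  rewrite (_ : _ `&` _ = `]Num.max a n.+1%:R^-1, +oo[%classic).
    by rewrite condition_a_ray// lt_max invr_gt0 ltr0n orbT.
  apply/seteqP; split => u; rewrite /B/= !in_itv/= !andbT gt_max; first by move=> [-> ->].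
  by move/andP.
have AE : A = \bigcup_n (A `&` B n).
  rewrite -setI_bigcupr; apply/seteqP; split => [x Ax|x []//]; split => //.
  have x0 : 0 < x := A0 x Ax.
  have [n _ /(_ n (leqnn n)) /= h] := near_infty_natSinv_lt (PosNum x0).
  by exists n => //; rewrite /B/= in_itv/= andbT.
have lim (rho : {measure set R -> \bar R}) : rho (A `&` B n) @[n --> \oo] --> rho A.
  rewrite {2}AE; apply: nondecreasing_cvg_mu => //.
  - by move=> n; exact: measurableI.
  - by apply: bigcup_measurable => n _; exact: measurableI.
  move=> i j ij; apply/subsetPset => x [Ax]; rewrite /B/= in_itv/= andbT => h; split => //=.
  by rewrite in_itv/= andbT (le_lt_trans _ h)// lef_pV2 ?posrE// ler_nat.
rewrite -[LHS]/(restr_R M A); apply: (cvg_unique _ (lim (restr_R M))) => //.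
rewrite (_ : (fun n => _) = (fun n => tilt_measure m (A `&` B n))); first exact: lim.
by apply/funext => n; exact: restr.
Qed.

End given_condition_a.

End limit_conditions.

(** * Real-valued limits, and the relations between the triplets *)

Lemma ae_fin_numP d (Om : measurableType d) (R : realType) (W : probability Om R)
    (xi : {RV W >-> \bar R}) :
  {ae W, forall w, xi w \is a fin_num} <-> restr_R (distribution W xi) setT = 1%E.
Proof.
pose A := xi @^-1` range EFin.
have mR : measurable (range (@EFin R)) by apply: measurable_image_EFin; exact: measurableT.
have mA : measurable A by rewrite -[A]setTI; exact: (measurable_funPT xi).
have AE w : A w <-> xi w \is a fin_num.
  split=> [[x _ <-]//|xw]; by exists (fine (xi w)) => //; rewrite fineK.
rewrite -[restr_R _ _]/(W A); split=> [[N [mN N0 AN]]|WA].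
  have WAC : W (~` A) = 0%E.
    apply/eqP; rewrite -measure_le0 -N0; apply: le_measure; rewrite ?inE//.
      exact: measurableC.
    by move=> w Aw; apply: AN => /= xw; apply: Aw; exact/AE.
  have fA : W A \is a fin_num by exact: fin_num_measure.
  move: WAC; rewrite probability_setC// -(fineK fA) -EFinB => -[] /eqP.
  by rewrite subr_eq0 => /eqP <-.
exists (~` A); split; [exact: measurableC| |].
  by rewrite probability_setC// [W A]WA subee.
by move=> w /= xw Aw; apply: xw; exact/AE.
Qed.

Theorem theorem2p4 (R : realType)
    (k : nat -> nat) (d : forall n, 'I_(k n) -> measure_display)
    (T : forall n (i : 'I_(k n)), measurableType (d n i))
    (P mu : forall n (i : 'I_(k n)), probability (T n i) R)
    (eps : forall n, 'I_(k n) -> {i01 R})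
    (d1 d2 : measure_display)
    (Om1 : measurableType d1) (Om2 : measurableType d2)
    (W1 : probability Om1 R) (W2 : probability Om2 R)
    (xi1 : {RV W1 >-> \bar R}) (xi2 : {RV W2 >-> \bar R}) :
  let nu1 := distribution W1 xi1 in
  let nu2 := distribution W2 xi2 in
  k @ \oo --> \oo ->
  (forall n i, mu n i `<< P n i) ->
  \big[Num.max/0]_(i < k n) (eps n i)%:num @[n --> \oo] --> (0 : R) ->
  cvg_in_distribution (fun n => null_law (P n))
    (fun n => loglik (P n) (mu n) (eps n)) nu1 ->
  cvg_in_distribution (fun n => alt_law (P n) (mu n) (eps n))
    (fun n => loglik (P n) (mu n) (eps n)) nu2 ->
  ({ae W1, forall w, xi1 w \is a fin_num} <->
    (exists (D : set R) (M : {measure set (\bar R) -> \bar R}),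
      condition_a P mu eps D M) /\
    (exists sigma2 : R, condition_b P mu eps sigma2)) /\
  (forall (D : set R) (M : {measure set (\bar R) -> \bar R}) (sigma2 : R),
    condition_a P mu eps D M -> condition_b P mu eps sigma2 ->
    [/\ nu2 (range EFin) = expeR (- M [set +oo%E])%E,
      exists (gamma1 sigma12 : R) (eta1 : {measure set R -> \bar R}),
        levy_khintchine_triplet (restr_R nu1) gamma1 sigma12 eta1,
      exists (gamma2 sigma22 : R) (eta2 : {measure set R -> \bar R}),
        levy_khintchine_triplet (normalized_restr_R nu2) gamma2 sigma22 eta2 &
      forall (gamma1 sigma12 : R) (eta1 : {measure set R -> \bar R})
          (gamma2 sigma22 : R) (eta2 : {measure set R -> \bar R}),
        levy_khintchine_triplet (restr_R nu1) gamma1 sigma12 eta1 ->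
        levy_khintchine_triplet (normalized_restr_R nu2) gamma2 sigma22 eta2 ->
        [/\ sigma2 = sigma12, sigma2 = sigma22 &
          forall A : set R, measurable A -> A `<=` [set x | 0 < x] ->
            eta2 A = (eta1 A + M (EFin @` A))%E]]).
Proof.
move=> nu1 nu2 _ muP eps0 cvg1 cvg2.
have tilt : tilt_of (restr_R nu1) (restr_R nu2).
  by move=> h; exact: (tilting_limit muP eps0 cvg1 cvg2).
have r1T := restr_R_setT_lty nu1; have r2T := restr_R_setT_lty nu2.
have limit C := @full_limit R k d T P mu eps nu1 nu2 muP eps0 cvg1 cvg2 C.
split; first split.
- move=> /ae_fin_numP nu1_1.
  have [|C kapC] := kap_bounded_of_mass muP eps0 cvg1 cvg2.
    by rewrite [restr_R nu1 setT]nu1_1.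
  have [m [c [mT m0 c0 _ kaplim]]] := limit C kapC.
  split; last by exists (4 * fine (m [set 0])); exact: (limit_condition_b eps0 mT m0 c0 kaplim).
  exists [set x | 0 < x /\ m [set x] = 0%E], (limit_tail_measure m c0).
  exact: (limit_condition_a eps0 mT c0 kaplim).
(* Boundedness of the masses of kap_n is all that is taken from (a) and (b) here; the strip identity
   at t = 0 then gives nu_1 full mass on R. *)
- move=> [[D [M ca]] [s2 cb]]; apply/ae_fin_numP.
  have [C kapC] := kap_bounded_of_conditions muP eps0 ca cb.
  have [m [c [mT m0 _ strip _]]] := limit C kapC.
  exact: (rho1_setT r1T r2T mT m0 strip tilt).
move=> D M s2 ca cb.
have [C kapC] := kap_bounded_of_conditions muP eps0 ca cb.
have [m [c [mT m0 c0 strip kaplim]]] := limit C kapC.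
have s2E := condition_b_unique eps0 mT m0 c0 kaplim cb.
have nu2E := rho2_setT r1T r2T mT m0 strip tilt.
have [g1 lk1] := levy_khintchine_rho1 r1T r2T mT m0 strip tilt.
have [g2 lk2] : exists gamma, levy_khintchine_triplet (normalized_restr_R nu2) gamma
    (4 * fine (m [set 0])) (levy_of m 1).
  (* The normalising constant is the inverse of the mass e^{-c}, that is, e^c. *)
  apply: (levy_khintchine_rho2 r1T r2T mT m0 strip tilt).
  rewrite -[LHS]/((fine (restr_R nu2 setT))^-1) [restr_R nu2 setT]nu2E.
  by rewrite /= expRN invrK.
split.
- rewrite (condition_a_infty eps0 mT c0 kaplim ca) /=.
  exact: nu2E.
- exists g1, (4 * fine (m [set 0])), (levy_of m 0); exact: lk1.
- exists g2, (4 * fine (m [set 0])), (levy_of m 1); exact: lk2.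
move=> gam1 s12 eta1 gam2 s22 eta2 lk1' lk2'.
(* Any given triplets share variance and Levy measure with the constructed ones, for which the
   relations hold by construction. *)
have [e1 eq1] := levy_khintchine_unique lk1 lk1'.
have [e2 eq2] := levy_khintchine_unique lk2 lk2'.
split; rewrite ?s2E// => A mA A0.
rewrite -eq1// -eq2// levy_of1E//; congr (_ + _)%E.
by rewrite (condition_a_measure eps0 mT c0 kaplim ca).
Qed.
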